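(* Let $G$ be a hyperbolic group acting properly and cocompactly on a finite dimensional CAT(0) cube complex $X$. Let $H\le G$ be a finitely presented subgroup. Then the following are equivalent: (1) The subgroup $H$ is quasiconvex in $G$. (2) For all $t\in \hat{\mathcal{I}}$, the group $\mathrm{Stab}_H(t)$ is finitely presented. (3) For all hyperplanes $k\in\hat{\mathcal H}$, the subgroup $\mathrm{Stab}_H(k)$ is quasiconvex in $G$. (4) The subgroup $H$ is hyperbolic and for all hyperplanes $k\in\hat{\mathcal H}$, the subgroup $\mathrm{Stab}_H(k)$ is quasiconvex in $H$.
   Context: Here $\hat{\mathcal H}$ is the set of hyperplanes of $X$, and $\hat{\mathcal I}=\{\bigcap_{i=1}^n \hat h_i\neq\emptyset \mid n\ge 0,\ (\hat h_1,\dots,\hat h_n)\in\hat{\mathcal H}^n\}$ is the set of non-empty intersections of finite collections of (pairwise transverse) hyperplanes, where the empty intersection ($n=0$) is $X$ itself. $\mathrm{Stab}_H(t)$ denotes the subgroup of elements of $H$ that preserve the subset $t\subseteq X$ (setwise stabilizer). Groups act on cube complexes by cubical automorphisms. *)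

(* Defs.v *)
From Stdlib Require Export Relations.
From mathcomp Require Export all_boot all_order all_algebra.
From mathcomp Require Export boolp classical_sets cardinality reals.

Set Implicit Arguments.
Unset Strict Implicit.
Unset Printing Implicit Defensive.

Local Open Scope classical_set_scope.

               

                                                                           
                                                                             
                                                                   
Section Groups.
Local Open Scope group_scope.
Variable G : groupType.
Implicit Types (H K S : set G) (g h : G).

Definition subgroup H : Prop :=
  [/\ H 1, forall g h, H g -> H h -> H (g * h) & forall g, H g -> H g^-1].

                                                                                
Definition word_ball S (n : nat) : set G :=
  [set g | exists w : seq G, [/\ (size w <= n)%N,
     forall x, x \in w -> S x \/ S x^-1 & g = \prod_(x <- w) x]].

Definition generates S H : Prop := H = \bigcup_n word_ball S n.

                                                                          
                   
Definition word_dist_le S (n : nat) g h : Prop := word_ball S n (g^-1 * h).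

                                                                               
                                                              
Definition geodesic S (n : nat) (p : nat -> G) : Prop :=
  forall i j, (i <= j <= n)%N ->
    word_dist_le S (j - i) (p i) (p j) /\
    (forall m, word_dist_le S m (p i) (p j) -> (j - i <= m)%N).

Definition geodesic_between S g h (n : nat) (p : nat -> G) : Prop :=
  [/\ geodesic S n p, p 0 = g & p n = h].

                                                                             
Definition slim_triangles S H (delta : nat) : Prop :=
  forall x y z nxy nyz nxz pxy pyz pxz,
    H x -> H y -> H z ->
    geodesic_between S x y nxy pxy ->
    geodesic_between S y z nyz pyz ->
    geodesic_between S x z nxz pxz ->
    forall i, (i <= nxy)%N ->
      (exists2 j, (j <= nyz)%N & word_dist_le S delta (pxy i) (pyz j)) \/
      (exists2 j, (j <= nxz)%N & word_dist_le S delta (pxy i) (pxz j)).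

Definition hyperbolic H : Prop :=
  exists S, [/\ finite_set S, generates S H &
    exists delta, slim_triangles S H delta].

                                                                              
                                                                
Definition quasiconvex K H : Prop :=
  exists S, [/\ finite_set S, generates S H & K `<=` H /\
    exists C : nat, forall g h n p, K g -> K h ->
      geodesic_between S g h n p ->
      forall i, (i <= n)%N -> exists2 k, K k & word_dist_le S C (p i) k].

                                                                         
Definition word (n : nat) : Type := seq ('I_n * bool).

Definition word_eval n (s : 'I_n -> G) (w : word n) : G :=
  \prod_(l <- w) (if l.2 then s l.1 else (s l.1)^-1).

Inductive word_step n (rels : seq (word n)) : word n -> word n -> Prop :=
| step_cancel u v i b :
    word_step rels (u ++ [:: (i, b); (i, ~~ b)] ++ v) (u ++ v)
| step_relator u v r :
    r \in rels -> word_step rels (u ++ r ++ v) (u ++ v).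

                                                 
Definition finitely_presented H : Prop :=
  exists (n : nat) (s : 'I_n -> G) (rels : seq (word n)),
    H = range (word_eval s) /\
    forall w, word_eval s w = 1 <->
              clos_refl_sym_trans _ (word_step rels) w [::].

End Groups.

                       

Definition hypercube (n : nat) : Type := {ffun 'I_n -> bool}.

                                                                               
Definition face n (J : {set 'I_n}) (a : hypercube n) : set (hypercube n) :=
  [set x | forall i, i \in J -> x i = a i].

                                                                               
                                                                            
                            
Definition cube_chart (V : Type) (cube : set (set V)) (c : set V)
    n (f : hypercube n -> V) : Prop :=
  [/\ injective f, range f = c &
    forall d, (cube d /\ d `<=` c) <-> exists J a, d = f @` face J a].

                                                                              
                                              
Record cubeComplex := CubeComplex {
  vertex :> Type;
  cube : set (set vertex);
  cube1 : forall v, cube [set v];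
  cubeI : forall c d, cube c -> cube d -> c `&` d !=set0 -> cube (c `&` d);
  cubeP : forall c, cube c ->
    exists n (f : hypercube n -> vertex), cube_chart cube c f
}.

Section CubeComplexes.
Variable X : cubeComplex.
Implicit Types (v w : X) (e : set X).

Definition chart (c : set X) n (f : hypercube n -> X) : Prop := cube_chart (@cube X) c f.

Definition finite_dimensional : Prop :=
  exists N, forall c n (f : hypercube n -> X), chart c f -> (n <= N)%N.

Definition adjacent v w : Prop := v <> w /\ cube [set v; w].

                                                               
Definition square (a b c d : X) : Prop :=
  cube [set x | [\/ x = a, x = b, x = c | x = d]] /\
  [/\ adjacent a b, adjacent b c, adjacent c d & adjacent d a] /\
  a <> c /\ b <> d.

Fixpoint edge_path v (p : seq X) : Prop :=
  if p is w :: q then adjacent v w /\ edge_path w q else True.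

                                                                        
Inductive homotopy_step : seq X -> seq X -> Prop :=
| step_backtrack p q v w : adjacent v w ->
    homotopy_step (p ++ [:: v; w; v] ++ q) (p ++ v :: q)
| step_square p q a b c d : square a b c d ->
    homotopy_step (p ++ [:: a; b; c] ++ q) (p ++ [:: a; d; c] ++ q).

Definition edge_connected : Prop :=
  forall v w, exists2 p, edge_path v p & last v p = w.

Definition simply_connected : Prop :=
  [/\ exists v : X, True, edge_connected &
    forall v p, edge_path v p -> last v p = v ->
      clos_refl_sym_trans _ homotopy_step (v :: p) [:: v]].

                                                                            
                        
Definition link_simplex v (A : set X) : Prop :=
  exists c, [/\ cube c, c v & A = [set w | adjacent v w /\ c w]].

Definition flag_link v : Prop :=
  forall A : set X, finite_set A -> A `<=` adjacent v ->
    (forall w w', A w -> A w' -> w <> w' -> link_simplex v [set w; w']) ->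
    link_simplex v A.

Definition CAT0 : Prop := simply_connected /\ forall v, flag_link v.

                                               

Variable R : realType.
Local Open Scope ring_scope.

Definition unit_cube n (p : 'I_n -> R) : Prop := forall i, 0 <= p i <= 1.

                                                                              
                                                                        
                                                                              
                                                                              
                                                                       
Definition chart_point n (f : hypercube n -> X) (p : 'I_n -> R) : X -> R :=
  fun v => \sum_(x : {ffun 'I_n -> bool} | `[< f x = v >])
             \prod_(i < n) (if x i then p i else 1 - p i).

Definition realization : set (X -> R) :=
  [set w | exists c n (f : hypercube n -> X) p,
     [/\ chart c f, unit_cube p & w = chart_point f p]].

                                              
Definition opposite (e e' : set X) : Prop :=
  exists a b c d, [/\ square a b c d, e = [set a; b] & e' = [set d; c]].

Definition parallel : set X -> set X -> Prop := clos_refl_sym_trans _ opposite.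

                                                                               
Definition dual_hyperplane e : set (X -> R) :=
  [set w | exists c n (f : hypercube n -> X) p i,
     [/\ chart c f, unit_cube p, p i = 2^-1, w = chart_point f p &
         exists a, parallel e (f @` face [set~ i]%SET a)]].

Definition hyperplane (k : set (X -> R)) : Prop :=
  exists v w, adjacent v w /\ k = dual_hyperplane [set v; w].

                                                                          
Definition hyperplane_intersection (t : set (X -> R)) : Prop :=
  exists n (h : 'I_n -> set (X -> R)),
    [/\ forall i, hyperplane (h i),
        t = realization `&` \bigcap_(i in [set: 'I_n]) h i & t !=set0].

End CubeComplexes.

                                         

Record cubicalAction (G : groupType) (X : cubeComplex) := CubicalAction {
  act :> G -> X -> X;
  act1 : forall v, act 1%g v = v;
  actM : forall g h v, act (g * h)%g v = act g (act h v);
  act_cube : forall g c, cube c -> cube (act g @` c)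
}.

Section Actions.
Variables (G : groupType) (X : cubeComplex) (a : cubicalAction G X).

                                                                               
                                                                           
           
Definition proper_action : Prop :=
  forall A : set X, finite_set A -> finite_set [set g | a g @` A `&` A !=set0].

Definition cocompact_action : Prop :=
  exists F : set (set X), [/\ finite_set F, F `<=` @cube X &
    forall c, cube c -> exists g d, F d /\ c = a g @` d].

Variable R : realType.

Definition act_point (g : G) (w : X -> R) : X -> R := fun v => w (a g^-1%g v).

Definition stab (H : set G) (t : set (X -> R)) : set G :=
  [set g | H g /\ act_point g @` t = t].

End Actions.

(* Main.v *)
(* The whole argument is coarse geometry in the Cayley graph of G.  By
   Svarc-Milnor, the carriers of hyperplanes become uniformly quasiconvex subsets
   of G, only finitely many of them meet a given ball, and two far apart elements
   are separated by many.  The heart is a criterion: if L stabilises a family T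
   of pairwise crossing hyperplanes, is finitely generated, and Stab_L(k) is
   quasiconvex for every hyperplane k crossing all of T, then L is quasiconvex.
   Starting from points, induction on the codimension turns finite generation of
   all Stab_H(t) into quasiconvexity of all of them, H included; with T empty the
   criterion also yields (3) => (1).  In a hyperbolic group, coarse intersections
   of quasiconvex subgroups are quasiconvex, and quasiconvex subgroups are finitely
   presented because projected geodesics form a fellow-travelling combing; applied
   to G and to H this gives (1) => (2) and (4) => (2).

   The cubical input is that the 1-skeleton of X is bipartite and satisfies the
   quadrangle condition.  This follows from uniqueness of reduced edge paths up to
   swaps across squares, proved by van der Waerden's trick: prepending a vertex
   acts on classes of reduced paths compatibly with elementary homotopies. *)

(* Finite generation of [L] provides paths of [L] with bounded steps but no control of their length,
   so nothing metric can be read off them; what survives is the side of each wall on which their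
   points lie. This is why the criterion argues with two walls and with first and last crossings
   instead of distances. It may restrict itself to walls crossing all of [T] because a wall that
   does not, and yet separates two points near every wall of [T], passes close to one of them, and a
   long geodesic meets too many walls for all of them to be close to an end. Condition (2) speaks of
   setwise stabilisers, whereas the induction runs on pointwise stabilisers of families of walls;
   these have finite index, so connectedness by bounded steps passes down to them. Hyperbolicity is
   used through the four-point inequality and through points almost between two others, which avoids
   choosing geodesics. Walls are handled combinatorially, as parallelism classes of edges; the
   realization serves only to translate the statement. *)
From HB Require Import structures.
Require Import Defs.
From mathcomp Require Import zify.

Set Implicit Arguments.
Unset Strict Implicit.
Unset Printing Implicit Defensive.

Local Open Scope classical_set_scope.

(** * Quasigeodesics in hyperbolic metrics *)

Section NatMetric.
Variables (V : Type) (d : V -> V -> nat).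

Definition geodesic_metric : Prop :=
  [/\ forall x, d x x = 0, forall x y, d x y = d y x,
      forall x y z, d x z <= d x y + d y z &
      forall x y i, i <= d x y -> exists2 z, d x z = i & d z y = d x y - i].

Definition four_point (dl : nat) : Prop :=
  forall x y z w,
    d x y + d z w <= maxn (d x z + d y w) (d x w + d y z) + dl.

(** Twice the Gromov product of [x] and [y] at [v] is at most [k]; this stands in for [v] being near
    a geodesic from [x] to [y]. *)
Definition btw (k : nat) x v y : Prop := d x v + d v y <= d x y + k.

End NatMetric.

Lemma linear_le_exp (A B : nat) :
  exists q0, forall q, q0 <= q -> A * q + B <= 2 ^ q.
Proof.
pose m := 2 * A + B; exists (2 * m).
elim=> [|q IH] hq.
  have -> : B = 0 by move: hq; rewrite /m; lia.
  by rewrite muln0.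
case: (ltnP q (2 * m)) => hq2; last first.
  have := IH hq2; rewrite expnS.
  have : A <= 2 ^ q by apply: leq_trans (ltnW (ltn_expl q (isT : 1 < 2))); lia.
  by lia.
have -> : q.+1 = m + m by lia.
rewrite expnD; have hm := ltn_expl m (isT : 1 < 2).
have h2 : m.+1 * m.+1 <= 2 ^ m * 2 ^ m by apply: leq_mul.
apply: leq_trans h2; rewrite /m; nia.
Qed.

(** The scale from which the logarithmic estimate of [log_path] beats linear growth. The summand 2
    is the gain: it improves a bound [D] on distances to [D - 1]. *)
Lemma linear_le_exp_log (A B C e : nat) :
  exists D0, forall D, D0 < D -> exists2 N, A * D + B <= 2 ^ N & C + N * e + 2 <= 2 * D.
Proof.
have [q0 hq0] := linear_le_exp (A * e.+1) (A * e.+1 + B).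
(* With this [N] the product [N * e] is at most [D], which leaves another [D] for the constants,
   while [2 ^ N] is still exponential in [D]. *)
exists (q0 * e.+1 + C + 2) => D hD; exists (D %/ e.+1).
  have := hq0 (D %/ e.+1).
  rewrite leq_divRL //; have := divn_eq D e.+1; have := ltn_pmod D (ltn0Sn e).
  set q := D %/ _; set r := D %% _ => hr hDe; move/(_ ltac:(lia)) => h.
  apply: leq_trans h; rewrite hDe.
  have : A * (q * e.+1 + r) <= A * (q * e.+1 + e.+1) by rewrite leq_mul2l; apply/orP; right; lia.
  nia.
have := leq_divM D e.+1; nia.
Qed.

Section Hyperbolic.
Variables (V : Type) (d : V -> V -> nat) (dl : nat).
Hypothesis dM : geodesic_metric d.
Hypothesis d4 : four_point d dl.
Local Notation btw := (btw d).

Let d0 x : d x x = 0. Proof. by case: dM. Qed.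
Let dC x y : d x y = d y x. Proof. by case: dM. Qed.
Let dT x y z : d x z <= d x y + d y z. Proof. by case: dM. Qed.

(** Thin triangles: a point near one side is near one of the other two, at the cost of [dl]. *)
Lemma btw_split k x v y z : btw k x v y -> btw (k + dl) x v z \/ btw (k + dl) z v y.
Proof.
rewrite /btw => h; have := d4 x y v z.
rewrite (dC z y) (dC z v) (dC y v).
by have := dC v z; lia.
Qed.

Lemma btwC k x v y : btw k x v y -> btw k y v x.
Proof. by rewrite /btw (dC y v) (dC v x) (dC y x); lia. Qed.

Lemma btw_point k x v y i : btw k x v y -> d x v = i ->
  exists2 u, btw 0 x u y & d u v <= k + dl /\ (d x u <= i).
Proof.
move=> h hi; case: (leqP i (d x y)) => hle.
  case: dM => _ _ _ /(_ x y i hle) [u hu1 hu2].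
  exists u; first by rewrite /btw; lia.
  split; last lia.
  have := d4 x y u v; move: h; rewrite /btw (dC v y) (dC u y) in hu2 *; lia.
exists y; first by rewrite /btw d0; lia.
by split; [rewrite dC|]; move: h; rewrite /btw; lia.
Qed.

Lemma btw_close k x v u y t : btw k x v y -> btw k x u y ->
  d x u <= d x v + t -> d x v <= d x u + t -> d u v <= t + k + dl.
Proof.
rewrite /btw => hv hu h1 h2; have := d4 x y u v.
rewrite (dC y v) (dC y u); lia.
Qed.

Lemma btw_shift k x v y x' y' v' a b c : btw k x v y ->
  d x x' <= a -> d y y' <= b -> d v v' <= c -> btw (k + 2 * a + 2 * b + 2 * c) x' v' y'.
Proof.
rewrite /btw => h ha hb hc.
have := dT x' x v; have := dT x' v v'; have := dT v' v y; have := dT v' y y'.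
have := dT x x' y; have := dT x' y' y; rewrite (dC x' x) (dC v' v) (dC y' y); lia.
Qed.

(** Each halving of the allowed length costs one use of [btw_split]; after [N] of them [v] is
    compared with a single step of the path. *)
Lemma log_path s k v N : forall (e : nat -> V) m, m <= 2 ^ N ->
  (forall i, i < m -> d (e i) (e i.+1) <= s) -> btw k (e 0) v (e m) ->
  exists2 i, i <= m & 2 * d v (e i) <= k + N * dl + 2 * s.
Proof.
elim: N k => [|N IH] k e m hm hs hb.
  case: m hm hs hb => [|[|//]] _ hs; rewrite /btw.
    by exists 0 => //; have := dC (e 0) v; have := d0 (e 0); lia.
  have := hs 0 isT; have := dC (e 0) v => h1 h2 h3.
  case: (leqP (d v (e 0)) (d v (e 1))) => h4; [exists 0|exists 1] => //; lia.
pose m1 := minn m (2 ^ N).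
case: (btw_split (e m1) hb) => hb'.
  have [||i hi hd] := IH _ _ _ _ _ hb'.
  - by rewrite geq_minr.
  - by move=> i hi; apply: hs; move: hi; rewrite /m1; lia.
  - by exists i; rewrite ?mulSn; move: hi hd; rewrite /m1; lia.
have := IH (k + dl) (fun i => e (i + m1)) (m - m1).
have -> : m - m1 + m1 = m by rewrite /m1; lia.
case.
- by move: hm; rewrite expnS /m1; lia.
- by move=> i hi; apply: hs; move: hi; rewrite /m1; lia.
- by rewrite add0n.
- by move=> i hi hd; exists (i + m1); rewrite ?mulSn; move: hi hd; rewrite /m1; lia.
Qed.

Section QuasiGeodesic.
Variables s a b : nat.

Definition quasi_geodesic (c : nat -> V) n : Prop :=
  (forall i, i < n -> d (c i) (c i.+1) <= s) /\
  (forall i j, i <= j <= n -> j - i <= a * d (c i) (c j) + b).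

Lemma step_dist (c : nat -> V) n i j : (forall i, i < n -> d (c i) (c i.+1) <= s) ->
  i <= j <= n -> d (c i) (c j) <= s * (j - i).
Proof.
move=> hs; elim: j => [|j IH] /andP[hi hj].
  by move: hi; rewrite leqn0 => /eqP ->; rewrite d0.
move: hi; rewrite leq_eqVlt => /orP[/eqP ->|hi]; first by rewrite d0.
have := IH ltac:(lia); have := hs j hj; have := dT (c i) (c j) (c j.+1).
have -> : j.+1 - i = (j - i).+1 by lia.
by rewrite mulnS; lia.
Qed.

Lemma quasi_geodesic_log c n k v i j N : quasi_geodesic c n -> i <= j <= n ->
  j - i <= 2 ^ N -> btw k (c i) v (c j) ->
  exists2 t, t <= n & 2 * d v (c t) <= k + N * dl + 2 * s.
Proof.
case=> hs _ hij hN hb.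
have := @log_path s k v N (fun t => c (t + i)) (j - i) hN.
have -> : j - i + i = j by lia.
rewrite add0n; case=> //.
  by move=> t ht; apply: hs; lia.
by move=> t ht hd; exists (t + i) => //; lia.
Qed.

(* If all points of the geodesic are [D]-close to the path and [D] is large, then
   [log_path] on the portion of the path shadowing the [2D]-neighbourhood of a
   point improves [D]. *)
Lemma quasi_geodesic_near0 : exists D0, forall c n, quasi_geodesic c n ->
  forall v, btw 0 (c 0) v (c n) -> exists2 i, i <= n & d v (c i) <= D0.
Proof.
have [D1 hD1] := linear_le_exp_log (6 * a) b (2 * dl + 2 * s) dl.
exists (maxn D1 (2 * dl)) => c n hc.
suff main D : (forall v, btw 0 (c 0) v (c n) -> exists2 i, i <= n & d v (c i) <= D) ->
  forall v, btw 0 (c 0) v (c n) -> exists2 i, i <= n & d v (c i) <= maxn D1 (2 * dl).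
  apply: (main (d (c 0) (c n))) => v hv; exists 0 => //.
  by move: hv; rewrite /btw; have := dC v (c 0); lia.
elim: D => [|D IH] hD.
  by move=> v /hD [i hi h]; exists i => //; lia.
case: (leqP D.+1 (maxn D1 (2 * dl))) => hDD.
  by move=> v /hD [i hi h]; exists i => //; lia.
apply: IH => v hv.
case: dM => _ _ _ dG.
(* The points [y] and [z] lie on both sides of [v] at twice the current bound, or coincide with an
   end of the path if that end is nearer; in the latter case the shadow is exact. *)
have [y hy1 hy2] := dG v (c 0) (minn (2 * D.+1) (d v (c 0))) (geq_minr _ _).
have [z hz1 hz2] := dG v (c n) (minn (2 * D.+1) (d v (c n))) (geq_minr _ _).
have T1 := dT (c 0) y (c n); have T2 := dT y z (c n); have T3 := dT y v z.
have T4 := dT (c 0) v (c n).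
have C1 := dC v (c 0); have C2 := dC y (c 0); have C3 := dC y v.
have hyb : btw 0 (c 0) y (c n).
  by move: hv; rewrite /btw; have := dT y v (c n); lia.
have hzb : btw 0 (c 0) z (c n).
  by move: hv; rewrite /btw; have := dT (c 0) v z; lia.
have hvb : btw 0 y v z.
  by move: hv; rewrite /btw; lia.
have [i hi [hyi hyi']] : exists2 i, i <= n & d y (c i) <= D.+1 /\
     (d v y = 2 * D.+1 \/ d y (c i) = 0).
  case: (leqP (2 * D.+1) (d v (c 0))) => h.
    by have [i hi h'] := hD _ hyb; exists i => //; split => //; left; lia.
  by exists 0 => //; split; [|right]; lia.
have [j hj [hzj hzj']] : exists2 i, i <= n & d z (c i) <= D.+1 /\ (d v z = 2 * D.+1 \/ d z (c i) = 0).
  case: (leqP (2 * D.+1) (d v (c n))) => h.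
    by have [i' hi' h'] := hD _ hzb; exists i' => //; split => //; left; lia.
  by exists n => //; split; [|right]; lia.
case: (btw_split (c i) hvb) => hvb1.
  exists i => //; move: hvb1 hyi'; rewrite /btw.
  by have := dT v (c i) y; rewrite (dC (c i) y); lia.
case: (btw_split (c j) hvb1) => hvb2; last first.
  exists j => //; move: hvb2 hzj'; rewrite /btw.
  by have := dT v (c j) z; rewrite (dC (c j) z) (dC (c j) v); lia.
(* One [D.+1] from each shadow and four from [y] to [z]; hence the slope [6 * a] above. *)
have hij : d (c i) (c j) <= 6 * D.+1.
  have := dT (c i) y (c j); have := dT y z (c j); have := dT y v z.
  by have := dC (c i) y; lia.
have [|N hN hN2] := hD1 D.+1; first by lia.
have hN' : a * d (c i) (c j) + b <= 2 ^ N.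
  by apply: leq_trans hN; rewrite leq_add2r mulnAC mulnC leq_mul2r; apply/orP; right; lia.
have [t ht hdt] : exists2 t, t <= n & 2 * d v (c t) <= (0 + dl + dl) + N * dl + 2 * s.
  case: (leqP i j) => hle.
    apply: (quasi_geodesic_log hc _ _ hvb2); first by lia.
    by apply: leq_trans hN'; apply: hc.2; lia.
  apply: (quasi_geodesic_log hc _ _ (btwC hvb2)); first by lia.
  by apply: leq_trans hN'; rewrite dC; apply: hc.2; lia.
by exists t => //; lia.
Qed.

Lemma quasi_geodesic_near k : exists D0, forall c n, quasi_geodesic c n ->
  forall v, btw k (c 0) v (c n) -> exists2 i, i <= n & d v (c i) <= D0.
Proof.
have [D0 hD0] := quasi_geodesic_near0.
exists (k + dl + D0) => c n hc v hv.
have [u hu [huv _]] := btw_point hv erefl.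
have [i hi h] := hD0 _ _ hc _ hu; exists i => //.
by have := dT v u (c i); rewrite (dC v u); lia.
Qed.

(** The shadows of points marching along the geodesic begin at indices at most [i] and end at
    indices at least [i], so two successive ones straddle [c i]. They are close, hence few indices
    apart, and [c i] is near both. *)
Lemma quasi_geodesic_btw : exists R, forall c n, quasi_geodesic c n ->
  forall i, i <= n -> btw R (c 0) (c i) (c n).
Proof.
have [D0 hD0] := quasi_geodesic_near0.
pose m := a * (2 * D0 + 1 + dl) + b; exists (2 * (s * m + D0)) => c n hc i hi.
have [hs hq] := hc.
pose P t := exists v j, [/\ btw 0 (c 0) v (c n), d (c 0) v = t, j <= i & d v (c j) <= D0].
suff [v [j [j' [hv hjj' hvj hjj'd]]]] : exists v j j', [/\ btw 0 (c 0) v (c n), j <= i <= j' /\ j' <= n,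
    d v (c j) <= D0 & d (c j) (c j') <= 2 * D0 + 1 + dl].
  have hjj : j' - j <= m.
    apply: leq_trans (hq j j' ltac:(lia)) _.
    by rewrite leq_add2r leq_mul2l hjj'd orbT.
  have hji := step_dist hs (_ : j <= i <= n).
  have {}hji : d (c j) (c i) <= s * m.
    by apply: leq_trans (hji ltac:(lia)) _; rewrite leq_mul2l; apply/orP; right; lia.
  have := @btw_shift 0 (c 0) v (c n) (c 0) (c n) (c i) 0 0 (s * m + D0) hv.
  rewrite !d0 /= !muln0 !addn0 add0n; apply=> //.
  by have := dT v (c j) (c i); lia.
have P0 : P 0 by exists (c 0), 0; split=> //; rewrite /btw !d0; lia.
have [t [ht hPt]] : exists t, P t /\ (t = d (c 0) (c n) \/ ~ P t.+1).
  apply: contrapT => hn.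
  have hall t : P t.
    elim: t => [//|t IH]; apply: contrapT => hnt; apply: hn.
    by exists t; split => //; right.
  by apply: hn; exists (d (c 0) (c n)); split; [|left].
case: ht => v [j [hv hvt hji hvj]]; exists v, j.
case: (leqP (d (c 0) (c n)) t) => htn.
  exists n; split=> //; first by lia.
  have hvn : d v (c n) = 0.
    by move: hv; rewrite /btw; have := dT (c 0) (c n) v; have := dC v (c n); lia.
  by have := dT (c j) v (c n); have := dC (c j) v; lia.
case: dM => _ _ _ /(_ _ _ _ htn) [w hw1 hw2].
have hw : btw 0 (c 0) w (c n) by rewrite /btw; lia.
have [j' hj' hwj'] := hD0 _ _ hc _ hw.
exists j'; split=> //.
  split=> //; apply/andP; split=> //; rewrite leqNgt; apply/negP => hlt.
  case: hPt => [|]; first by lia.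
  by apply; exists w, j'; split=> //; lia.
(* The points [v] and [w] need not lie on one geodesic; differing by 1 in height, they are within
   [1 + dl]. *)
have := @btw_close 0 (c 0) v w (c n) 1 hv hw ltac:(lia) ltac:(lia).
by have := dT (c j) v (c j'); have := dT v w (c j'); have := dC (c j) v; have := dC v w; lia.
Qed.

End QuasiGeodesic.
End Hyperbolic.

(** * Quasiconvexity from walls *)

Section Core.
Variables (V : Type) (d : V -> V -> nat) (dl : nat).
Hypothesis dM : geodesic_metric d.
Hypothesis d4 : four_point d dl.
Local Notation btw := (btw d).

Let d0 x : d x x = 0. Proof. by case: dM. Qed.
Let dC x y : d x y = d y x. Proof. by case: dM. Qed.
Let dT x y z : d x z <= d x y + d y z. Proof. by case: dM. Qed.

Definition quasiconvex_set (C : nat) (A : set V) : Prop :=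
  forall x y v, A x -> A y -> btw 0 x v y -> exists2 z, A z & d v z <= C.

Lemma quasiconvex_btw C A k x y v : quasiconvex_set C A -> A x -> A y ->
  btw k x v y -> exists2 z, A z & d v z <= k + dl + C.
Proof.
move=> hA hx hy hv; have [u hu [huv _]] := btw_point dM d4 hv erefl.
have [z hz huz] := hA _ _ _ hx hy hu; exists z => //.
by have := dT v u z; have := dC v u; lia.
Qed.

Fixpoint chain (A : set V) (s : nat) (x : V) (p : seq V) : Prop :=
  if p is y :: q then [/\ A y, d x y <= s & chain A s y q] else True.

Section Walls.
(** In the application [V] is the group, [side k x] is the side of the wall [k] containing the orbit
    point of [x], [C k] is a neighbourhood of [k] in the group, the good walls are those crossing a
    family [T] stabilised by [L], and [Y rho] consists of the elements within [rho] of every wall of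
    [T]. The constants are uniform in the wall. *)
Variables (K : Type) (side : K -> V -> bool) (C : K -> set V) (good : set K).
Variables (L : set V) (Y : nat -> set V) (s lam mu : nat).
Hypothesis s1 : 1 <= s.
Hypothesis sideC : forall k x y, d x y <= s -> side k x != side k y -> C k x.
Hypothesis qcC : forall k, quasiconvex_set lam (C k).
Hypothesis exists_wall : forall r rho, exists M, forall x y, Y rho x -> Y rho y ->
  M <= d x y -> exists k, [/\ good k, side k x != side k y,
    forall z, C k z -> r < d x z & forall z, C k z -> r < d y z].
Hypothesis LY : L `<=` Y 0.
Hypothesis qcY : forall rho, exists rho', forall x y v,
  Y rho x -> Y rho y -> btw 0 x v y -> Y rho' v.
Hypothesis monoY : forall rho rho', rho <= rho' -> Y rho `<=` Y rho'.
Hypothesis qcCL : forall k, good k -> quasiconvex_set mu (C k `&` L).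
Hypothesis near_CL : forall c, exists c', forall k v, good k -> C k `&` L !=set0 ->
  (exists2 z, C k z & d v z <= c) -> (exists2 z, L z & d v z <= c) ->
  exists2 z, (C k `&` L) z & d v z <= c'.
Hypothesis chainL : forall x y, L x -> L y -> exists2 p, chain L s x p & last x p = y.

Let sideC' k x y : d x y <= s -> side k x != side k y -> C k y.
Proof. by move=> h1 h2; apply: (@sideC k y x); rewrite 1?dC // eq_sym. Qed.

Lemma geodesic_crossing k x y : side k x != side k y ->
  exists2 z, C k z & btw 0 x z y.
Proof.
move En : (d x y) => n; elim: n x En => [|n IH] x En hxy.
  exists x; last by rewrite /btw d0; lia.
  by apply: (@sideC k x y) => //; rewrite En.
case: (dM) => _ _ _ /(_ x y 1) []; first by rewrite En.
move=> x' h1 h2; case: (eqVneq (side k x) (side k x')) => hs; last first.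
  by exists x; [apply: (@sideC k x x') hs; rewrite h1|rewrite /btw d0; lia].
have [||z hz hb] := IH x'; [lia|by rewrite -hs|].
by exists z => //; move: hb; rewrite /btw; have := dT x x' z; lia.
Qed.

(** The wall separates points [u], [u'] on both sides of [w] and stays away from both. It cannot
    cross [[x, u]] or [[u', y]] as well, since two crossings would put [u] or [u'] within [lam] of
    its quasiconvex carrier; so it separates [x] from [y]. *)
Lemma select_wall r rho : lam <= r -> exists M, forall x y w,
  (forall v, btw 0 x v y -> Y rho v) -> btw 0 x w y -> M <= d x w -> M <= d w y ->
  exists k u u' p, [/\ good k, side k x != side k y, C k p,
    (forall z, C k z -> r < d u z) /\ (forall z, C k z -> r < d u' z) &
    [/\ btw 0 x u w, btw 0 w u' y, btw 0 u p u', d u w = M & d w u' = M]].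
Proof.
move=> hr; have [M hM] := exists_wall r rho; exists M => x y w hY hw h1 h2.
case: (dM) => _ _ _ dG.
have [u hu1 hu2] := dG w x M ltac:(rewrite dC; lia).
have [u' hu1' hu2'] := dG w y M h2.
have C1 := dC w x; have C2 := dC u x; have C3 := dC u w.
have hu : btw 0 x u w by rewrite /btw; lia.
have hu' : btw 0 w u' y by rewrite /btw; lia.
have huu' : d u u' = 2 * M.
  move: hw; rewrite /btw; have := dT x u y; have := dT u u' y; have := dT u w u'; lia.
have huy : btw 0 x u y by move: hw; rewrite /btw; have := dT u w y; lia.
have hu'y : btw 0 x u' y by move: hw; rewrite /btw; have := dT x w u'; lia.
have [k [gk hk hku hku']] := hM u u' (hY _ huy) (hY _ hu'y) ltac:(lia).
have [p hp hpb] := geodesic_crossing hk.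
have hx : side k x = side k u.
  apply/eqP/negP => /negP /geodesic_crossing [p' hp' hpb'].
  have [|z /hku hz hz2] := qcC (v := u) hp' hp; last by lia.
  move: hpb hpb' hw; rewrite /btw; have := dT x p' y; have := dT p' p y; have := dT p u' y.
  have := dT p' u p; lia.
have hy : side k y = side k u'.
  apply/eqP/negP => /negP /geodesic_crossing [p' hp' hpb'].
  have [|z /hku' hz hz2] := qcC (v := u') hp hp'; last by lia.
  move: hpb hpb' hw; rewrite /btw; have := dT x u y; have := dT u p y; have := dT p p' y.
  have := dC p' y; have := dC p' u'; have := dC u' y.
  have := dT p u' p'; lia.
exists k, u, u', p; split=> //; first by rewrite hx hy.
by split=> //; rewrite dC.
Qed.

Lemma first_crossing k x p : L x -> chain L s x p -> side k x != side k (last x p) ->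
  exists q p1, [/\ chain L s x p1, last x p1 = q, side k q = side k x, C k q & L q] /\
    forall z, z \in map (side k) (x :: p1) -> z = side k x.
Proof.
elim: p x => [|y p IH] x Lx /=; first by rewrite eqxx.
case=> Ly hxy hp hs; case: (eqVneq (side k x) (side k y)) => hs'.
  have [|q [p1 [[h1 h2 h3 h4 h5] h6]]] := IH y Ly hp; first by rewrite -hs'.
  exists q, (y :: p1); split; first by split=> //=; rewrite h3.
  by move=> z; rewrite /= in_cons => /orP[/eqP //|/h6]; rewrite hs'.
exists x, [::]; split; first by split=> //; apply: (sideC hxy).
by move=> z; rewrite /= inE => /eqP.
Qed.

Lemma chain_crossing k k1 x p b : L x -> chain L s x p ->
  (forall z, z \in map (side k) (x :: p) -> z = b) ->
  side k1 x != side k1 (last x p) ->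
  exists2 q, (C k1 `&` L) q & side k q = b.
Proof.
elim: p x => [|y p IH] x Lx /=; first by rewrite eqxx.
case=> Ly hxy hp hb hs; case: (eqVneq (side k1 x) (side k1 y)) => hs'.
  apply: (IH y) => //; last by rewrite -hs'.
  by move=> z hz; apply: hb; rewrite in_cons hz orbT.
exists x; last by apply: hb; rewrite in_cons eqxx.
by split=> //; apply: (sideC hxy).
Qed.

Lemma last_crossing k x p : L x -> chain L s x p -> side k x != side k (last x p) ->
  exists q p1, [/\ L q, chain L s q p1, last q p1 = last x p & C k q] /\
    forall z, z \in map (side k) (q :: p1) -> z = side k (last x p).
Proof.
move=> Lx hp hs.
have : exists2 z, z \in map (side k) (x :: p) & z <> side k (last x p).
  by exists (side k x); [rewrite /= in_cons eqxx|apply/eqP].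
elim: p x Lx hp {hs} => [|y p IH] x Lx /=.
  by move=> _ [z]; rewrite inE => /eqP ->.
case=> Ly hxy hp hz.
case: (EM (exists2 z, z \in map (side k) (y :: p) & z <> side k (last y p))).
  exact: IH.
move=> hn; exists y, p; split.
  split=> //; apply: (sideC' hxy).
  case: hz => z; rewrite in_cons => /orP[/eqP -> hz|hz hz']; last by case: hn; exists z.
  suff -> : side k y = side k (last y p) by apply/eqP.
  by apply: contrapT => h; apply: hn; exists (side k y) => //=; rewrite in_cons eqxx.
by move=> z hz'; apply: contrapT => h; apply: hn; exists z.
Qed.

(* If a point [v] of a geodesic [x, y] is far from [L], a wall [k] crosses
   [x, y] near [v] transversally.  A path of [L] from [x] to [y] stays on one
   side of [k] up to a first crossing [q], and on the other side after a last
   crossing [q'].  A second wall [k1], transverse to [v, q] far from [v] and from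
   [L], separates both [x] from [q] and [y] from [q'], so the path meets [k1]
   on both sides of [k].  Quasiconvexity of [C k1 `&` L] then yields a
   point near both [C k `&` L] and [k1], forcing [k1] to run along [v, q]. *)
Theorem chain_connected_quasiconvex : exists D, quasiconvex_set D L.
Proof.
have [rho1 hrho1] := qcY 0.
have [rho2 hrho2] := qcY rho1.
pose r := lam + dl + dl.
have [M hM] := @select_wall r (maxn rho1 rho2) ltac:(rewrite /r; lia).
have [c' hc'] := near_CL mu.
(* [ka] is the error in [hxq] and [hyq]; [M1] puts [k1] far enough along [[v, q]] for [hsamev]; the
   bracket in [D] keeps [L] out of reach of [u1'] in [hnear] and [hsame]. *)
pose ka := dl + 2 * M; pose M1 := M + ka + dl + 1.
pose D := 2 * M1 + 2 * M + (2 * (mu + c') + dl + dl + mu) + 1.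
exists D => x y v Lx Ly hv; apply: contrapT => hD.
have farL z : L z -> D < d v z.
  by move=> Lz; rewrite ltnNge; apply/negP => h; apply: hD; exists z.
have hYxy w : btw 0 x w y -> Y rho1 w by apply: hrho1; apply: LY.
have hYL z : L z -> Y rho1 z by move=> Lz; apply: (hrho1 z z); [exact: LY..|rewrite /btw d0; lia].
have [||||k [u [u' [p [gk hk Cp [hu hu'] [hxu huy hupu hMu hMu']]]]]] := hM x y v.
- by move=> w /hYxy; apply: monoY; rewrite leq_maxl.
- exact: hv.
- by rewrite dC; have := farL _ Lx; rewrite /D; lia.
- by have := farL _ Ly; rewrite /D /M1; lia.
have hux : btw 0 x u p.
  move: hxu huy hupu hv; rewrite /btw.
  have := dT x p y; have := dT p u' y; have := dT u v u'; have := dT v u' y; lia.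
have huy' : btw 0 y u' p.
  move: hxu huy hupu hv; rewrite /btw.
  have := dT x p y; have := dT x u p; have := dT u v u'; have := dT x u v.
  have := dC p u'; have := dC y u'; have := dC y p; lia.
(* The carrier of [k] avoids [u], so every point of it is reached from [x] by passing near [u], and
   [v] is only [M] away from [u]. *)
have hxq q : C k q -> btw ka x v q.
  move=> Cq; case: (btw_split dM d4 q hux) => h.
    by move: h; rewrite /btw /ka; have := dT x u v; have := dT v u q; have := dC u v; lia.
  have [z /hu] := quasiconvex_btw (qcC (k := k)) Cq Cp h; rewrite /r; lia.
have hyq q : C k q -> btw ka y v q.
  move=> Cq; case: (btw_split dM d4 q huy') => h.
    by move: h; rewrite /btw /ka; have := dT y u' v; have := dT v u' q; have := dC u' v; lia.
  have [z /hu'] := quasiconvex_btw (qcC (k := k)) Cq Cp h; rewrite /r; lia.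
have [pa hpa hlast] := chainL Lx Ly.
have hk' : side k x != side k (last x pa) by rewrite hlast.
have [q [p1 [[hp1 hq1 hsq Cq Lq] hside1]]] := first_crossing Lx hpa hk'.
have [q' [p2 [[Lq' hp2 hlast2 Cq'] hside2]]] := last_crossing Lx hpa hk'.
case: (dM) => _ _ _ dG.
have hvq := farL _ Lq.
have [v1 hv1 hv1'] := dG v q M1 ltac:(rewrite /D in hvq; lia).
have hYvq w : btw 0 v w q -> Y rho2 w by apply: hrho2; [apply: hYxy|apply: hYL].
have [||||k1 [u1 [u1' [p3 [gk1 hk1 Cp3 [hu1 hu1'] [hxu1 huy1 hupu1 hMu1 hMu1']]]]]] := hM v q v1.
- by move=> w /hYvq; apply: monoY; rewrite leq_maxr.
- by rewrite /btw; lia.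
- by rewrite hv1 /M1; lia.
- by rewrite /D in hvq; lia.
have hvu1 : btw 0 v u1 p3.
  move: hxu1 huy1 hupu1; rewrite /btw.
  have := dT v p3 q; have := dT p3 u1' q; have := dT u1 v1 u1'; have := dT v1 u1' q; lia.
have hvu1' : btw 0 p3 u1' q.
  move: hxu1 huy1 hupu1; rewrite /btw.
  have := dT v p3 q; have := dT v u1 p3; have := dT u1 v1 u1'; have := dT v u1 v1; lia.
have hvp3 : btw 0 v p3 q.
  move: hxu1 huy1 hupu1; rewrite /btw.
  have := dT v u1 p3; have := dT p3 u1' q; have := dT u1 v1 u1'; lia.
(* Otherwise [k1] crosses [[z, v]] as well as [[v, q]] beyond [u1], and quasiconvexity brings its
   carrier near [u1]. *)
have hsamev z : btw ka z v q -> side k1 z = side k1 v.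
  move=> hz; apply/eqP/negP => /negP /geodesic_crossing [p' hp' hpb'].
  have hbp : btw ka p' v p3.
    move: hz hpb' hvp3; rewrite /btw.
    by have := dT z p' q; have := dT p' p3 q; lia.
  case: (btw_split dM d4 p' hvu1) => h; last first.
    have [w /hu1] := quasiconvex_btw (qcC (k := k1)) hp' Cp3 h; rewrite /r; lia.
  move: h hbp hvu1 hxu1; rewrite /btw.
  have := dT p' u1 p3; have := dT v u1 v1; have := dC p' u1; have := dC p' v; rewrite /M1 in hv1; lia.
have hfar w : d v w <= M1 + M -> forall z, L z -> 2 * (mu + c') + dl + dl + mu < d w z.
  by move=> hw z /farL; have := dT v w z; rewrite /D; lia.
have hvu1M : d v u1' <= M1 + M by have := dT v v1 u1'; lia.
(* Since the carrier of [k1] avoids [u1'], a point of it near [z] would make [u1'] almost between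
   [z] and [q], two points of [C k] in [L], hence close to [L]. *)
have hnear z z2 : C k1 z2 -> (C k `&` L) z -> d z2 z <= mu + c' -> False.
  move=> Cz2 CLz hz; case: (btw_split dM d4 z2 hvu1') => h.
    have [w' /hu1'] := quasiconvex_btw (qcC (k := k1)) Cp3 Cz2 h; rewrite /r; lia.
  have h' := @btw_shift _ d dM _ _ _ _ z q u1' (mu + c') 0 0 h hz.
  rewrite !d0 in h'; have {}h' := h' isT isT.
  have [w' [_ hw'] hw2] := quasiconvex_btw (qcCL gk) CLz (conj Cq Lq) h'.
  by have := hfar u1' hvu1M _ hw'; lia.
have hsame : side k1 q = side k1 q'.
  apply/eqP/negP => /negP /geodesic_crossing [z Cz hzb].
  case: (btw_split dM d4 z hvu1') => h.
    have [w' /hu1'] := quasiconvex_btw (qcC (k := k1)) Cp3 Cz h; rewrite /r; lia.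
  have h' : btw (0 + dl) q u1' q'.
    move: h hzb; rewrite /btw.
    have := dT q u1' z; have := dT z u1' q'; have := dT u1' z q'.
    have := dC u1' z; have := dC q u1'; have := dC q z; lia.
  have [w' [_ hw'] hw2] := quasiconvex_btw (qcCL gk) (conj Cq Lq) (conj Cq' Lq') h'.
  by have := hfar u1' hvu1M _ hw'; lia.
have hxq1 : side k1 x != side k1 (last x p1).
  by rewrite hq1 (hsamev x) //; apply: hxq.
have [qa CLqa hsa] := chain_crossing Lx hp1 hside1 hxq1.
have hyq1 : side k1 q' != side k1 (last q' p2).
  by rewrite hlast2 hlast -hsame (hsamev y) 1?eq_sym //; apply: hyq.
have [qb CLqb hsb] := chain_crossing Lq' hp2 hside2 hyq1.
have [z Cz hzb] : exists2 z, C k z & btw 0 qa z qb.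
  by apply: geodesic_crossing; rewrite hsa hsb.
have [z2 [Cz2 Lz2] hz2] := qcCL gk1 CLqa CLqb hzb.
have [z' CLz' hz'] : exists2 z', (C k `&` L) z' & d z z' <= c'.
  apply: hc' => //; first by exists q.
    by exists z; rewrite ?d0.
  by exists z2.
apply: (hnear z' z2) => //.
by apply: leq_trans (dT z2 z z') _; apply: leq_add => //; rewrite dC.
Qed.

End Walls.
End Core.

(** * Squares and swaps of edge paths *)

Definition flip n (x : hypercube n) (i : 'I_n) : hypercube n :=
  [ffun j => x j (+) (j == i)].

Section Flip.
Variable n : nat.
Implicit Types (x y : hypercube n) (i j k : 'I_n).

Lemma flipK x i : flip (flip x i) i = x.
Proof. by apply/ffunP => j; rewrite !ffunE; case: (x j); case: (j == i). Qed.

Lemma flipC x i j : flip (flip x i) j = flip (flip x j) i.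
Proof. by apply/ffunP => k; rewrite !ffunE; case: (x k); case: (k == i); case: (k == j). Qed.

Lemma flip_neq x i : flip x i <> x.
Proof. by move/ffunP/(_ i); rewrite ffunE eqxx; case: (x i). Qed.

Lemma flip_inj x i j : flip x i = flip x j -> i = j.
Proof.
move/ffunP/(_ i); rewrite !ffunE eqxx; case: (eqVneq i j) => //.
by case: (x i).
Qed.

Lemma flip2_inj x i j k l : i <> j -> k <> i ->
  flip (flip x i) k = flip (flip x j) l -> k = j /\ l = i.
Proof.
move=> hij hki h; have li : l = i.
  move/ffunP/(_ i): h; rewrite !ffunE eqxx.
  have /eqP/negPf -> : i <> k by move=> e; apply: hki.
  have /eqP/negPf -> := hij.
  by case: (eqVneq i l) => // _; case: (x i).
split=> //; rewrite li (flipC x j) in h.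
by have := flip_inj h.
Qed.

Lemma flip2_neq1 x i j k : i <> j -> flip (flip x i) j <> flip x k.
Proof.
move=> hij; case: (eqVneq k i) => [->|ki]; first exact: flip_neq.
move/ffunP => h; have := h i; have := h j; rewrite !ffunE !eqxx.
move/eqP/negPf: hij => hij; rewrite (eq_sym j i) hij.
rewrite eq_sym in ki; rewrite (negPf ki).
by case: (eqVneq j k) => [_|_]; case: (x i); case: (x j).
Qed.

Lemma face_edge x i : face [set~ i]%SET x = [set x; flip x i].
Proof.
apply/seteqP; split=> [y hy|y [->|->]] /=.
- case: (eqVneq (y i) (x i)) => h; [left|right]; apply/ffunP => j; rewrite ?ffunE.
    by case: (eqVneq j i) => [->//|hj]; apply: hy; rewrite in_setC1.
  case: (eqVneq j i) => [->|hj]; last by rewrite addbF; apply: hy; rewrite in_setC1.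
  by move: h; case: (y i); case: (x i).
- by [].
- by move=> j; rewrite in_setC1 ffunE => /negPf ->; rewrite addbF.
Qed.

Lemma face_square x i j : i <> j ->
  face (~: [set i; j])%SET x = [set y | [\/ y = x, y = flip x i, y = flip (flip x i) j | y = flip x j]].
Proof.
move=> /eqP hij; apply/seteqP; split=> [y hy|y] /=; last first.
  case=> -> k; rewrite !inE negb_or => /andP[/negPf h1 /negPf h2];
  by rewrite ?ffunE ?h1 ?h2 ?addbF.
have hk k : k <> i -> k <> j -> y k = x k.
  by move=> /eqP h1 /eqP h2; apply: hy; rewrite !inE negb_or h1 h2.
have E (z : hypercube n) : y i = z i -> y j = z j -> (forall k, k <> i -> k <> j -> x k = z k) -> y = z.
  move=> h1 h2 h3; apply/ffunP => k; case: (eqVneq k i) => [->//|/eqP ki].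
  by case: (eqVneq k j) => [->//|/eqP kj]; rewrite hk ?h3.
have N (k l : 'I_n) : k <> l -> (k == l) = false by move/eqP/negPf.
have ij : (i == j) = false by rewrite (negPf hij).
have ji : (j == i) = false by rewrite eq_sym.
case: (eqVneq (y i) (x i)) => hi; case: (eqVneq (y j) (x j)) => hj.
- by apply: Or41; apply: E.
- apply: Or44; apply: (E (flip x j)); rewrite ?ffunE ?ij ?eqxx ?addbF //.
    by move: hj; case: (y j); case: (x j).
  by move=> k k1 k2; rewrite !ffunE (N k j) // addbF.
- apply: Or42; apply: (E (flip x i)); rewrite ?ffunE ?ji ?eqxx ?addbF //.
    by move: hi; case: (y i); case: (x i).
  by move=> k k1 k2; rewrite !ffunE (N k i) // addbF.
- apply: Or43; apply: (E (flip (flip x i) j)); rewrite ?ffunE ?ij ?ji ?eqxx ?addbF //.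
  + by move: hi; case: (y i); case: (x i).
  + by move: hj; case: (y j); case: (x j).
  + by move=> k k1 k2; rewrite !ffunE (N k i) // (N k j) // !addbF.
Qed.

End Flip.

Section Squares.
Variable X : cubeComplex.
Implicit Types (u v w : X).

Section Chart.
Variables (c : set X) (n : nat) (f : hypercube n -> X).
Hypothesis hf : chart c f.

Lemma chart_inj : injective f. Proof. by case: hf. Qed.

Lemma chartP v : c v -> exists x, v = f x.
Proof. by case: hf => _ <- _ [x _ <-]; exists x. Qed.

Lemma chart_in x : c (f x).
Proof. by case: hf => _ <- _; exists x. Qed.

Lemma chart_face J x : cube (f @` face J x).
Proof. by case: hf => _ _ /(_ (f @` face J x)) [_ []]; first by exists J, x. Qed.

Lemma chart_sub e : cube e -> e `<=` c -> exists J x, e = f @` face J x.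
Proof. by case: hf => _ _ /(_ e) [h _] ce ec; apply: h. Qed.

Lemma chart_adjacent x i : adjacent (f x) (f (flip x i)).
Proof.
split; first by move=> /chart_inj/esym; apply: flip_neq.
have := chart_face [set~ i]%SET x; rewrite face_edge.
by rewrite image_setU !image_set1.
Qed.

Lemma chart_adjacentP x y : adjacent (f x) (f y) -> exists i, y = flip x i.
Proof.
case=> hxy hc; have [|J [a hJ]] := chart_sub hc.
  by move=> z [->|->]; apply: chart_in.
have ha z : face J a z <-> f z = f x \/ f z = f y.
  have <- : [set f x; f y] (f z) <-> f z = f x \/ f z = f y by [].
  rewrite hJ; split=> [h|[z' h /chart_inj <- //]]; by exists z.
have ax : face J a x by apply/ha; left.
have ay : face J a y by apply/ha; right.
have [i hi] : exists i, i \notin J.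
  apply: contrapT => hn; apply: hxy; congr f; apply/ffunP => i.
  have hi : i \in J by apply/negPn/negP => hi; apply: hn; exists i.
  by rewrite ax // ay.
exists i; have : face J a (flip x i).
  move=> j hj; rewrite ffunE; case: (eqVneq j i) => [e|_]; last by rewrite addbF ax.
  by move: hi; rewrite -e hj.
by case/ha => /chart_inj; [move/flip_neq|move->].
Qed.

Lemma chart_corner e x i j : cube e -> e `<=` c -> e (f x) ->
  e (f (flip x i)) -> e (f (flip x j)) -> e (f (flip (flip x i) j)).
Proof.
move=> ce ec; have [J [a ->]] := chart_sub ce ec.
move=> [x' hx /chart_inj ex] [x1 h1 /chart_inj e1] [x2 h2 /chart_inj e2].
rewrite ex in hx; rewrite e1 in h1; rewrite e2 in h2.
exists (flip (flip x i) j) => // k hk; rewrite !ffunE.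
have := h1 k hk; have := h2 k hk; rewrite -(hx k hk) !ffunE.
by case: (x k); case: (k == i); case: (k == j).
Qed.

Lemma chart_square x i j : i <> j ->
  square (f x) (f (flip x i)) (f (flip (flip x i) j)) (f (flip x j)).
Proof.
move=> hij; split; last split; last split.
- have := chart_face (~: [set i; j])%SET x; rewrite face_square //.
  congr cube; apply/seteqP; split=> [_ [y h <-]|y] /=.
    by case: h => ->; [apply: Or41|apply: Or42|apply: Or43|apply: Or44].
  by case=> ->; [exists x|exists (flip x i)|exists (flip (flip x i) j)|exists (flip x j)] => //=;
    [apply: Or41|apply: Or42|apply: Or43|apply: Or44].
- split; try exact: chart_adjacent.
    by rewrite flipC -{2}(flipK (flip x j) i); apply: chart_adjacent.
  by rewrite -{2}(flipK x j); apply: chart_adjacent.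
- move/chart_inj => /(congr1 (fun y => flip y j)).
  by rewrite flipK => /flip_inj/esym.
- by move/chart_inj/flip_inj.
Qed.

Lemma square_chart x1 x2 x3 x4 : square (f x1) (f x2) (f x3) (f x4) ->
  exists i j, [/\ i <> j, x2 = flip x1 i, x4 = flip x1 j & x3 = flip (flip x1 i) j].
Proof.
case=> _ [[a12 a23 a34 a41] [n13 n24]].
have [i ei] := chart_adjacentP a12.
have [k ek] := chart_adjacentP a23.
have [j' ej'] := chart_adjacentP a41.
have [l' el'] := chart_adjacentP a34.
have ej : x4 = flip x1 j' by rewrite ej' flipK.
have el : x3 = flip x4 l' by rewrite el' flipK.
have hij : i <> j' by move=> e; apply: n24; rewrite ei ej e.
exists i, j'; split=> //; rewrite ek ei.
have hki : k <> i by move=> e; apply: n13; rewrite ek ei e flipK.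
have E : flip (flip x1 i) k = flip (flip x1 j') l' by rewrite -ej -el ek ei.
by have [-> _] := flip2_inj hij hki E.
Qed.

End Chart.

Lemma adjacentC v w : adjacent v w -> adjacent w v.
Proof. by case=> h1 h2; split; [move=> e; apply: h1|rewrite setUC]. Qed.

Lemma square_rot a b c d : @square X a b c d -> square b c d a.
Proof.
case=> h [[h1 h2 h3 h4] [h5 h6]]; split; last first.
  by split; [split|split] => // e; apply: h5.
by move: h; congr cube; apply/seteqP; split=> x [] ->;
  by [apply: Or41|apply: Or42|apply: Or43|apply: Or44].
Qed.

Lemma square_flip a b c d : @square X a b c d -> square a d c b.
Proof.
case=> h [[h1 h2 h3 h4] [h5 h6]]; split; last first.
  by split; [split; exact: adjacentC|split] => // e; apply: h6.
by move: h; congr cube; apply/seteqP; split=> x [] ->;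
  by [apply: Or41|apply: Or42|apply: Or43|apply: Or44].
Qed.

Lemma square_cubeP a b c d : @square X a b c d -> exists q n (f : hypercube n -> X) x i j,
  [/\ chart q f, i <> j, a = f x, [/\ b = f (flip x i), d = f (flip x j) & c = f (flip (flip x i) j)] &
   q = [set x | [\/ x = a, x = b, x = c | x = d]]].
Proof.
move=> sq; have cq := sq.1; set q := [set _ | _] in cq.
have [n [f hf]] := cubeP cq; exists q, n, f.
have [x ex] := chartP hf (Or41 _ _ _ erefl : q a).
have [x2 e2] := chartP hf (Or42 _ _ _ erefl : q b).
have [x3 e3] := chartP hf (Or43 _ _ _ erefl : q c).
have [x4 e4] := chartP hf (Or44 _ _ _ erefl : q d).
have sq' := sq; rewrite ex e2 e3 e4 in sq'.
have [i [j [h1 h2 h3 h4]]] := square_chart hf sq'.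
exists x, i, j; split=> //; split.
- by rewrite -h2.
- by rewrite -h3.
- by rewrite -h4.
Qed.

(** Intersecting [e] with the cube of the square gives a face of that cube containing three of its
    corners. *)
Lemma square_close a b c d e : @square X a b c d -> cube e -> e a -> e b -> e d -> e c.
Proof.
move=> sq ce ea eb ed; have [q [n [f [x [i [j [hf hij Ea [Eb Ed Ec] Eq]]]]]]] := square_cubeP sq.
have cq : cube q by rewrite Eq; case: sq.
have cqe : cube (q `&` e) by apply: cubeI => //; exists a; split=> //; rewrite Ea; apply: chart_in hf _.
suff : (q `&` e) c by case.
rewrite Ec; apply: (chart_corner hf cqe (@subIsetl _ _ _)); split; rewrite -?Ea -?Eb -?Ed //;
  by rewrite Eq; by [apply: Or41|apply: Or42|apply: Or43|apply: Or44].
Qed.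

Lemma square_unique a b c c' d : @square X a b c d -> square a b c' d -> c = c'.
Proof.
move=> sq sq'; have := square_close sq sq'.1.
case=> //; [exact: Or41|exact: Or42|exact: Or44|..] => e.
- by case: sq => _ [_ []]; rewrite e.
- by case: sq => _ [[_ []]]; rewrite e.
- by case: sq => _ [[_ _ []]]; rewrite e.
Qed.

Lemma square_chart_corner e n (f : hypercube n -> X) x i j c : cube e -> chart e f ->
  square (f x) (f (flip x i)) c (f (flip x j)) -> c = f (flip (flip x i) j).
Proof.
move=> ce hf sq.
have [z ez] := chartP hf (square_close sq ce (chart_in hf _) (chart_in hf _) (chart_in hf _)).
rewrite ez in sq *; have [i' [j' [_ /flip_inj -> /flip_inj -> -> //]]] := square_chart hf sq.
Qed.

Lemma square_link v w u w' : @square X v w u w' -> link_simplex v [set w; w'].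
Proof.
move=> sq; have [q [n [f [x [i [j [hf hij Ea [Eb Ed Ec] Eq]]]]]]] := square_cubeP sq.
have cq : cube q by rewrite Eq; case: sq.
exists q; split=> //; first by rewrite Eq; apply: Or41.
apply/seteqP; split=> y /=.
  by case=> ->; split; [case: sq => _ [[]]|rewrite Eq; apply: Or42|
    apply: adjacentC; case: sq => _ [[]]|rewrite Eq; apply: Or44].
case=> h; rewrite Eq => -[] e; [|by left| |by right].
  by case: h; rewrite e.
by move: h; rewrite e Ea Ec => /(chart_adjacentP hf) [k /flip2_neq1].
Qed.

Lemma link_chart v A : link_simplex v A -> exists c n (f : hypercube n -> X) x,
  [/\ cube c, chart c f, f x = v & forall w, A w <-> exists i, w = f (flip x i)].
Proof.
case=> c [cc cv ->]; have [n [f hf]] := cubeP cc.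
have [x ex] := chartP hf cv; exists c, n, f, x; split=> // w; split.
  case=> h cw; have [y ey] := chartP hf cw.
  by move: h; rewrite ex ey => /(chart_adjacentP hf) [i ->]; exists i.
by case=> i ->; split; [rewrite ex; apply: chart_adjacent hf _ _|apply: chart_in hf _].
Qed.

Hypothesis flagX : forall v, @flag_link X v.

(** The squares meet at [w1] and span edges between three vertices of its link, so the flag
    condition completes them to a 3-cube; [z] is the corner opposite [w1]. *)
Lemma three_squares v w u w1 u1 w2 s :
  square v w u w1 -> square v w1 u1 w2 -> square w1 u s u1 ->
  exists z, [/\ square v w z w2, square s u w z & square s u1 w2 z].
Proof.
move=> s1 s2 s3.
have s1' := square_rot (square_flip s1); have s2' := square_rot s2.
have [|c [n [f [x [cc hf ex hA]]]]] := @link_chart w1 [set z | [\/ z = v, z = u | z = u1]].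
  apply: flagX.
  - suff -> : [set z | [\/ z = v, z = u | z = u1]] = [set v; u; u1] by [].
    by apply/seteqP; split=> z; rewrite /setU /=; [case; tauto|case=> [[]|] ->; [apply: Or31|apply: Or32|apply: Or33]].
  - move=> z [] ->; [case: s2 => _ [[]] //; move/adjacentC => //|by case: s3 => _ [[]]|].
    by case: s3 => _ [[_ _ _ /adjacentC]].
  have l1 := square_link s1'; have l2 := square_link s2'; have l3 := square_link s3.
  by move=> z z' [] -> [] -> // _; rewrite // setUC.
have [|i ev] := (hA v).1; first exact: Or31.
have [|j eu] := (hA u).1; first exact: Or32.
have [|k eu1] := (hA u1).1; first exact: Or33.
have hji : j <> i by move=> e; case: s1' => _ [_ [_ []]]; rewrite ev eu e.
have hik : i <> k by move=> e; case: s2' => _ [_ [_ []]]; rewrite ev eu1 e.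
have hjk : j <> k by move=> e; case: s3 => _ [_ [_ []]]; rewrite eu eu1 e.
have ew : w = f (flip (flip x j) i).
  by apply: (square_chart_corner cc hf); rewrite ex -ev -eu.
have ew2 : w2 = f (flip (flip x k) i).
  by apply: (square_chart_corner cc hf); rewrite ex -ev -eu1.
have es : s = f (flip (flip x j) k).
  by apply: (square_chart_corner cc hf); rewrite ex -eu -eu1.
exists (f (flip (flip (flip x i) j) k)); split.
- by rewrite ew ew2 ev (flipC x j) (flipC x k); apply: (chart_square hf).
- have sq := chart_square hf (flip x j) (fun e => hik (esym e)).
  rewrite es eu ew (flipC x i) (flipC _ i k).
  exact/square_rot/square_rot/square_rot/square_flip.
- have sq := chart_square hf (flip x k) hji.
  rewrite es eu1 ew2 (flipC x j k) (flipC (flip x i)) (flipC x i) (flipC _ i j).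
  exact/square_rot/square_rot/square_rot/square_flip.
Qed.

(** * Swap equivalence of edge paths and its exchange property *)

Inductive swap : seq X -> seq X -> Prop :=
| swap_head a b c d l : square a b c d -> swap [:: a, b, c & l] [:: a, d, c & l]
| swap_cons a l l' : swap l l' -> swap (a :: l) (a :: l').

Lemma swap_size3 l m : swap l m -> 2 < size l.
Proof. by elim=> //= _ p _ _; apply: ltnW. Qed.

Inductive swaps (l : seq X) : seq X -> Prop :=
| swaps_refl : swaps l l
| swaps_step m m' : swaps l m -> swap m m' -> swaps l m'.

Lemma swaps_trans l m p : swaps l m -> swaps m p -> swaps l p.
Proof. by move=> h; elim=> // m1 m2 _ h1; apply: swaps_step. Qed.

Lemma swap_sym l m : swap l m -> swap m l.
Proof.
elim=> [a b c d p sq|a p p' _ IH]; last exact: swap_cons.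
by apply: swap_head; apply: square_flip.
Qed.

Lemma swaps_sym l m : swaps l m -> swaps m l.
Proof.
elim=> [|m1 m2 _ IH h]; first exact: swaps_refl.
by apply: swaps_trans IH; apply: swaps_step (swaps_refl _) _; apply: swap_sym.
Qed.

Lemma swaps_cons a l m : swaps l m -> swaps (a :: l) (a :: m).
Proof.
elim=> [|m1 m2 _ IH h]; first exact: swaps_refl.
by apply: swaps_step IH _; apply: swap_cons.
Qed.

Lemma swaps_square a b c d l : square a b c d -> swaps [:: a, b, c & l] [:: a, d, c & l].
Proof. by move=> sq; apply: swaps_step (swaps_refl _) _; apply: swap_head. Qed.

Lemma swaps_size l m : swaps l m -> size l = size m.
Proof.
elim=> // m1 m2 _ -> h; elim: h => //= a p p' _ -> //.
Qed.

Lemma swaps_head v l m : swaps (v :: l) m -> exists m', m = v :: m'.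
Proof.
elim=> [|m1 m2 _ [m' ->] h]; first by exists l.
by inversion h; eexists.
Qed.

Lemma swap_cons2 v w w' p p' : swap [:: v, w & p] [:: v, w' & p'] ->
  (w = w' /\ swap (w :: p) (w' :: p')) \/
  exists u l, [/\ p = u :: l, p' = u :: l & square v w u w'].
Proof.
move=> h; inversion h as [? ? ? ? l sq|? ? ? h']; subst; first by right; exists c, l.
left; split=> //; have [m] := swaps_head (swaps_step (swaps_refl _) h').
by case.
Qed.

(** The counterpart of the exchange property of right-angled Coxeter groups: equivalent paths with
    different first edges can both be routed along one square. *)
Definition exchange v w p w' p' : Prop :=
  (w = w' /\ swaps (w :: p) (w' :: p')) \/
  exists u r, [/\ square v w u w', swaps (w :: p) [:: w, u & r]
                & swaps (w' :: p') [:: w', u & r]].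

(* The flag condition enters when two successive swaps change the first edge:
   the three squares involved bound a 3-cube. *)
Lemma swaps_exchange v w w' p p' : swaps [:: v, w & p] [:: v, w' & p'] -> exchange v w p w' p'.
Proof.
elim: {p}(size p) {-2}p (leqnn (size p)) v w w' p' => [|n IHn] p hp v w w' p' h.
- suff H m : swaps [:: v, w & p] m -> m = [:: v; w].
    by case: (H _ h) => -> ->; left; split=> //; move: hp; case: (p) => // _; apply: swaps_refl.
  by move: hp; case: (p) => // _; elim=> // m1 m2 _ -> /swap_size3.
suff H m : swaps [:: v, w & p] m -> forall w' p', m = [:: v, w' & p'] -> exchange v w p w' p'.
  exact: H h _ _ erefl.
elim=> {h w' p' m} [|m1 m2 h IH hs] w' p' em.
  by case: em => <- <-; left; split=> //; apply: swaps_refl.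
rewrite {}em in hs.
have [[|w1 p1] em1] := swaps_head h; first by move: (swaps_size h); rewrite em1.
rewrite em1 in hs h; have {IH em1} := IH _ _ em1.
case/swap_cons2: hs => [[<- hs]|[u1 [l [? ? sq1]]]].
  case=> [[ew h1]|[u [r [h1 h2 h3]]]]; [left|right].
    by split=> //; apply: swaps_step h1 hs.
  exists u, r; split=> //.
  by apply: swaps_trans h3; apply: swaps_sym; apply: swaps_step (swaps_refl _) hs.
subst p1 p'; case=> [[ew h1]|[u [r [sq h2 h3]]]].
  by subst w1; right; exists u1, l; split=> //; apply: swaps_refl.
have hr : size r <= n.
  by have := swaps_size h2; move: hp => /=; lia.
(* The tails after [w1] are again equivalent and shorter, so they satisfy the exchange property; a
   second square at [w1] is the third one needed for [three_squares]. *)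
have := IHn r hr w1 u u1 l (swaps_sym h3).
case=> [[eu h4]|[t [q [sq2 h4 h5]]]].
  subst u1; left; have ew : w = w'.
    by apply: (@square_unique w1 u w w' v); [exact/square_flip/square_rot/square_rot/square_rot|exact: square_rot].
  split=> //; rewrite -ew; apply: swaps_trans h2 _; exact: swaps_cons.
have [z [sq3 sq4 sq5]] := three_squares sq sq1 sq2.
right; exists z, [:: t & q]; split=> //.
  apply: swaps_trans h2 _; apply: swaps_trans (swaps_cons _ h4) _.
  by apply: swaps_square; apply/square_flip/square_rot/square_rot.
apply: swaps_trans (swaps_cons _ h5) _.
by apply: swaps_square; apply/square_flip/square_rot/square_rot.
Qed.

Lemma swaps_uncons v w p p' : swaps [:: v, w & p] [:: v, w & p'] -> swaps (w :: p) (w :: p').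
Proof. by case/swaps_exchange=> [[]//|[u [r [[_ [_ [_ []]]]]]]]. Qed.

End Squares.

(** * Reduced edge paths *)

Section NormalForm.
Variable X : cubeComplex.
Hypothesis flagX : forall v, @flag_link X v.
Implicit Types (u v w : X) (l m p q r : seq X).

Inductive backtrack : seq X -> Prop :=
| backtrack_head a b l : backtrack [:: a, b, a & l]
| backtrack_cons a l : backtrack l -> backtrack (a :: l).

Definition reduced l := forall m, swaps l m -> ~ backtrack m.

Lemma backtrack_size l : backtrack l -> 2 < size l.
Proof. by elim=> //= _ p _; apply: ltnW. Qed.

Lemma backtrack_cons2 v w p : backtrack [:: v, w & p] ->
  (exists q, p = v :: q) \/ backtrack (w :: p).
Proof.
move=> h; inversion h as [? ? q|]; subst; last by right.
by left; exists q.
Qed.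

Lemma reduced_swaps l m : reduced l -> swaps l m -> reduced m.
Proof. by move=> hl hm m' h; apply: hl; apply: swaps_trans hm h. Qed.

Lemma reduced_tail a l : reduced (a :: l) -> reduced l.
Proof. by move=> h m hm hb; apply: (h (a :: m)); [exact: swaps_cons|exact: backtrack_cons]. Qed.

(** As with descents in Coxeter groups, prepending [v] to such a path creates, after swaps, a
    backtrack. *)
Definition descent v m : Prop :=
  exists w m', swaps m [:: w, v & m'].

Lemma descent_cons v w m : descent v (w :: m) -> exists m', swaps (w :: m) [:: w, v & m'].
Proof.
by case=> w' [m' h]; exists m'; have [m2 [e _]] := swaps_head h; subst w'.
Qed.

Lemma descent_swaps v l m : swaps l m -> descent v l -> descent v m.
Proof. by move=> h [w [m' h']]; exists w, m'; apply: swaps_trans h'; apply: swaps_sym. Qed.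

(** Exchange traces a backtrack of a swapped [v :: m] back to [m]. If the first edge is unchanged,
    it comes from a descent or a backtrack of [m]; if that edge moved across a square, the new tail
    is reduced by induction, and a backtrack at the head forces one in [m]. *)
Lemma reduced_cons v m : reduced m -> ~ descent v m -> reduced (v :: m).
Proof.
elim: {m}(size m) {-2}m (leqnn (size m)) v => [|n IH] [|w m] hm v //.
- by move=> _ _ l /swaps_size h /backtrack_size; rewrite -h.
- by move=> _ _ l /swaps_size h /backtrack_size; rewrite -h.
move=> rm nd l h hb.
have [[|w' p] el] := swaps_head h; first by move: (swaps_size h); rewrite el.
rewrite {}el in h hb.
have := swaps_exchange flagX h; case=> [[e h1]|[u [r [sq h1 h2]]]].
  subst w'; case: (backtrack_cons2 hb) => [[q eq]|hb']; last exact: rm h1 hb'.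
  by subst p; apply: nd; exists w, q.
have rur : reduced (w' :: u :: r).
  apply: IH.
  - by have := swaps_size h1; move: hm => /=; lia.
  - exact: reduced_tail (reduced_swaps rm h1).
  - move=> /descent_cons [r' hr']; apply: nd; exists w, (w' :: r').
    apply: swaps_trans h1 _; apply: swaps_trans (swaps_cons _ hr') _.
    by apply: swaps_square; exact: square_rot.
case: (backtrack_cons2 hb) => [[p' eq]|hb']; last exact: rur (swaps_sym h2) hb'.
subst p.
have := swaps_exchange flagX h2; case=> [[e _]|[t [q [sq2 _ h4]]]].
  by case: sq => _ [_ []].
apply: (reduced_swaps rm h1) _; first exact: swaps_cons h4.
suff -> : t = w by exact: backtrack_head.
by apply: (square_unique sq2); exact/square_flip/square_rot/square_flip.
Qed.

(** Prepending [v] cancels against a descent when there is one. The remainder is picked by choice,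
    so the result is meaningful only up to swaps; [add_descent] shows it is well defined in this
    sense. *)
Definition add v m :=
  if pselect (exists m', exists w, swaps m [:: w, v & m']) is left e then v :: sval (cid e)
  else v :: m.

Lemma add_descent v w m m' : swaps m [:: w, v & m'] -> swaps (add v m) (v :: m').
Proof.
move=> h; rewrite /add; case: pselect => [e|]; last by case; exists m', w.
case: cid => m'' [w' h'] /=; have h2 := swaps_trans (swaps_sym h') h.
by have [? [e2 _]] := swaps_head h2; subst w'; apply: swaps_uncons flagX _ _ _ _ h2.
Qed.

Lemma add_ascent v m : ~ descent v m -> add v m = v :: m.
Proof. by move=> h; rewrite /add; case: pselect => // -[m' [w hw]]; case: h; exists w, m'. Qed.

Lemma add_swaps v m m' : swaps m m' -> swaps (add v m) (add v m').
Proof.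
move=> h; case: (EM (descent v m)) => [[w [p hp]]|hn].
  apply: swaps_trans (add_descent hp) _; apply: swaps_sym.
  by apply: (add_descent (w := w)); apply: swaps_trans (swaps_sym h) hp.
rewrite !add_ascent //; first exact: swaps_cons.
by move=> h'; apply: hn; apply: descent_swaps h'; apply: swaps_sym.
Qed.

Lemma add_cons v m : exists m', add v m = v :: m'.
Proof. by rewrite /add; case: pselect => [e|]; eexists. Qed.

Lemma add_reduced v m : reduced m -> reduced (add v m).
Proof.
move=> rm; case: (EM (descent v m)) => [[w [p hp]]|hn].
  apply: reduced_swaps (swaps_sym (add_descent hp)).
  exact: reduced_tail (reduced_swaps rm hp).
by rewrite add_ascent //; apply: reduced_cons.
Qed.

Lemma add_backtrack v w m : reduced (v :: m) -> swaps (add v (add w (v :: m))) (v :: m).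
Proof.
move=> rm; case: (EM (descent w (v :: m))) => [/descent_cons [p hp]|hn].
  apply: swaps_trans (add_swaps _ (add_descent hp)) _.
  rewrite add_ascent; first exact: swaps_sym.
  move=> /descent_cons [q hq]; apply: (rm [:: v, w, v & q]); last exact: backtrack_head.
  by apply: swaps_trans hp (swaps_cons _ hq).
by rewrite (add_ascent hn); apply: add_descent (swaps_refl _).
Qed.

(** If [b] and [d] are both descents, exchange at [c] recovers the given square and both sides
    cancel to a path from [a]. If neither is, nothing cancels and the sides differ by one swap. In
    the mixed case one cancellation on each side, at different moments, gives the same path. *)
Lemma add_square a b c d m : square a b c d -> reduced (c :: m) ->
  swaps (add a (add b (c :: m))) (add a (add d (c :: m))).
Proof.
move=> sq rm.
have sqcb : square c b a d by exact/square_rot/square_rot/square_flip.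
wlog suff W : b d sq sqcb / descent b (c :: m) -> ~ descent d (c :: m) ->
    swaps (add a (add b (c :: m))) (add a (add d (c :: m))).
  case: (EM (descent b (c :: m))) => hb; case: (EM (descent d (c :: m))) => hd.
  - have [p hp] := descent_cons hb; have [q hq] := descent_cons hd.
    have := swaps_exchange flagX (swaps_trans (swaps_sym hp) hq).
    case=> [[e _]|[u [r [sq' h1 h2]]]]; first by case: sq => _ [_ []].
    have eu : u = a by exact: (square_unique sq' sqcb).
    subst u; apply: (@swaps_trans _ _ (a :: r)).
      apply: swaps_trans (add_swaps _ (add_descent hp)) _.
      exact: (add_descent (w := b)).
    apply: swaps_sym; apply: swaps_trans (add_swaps _ (add_descent hq)) _.
    exact: (add_descent (w := d)).
  - exact: W.
  - apply: swaps_sym; apply: W => //; exact: square_flip.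
  - rewrite (add_ascent hb) (add_ascent hd).
    have key e f : square a e c f -> ~ descent f (c :: m) -> ~ descent a (e :: c :: m).
      move=> sqe hf /descent_cons [p hp]; apply: hf.
      have := swaps_exchange flagX hp; case=> [[e' _]|[u [r [sq' h1 h2]]]].
        by case: sqe => _ [_ [+ _]]; rewrite e'.
      exists c, r; suff <- : u = f by [].
      apply: (square_unique sq'); exact: square_rot.
    rewrite (add_ascent (key _ _ sq hd)) (add_ascent (key _ _ (square_flip sq) hb)).
    exact: swaps_square.
move=> hb hd; have [p hp] := descent_cons hb.
rewrite (add_ascent hd).
have hna : ~ descent a (b :: p).
  move=> /descent_cons [q hq]; apply: hd; exists c, (a :: q).
  apply: swaps_trans hp _; apply: swaps_trans (swaps_cons _ hq) _.
  exact: swaps_square.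
apply: swaps_trans (add_swaps _ (add_descent hp)) _.
rewrite (add_ascent hna); apply: swaps_sym.
apply: (add_descent (w := d)).
apply: swaps_trans (swaps_cons _ hp) _.
by apply: swaps_square; do 3 apply: square_rot.
Qed.

Definition nf l := foldr add [::] l.

Lemma nf_reduced l : reduced (nf l).
Proof.
elim: l => [|v l IH] /=; last exact: add_reduced.
by move=> m /swaps_size h /backtrack_size; rewrite -h.
Qed.

Lemma nf_cat p l m : swaps (nf l) (nf m) -> swaps (nf (p ++ l)) (nf (p ++ m)).
Proof. by move=> h; elim: p => //= v p IH; apply: add_swaps. Qed.

Lemma nf_cons v l : exists m, nf (v :: l) = v :: m.
Proof. exact: add_cons. Qed.

Lemma nf_homotopy l m : clos_refl_sym_trans _ (@homotopy_step X) l m -> swaps (nf l) (nf m).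
Proof.
elim=> [p q|p|p q _ h|p q r _ h1 _ h2].
- case=> [p1 p2 v w _|p1 p2 a b c d sq]; apply: nf_cat => /=.
    have [m' em] := nf_cons v p2; rewrite /= in em; rewrite em.
    by apply: add_backtrack; rewrite -em; apply: (@nf_reduced (v :: p2)).
  have [m' em] := nf_cons c p2; rewrite /= in em; rewrite em.
  by apply: add_square => //; rewrite -em; apply: (@nf_reduced (c :: p2)).
- exact: swaps_refl.
- exact: swaps_sym.
- exact: swaps_trans h1 h2.
Qed.

Lemma nf_id l : reduced l -> swaps (nf l) l.
Proof.
elim: l => [|v l IH] rl /=; first exact: swaps_refl.
apply: swaps_trans (add_swaps _ (IH (reduced_tail rl))) _.
rewrite add_ascent; first exact: swaps_refl.
case: l {IH} rl => [|w l] rl; first by case=> w [m /swaps_size].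
move=> /descent_cons [m hm]; apply: (rl [:: v, w, v & m]); last exact: backtrack_head.
exact: swaps_cons.
Qed.

End NormalForm.

(** * The edge metric *)

Section EdgePaths.
Variable X : cubeComplex.
Implicit Types (u v w x : X) (l m p q r : seq X).

Lemma edge_path_cat v p q :
  edge_path v (p ++ q) <-> edge_path v p /\ edge_path (last v p) q.
Proof. by elim: p v => [|w p IH] v /=; [tauto|have := IH w; tauto]. Qed.

Lemma edge_path_rev v p : edge_path v p -> edge_path (last v p) (rev (belast v p)).
Proof.
elim: p v => [|w p IH] v //= [h1 h2]; rewrite rev_cons -cats1.
apply/edge_path_cat; split; first exact: IH.
case: p {IH h2} => [|w' p] /=; first by split=> //; apply: adjacentC.
by rewrite rev_cons last_rcons; split=> //; apply: adjacentC.
Qed.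

Lemma last_rev_belast v p : last (last v p) (rev (belast v p)) = v.
Proof. by case: p => [|w p] //=; rewrite rev_cons last_rcons. Qed.

Definition homotopic : seq X -> seq X -> Prop := clos_refl_sym_trans _ (@homotopy_step X).

Lemma homotopic_cat p q l m : homotopic l m -> homotopic (p ++ l ++ q) (p ++ m ++ q).
Proof.
elim=> [l1 l2|l1|l1 l2 _ h|l1 l2 l3 _ h1 _ h2].
- move=> h; apply: rst_step; case: h => [p1 p2 v w h|p1 p2 a b c d h].
    have := @step_backtrack X (p ++ p1) (p2 ++ q) v w h.
    by rewrite -!catA.
  have := @step_square X (p ++ p1) (p2 ++ q) a b c d h.
  by rewrite -!catA.
- exact: rst_refl.
- exact: rst_sym.
- exact: rst_trans h1 h2.
Qed.

Lemma homotopic_odd l m : homotopic l m -> odd (size l) = odd (size m).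
Proof.
elim=> [l1 l2|//|l1 l2 _ -> //|l1 l2 l3 _ -> _ -> //].
by case=> [p1 p2 v w _|p1 p2 a b c d _]; rewrite !size_cat /= !addnS //= negbK.
Qed.

Lemma homotopic_rev v p pre : edge_path v p ->
  homotopic (pre ++ rev (v :: p) ++ p) (pre ++ [:: last v p]).
Proof.
elim: p v => [|w p IH] v /=.
  by move=> _; apply: rst_refl.
case=> h1 h2; apply: rst_trans (IH _ h2); apply: rst_step.
have := @step_backtrack X (pre ++ rev p) p w v (adjacentC h1).
by rewrite !rev_cons -!cats1 -!catA.
Qed.

Hypothesis hX : CAT0 X.

(** The loop of [p] followed by [q] reversed contracts; append [q] and cancel. *)
Lemma homotopic_paths v p q : edge_path v p -> edge_path v q -> last v p = last v q ->
  homotopic (v :: p) (v :: q).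
Proof.
move=> hp hq e; have [[_ _ sc] _] := hX.
have hl : homotopic (v :: p ++ rev (belast v q)) [:: v].
  apply: sc; last by rewrite last_cat e last_rev_belast.
  by apply/edge_path_cat; split=> //; rewrite e; apply: edge_path_rev.
have h1 := homotopic_cat [::] q hl.
have h2 := homotopic_rev (belast v p) hq.
apply: rst_trans (h1); rewrite /= -catA.
have -> : v :: p ++ rev (belast v q) ++ q = belast v p ++ rev (v :: q) ++ q.
  by rewrite (lastI v q) rev_rcons -e -!cat_cons lastI cat_rcons.
have -> : v :: p = belast v p ++ [:: last v q] by rewrite cats1 -e -lastI.
exact: rst_sym.
Qed.

Lemma edge_dist_exists v w : exists n, `[< exists p, [/\ edge_path v p, last v p = w & size p = n] >].
Proof.
have [[_ ec _] _] := hX; have [p hp e] := ec v w.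
by exists (size p); apply/asboolP; exists p.
Qed.

Definition edge_dist v w := ex_minn (edge_dist_exists v w).

Lemma edge_distP v w : exists p, [/\ edge_path v p, last v p = w & size p = edge_dist v w].
Proof. by rewrite /edge_dist; case: ex_minnP => n /asboolP. Qed.

Lemma edge_dist_le v p : edge_path v p -> edge_dist v (last v p) <= size p.
Proof.
by move=> hp; rewrite /edge_dist; case: ex_minnP => n _; apply; apply/asboolP; exists p.
Qed.

Lemma edge_dist_metric : geodesic_metric edge_dist.
Proof.
have sym x y : edge_dist x y <= edge_dist y x.
  have [p [hp <- <-]] := edge_distP y x.
  have := edge_dist_le (edge_path_rev hp).
  by rewrite last_rev_belast size_rev size_belast.
split=> [x|x y|x y z|x y i].
- by apply/eqP; rewrite -leqn0; apply: (@edge_dist_le x [::]).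
- by apply/eqP; rewrite eqn_leq !sym.
- have [p [hp <- <-]] := edge_distP x y; have [q [hq <- <-]] := edge_distP (last x p) z.
  rewrite -size_cat -last_cat; apply: edge_dist_le; exact/edge_path_cat.
- have [p [hp e sp]] := edge_distP x y => hi.
  have := hp; rewrite -{1}(cat_take_drop i p) => /edge_path_cat [h1 h2].
  have e1 := edge_dist_le h1; have e2 := edge_dist_le h2.
  rewrite -last_cat cat_take_drop e size_drop in e2.
  rewrite size_takel in e1; last by rewrite sp.
  have [p1 [hp1 ep1 sp1]] := edge_distP x (last x (take i p)).
  have [p2 [hp2 ep2 sp2]] := edge_distP (last x (take i p)) y.
  have : edge_path x (p1 ++ p2) by apply/edge_path_cat; rewrite ep1.
  move/edge_dist_le; rewrite last_cat ep1 ep2 size_cat sp1 sp2 => h3.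
  by exists (last x (take i p)); lia.
Qed.

Let d0 x : edge_dist x x = 0. Proof. by case: edge_dist_metric. Qed.
Let dC x y : edge_dist x y = edge_dist y x. Proof. by case: edge_dist_metric. Qed.
Let dT x y z : edge_dist x z <= edge_dist x y + edge_dist y z.
Proof. by case: edge_dist_metric. Qed.

Lemma edge_dist_eq0 x y : edge_dist x y = 0 -> x = y.
Proof. by have [[|z p] [_ <- <-]] := edge_distP x y. Qed.

Lemma edge_dist_eq1 x y : edge_dist x y = 1 <-> adjacent x y.
Proof.
split=> [|h].
  by have [[|z [|? p]] [+ <- <-]] := edge_distP x y => //= -[].
have : edge_path x [:: y] by [].
move/edge_dist_le => /= h1; case e : (edge_dist x y) h1 => [|[|//]] // _.
by case: h; rewrite (edge_dist_eq0 e).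
Qed.

(** Elementary homotopies preserve the parity of length, so the 1-skeleton is bipartite. *)
Lemma edge_dist_adjacent x y z : adjacent x y ->
  edge_dist z x = (edge_dist z y).+1 \/ edge_dist z y = (edge_dist z x).+1.
Proof.
move=> h; rewrite !(dC z).
have [p [hp ep sp]] := edge_distP x z; have [q [hq eq sq]] := edge_distP y z.
have hq' : edge_path x (y :: q) by [].
have := homotopic_odd (homotopic_paths hp hq' (etrans ep (esym eq))).
have := (edge_dist_eq1 x y).2 h.
have := dT x y z; have := dT y x z; rewrite (dC y x) /= sp sq; lia.
Qed.

Definition vertex_path l := if l is v :: p then edge_path v p else True.

Lemma swap_path l m : @swap X l m -> vertex_path l ->
  vertex_path m /\ forall x, last x l = last x m.
Proof.
elim=> [a b c d q sq /= [h1 [h2 h3]]|a p p' h IH].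
  by case: sq => _ [[s1 s2 s3 s4] _]; split=> //; split; [exact: adjacentC|split; [exact: adjacentC|]].
case: p h IH => [|b p] h IH; first by inversion h.
have [p'' e] := swaps_head (swaps_step (swaps_refl _) h); subst p'.
by case=> h1 /IH [h2 h3]; split=> // x; exact: (h3 x).
Qed.

Lemma swaps_path l m : @swaps X l m -> vertex_path l ->
  vertex_path m /\ forall x, last x l = last x m.
Proof.
move=> h hl; elim: h => [//|m1 m2 _ [h1 h2] /swap_path h3].
by have [h4 h5] := h3 h1; split=> // x; rewrite h2.
Qed.

Lemma geodesic_reduced v p : edge_path v p -> size p = edge_dist v (last v p) ->
  reduced (v :: p).
Proof.
move=> hp sp l hl hb.
have [hpl el] := swaps_path hl (hp : vertex_path (v :: p)).
have [p' e] := swaps_head hl; subst l.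
have := swaps_size hl => -[sz].
suff [q [hq elq szq]] : exists q, [/\ edge_path v q, last v q = last v p' & size q < size p'].
  have := edge_dist_le hq; rewrite elq; have := el v => /= <-; rewrite -sp; lia.
move: hpl => {hl el sz sp hp} /=.
elim: p' v hb => [|w q IH] v hb; first by have := backtrack_size hb.
case/backtrack_cons2: hb => [[q' ->]|hb] [h1 h2].
  by exists q'; split; [case: h2| |rewrite /=; lia].
have [q' [h3 h4 h5]] := IH _ hb h2.
by exists (w :: q').
Qed.

(** Geodesics through [w] and through [w'] are reduced and homotopic, hence swap-equivalent, and
    exchange at [v] supplies the square. *)
Lemma quadrangle v w w' x : adjacent v w -> adjacent v w' -> w <> w' ->
  edge_dist v x = (edge_dist w x).+1 -> edge_dist v x = (edge_dist w' x).+1 ->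
  exists2 u, square v w u w' & edge_dist w x = (edge_dist u x).+1.
Proof.
move=> hw hw' nww e e'; have [_ flagX] := hX.
have [p [hp ep sp]] := edge_distP w x; have [q [hq eq sq]] := edge_distP w' x.
have hp' : edge_path v (w :: p) by [].
have hq' : edge_path v (w' :: q) by [].
have rp : reduced [:: v, w & p] by apply: geodesic_reduced => //=; rewrite ep e sp.
have rq : reduced [:: v, w' & q] by apply: geodesic_reduced => //=; rewrite eq e' sq.
have := nf_homotopy flagX (homotopic_paths hp' hq' (etrans ep (esym eq))).
move=> h; have {}h := swaps_trans (swaps_sym (nf_id flagX rp)) (swaps_trans h (nf_id flagX rq)).
have := swaps_exchange flagX h; case=> [[//]|[u [r [squ h1 _]]]].
exists u => //.
have [[au hr] er] := swaps_path h1 (hp : vertex_path (w :: p)).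
have := edge_dist_le hr; have := er w; rewrite /= ep => <-.
have := swaps_size h1; have := edge_dist_adjacent x au; rewrite !(dC x) /=; lia.
Qed.

End EdgePaths.

(** * Halfspaces, carriers and crossing walls *)

Lemma set2_inj T (a b c d : T) : [set a; b] = [set c; d] ->
  (a = c /\ b = d) \/ (a = d /\ b = c).
Proof.
move=> e; have ha : [set c; d] a by rewrite -e; left.
have hb : [set c; d] b by rewrite -e; right.
have hc : [set a; b] c by rewrite e; left.
have hd : [set a; b] d by rewrite e; right.
by case: ha => ?; case: hb => ?; case: hc => ?; case: hd => ?; subst; auto.
Qed.

(* A hyperplane is represented by any oriented edge dual to it. *)
Record edge (X : cubeComplex) := Edge { src : X; tgt : X; edgeP : adjacent src tgt }.

Section Halfspaces.
Variable X : cubeComplex.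
Hypothesis hX : CAT0 X.
Implicit Types (u v w x y z : X) (e f k : edge X).
Local Notation d := (edge_dist hX).

Definition ends e : set X := [set src e; tgt e].
Definition par e f : Prop := parallel (ends e) (ends f).

Let d0 x : d x x = 0. Proof. by case: (edge_dist_metric hX). Qed.
Let dC x y : d x y = d y x. Proof. by case: (edge_dist_metric hX). Qed.
Let dT x y z : d x z <= d x y + d y z. Proof. by case: (edge_dist_metric hX). Qed.
Let dG x y i : i <= d x y -> exists2 z, d x z = i & d z y = d x y - i.
Proof. by case: (edge_dist_metric hX) => _ _ _; apply. Qed.

Lemma par_refl e : par e e. Proof. exact: rst_refl. Qed.
Lemma par_sym e f : par e f -> par f e. Proof. exact: rst_sym. Qed.
Lemma par_trans e f k : par e f -> par f k -> par e k.
Proof. exact: rst_trans. Qed.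

Lemma square_parallel a b c (b' : X) : square a b c b' -> parallel [set a; b] [set b'; c].
Proof. by move=> sq; apply: rst_step; exists a, b, c, b'. Qed.

Definition side e x : bool := d x (src e) < d x (tgt e).

Definition edge_rev e := Edge (adjacentC (edgeP e)).

Lemma ends_rev e : ends (edge_rev e) = ends e.
Proof. by rewrite /ends /= setUC. Qed.

Lemma side_rev e x : side (edge_rev e) x = ~~ side e x.
Proof. by have := edge_dist_adjacent hX x (edgeP e); rewrite /side /=; lia. Qed.

Lemma side_src e : side e (src e).
Proof. by rewrite /side d0 (edge_dist_eq1 hX _ _).2 //; apply: edgeP. Qed.

Lemma side_tgt e : ~~ side e (tgt e).
Proof. by rewrite -side_rev; apply: (side_src (edge_rev e)). Qed.

Lemma sideE e x : if side e x then d x (tgt e) = (d x (src e)).+1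
  else d x (src e) = (d x (tgt e)).+1.
Proof. by have := edge_dist_adjacent hX x (edgeP e); rewrite /side; case: ltnP; lia. Qed.

(** Otherwise parity makes [a] and [c] nearer to [x] than [b]. The quadrangle condition at [b] gives
    a square whose last corner is nearer still, but by uniqueness that corner is [b'], which is
    farther than [a]. *)
Lemma closer_square a b c b' x : square a b c b' -> d x a < d x b -> d x b' < d x c.
Proof.
move=> sq; have [_ [[ab bc cb' b'a] [nac nbb']]] := sq.
have := edge_dist_adjacent hX x ab; have := edge_dist_adjacent hX x bc.
have := edge_dist_adjacent hX x cb'; have := edge_dist_adjacent hX x b'a.
move=> h1 h2 h3 h4 h; rewrite ltnNge; apply/negP => h'.
have [||u sq' eu] := @quadrangle X hX b a c x (adjacentC ab) bc nac.
- by rewrite !(dC _ x); lia.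
- by rewrite !(dC _ x); lia.
suff e : u = b' by subst u; move: eu; rewrite !(dC _ x); lia.
by apply: (square_unique sq'); do 3 apply: square_rot; exact: square_flip.
Qed.

(** Parallelism forgets orientation, so only lying on different sides is invariant; it is phrased
    for sets to allow induction along [parallel]. *)
Definition separates (E : set X) x y : Prop :=
  exists e, E = ends e /\ side e x != side e y.

Lemma separates_ends e x y : separates (ends e) x y <-> side e x != side e y.
Proof.
split=> [[f [h]]|h]; last by exists e.
have [[h1 h2]|[h1 h2]] := set2_inj h; first by rewrite /side h1 h2.
have E z : side e z = ~~ side f z.
  by rewrite /side h1 h2; have := edge_dist_adjacent hX z (edgeP f); lia.
by rewrite !E; case: (side f x); case: (side f y).
Qed.

Lemma par_side e f x y : par e f -> (side e x != side e y) = (side f x != side f y).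
Proof.
move=> h; suff H : separates (ends e) x y <-> separates (ends f) x y.
  by apply/idP/idP => /separates_ends /H /separates_ends.
elim: h => [E F|//|E F _ h|E F K _ h1 _ h2]; [|tauto|tauto].
case=> a [b [c [b' [sq [-> ->]]]]].
have [_ [[ab bc cb' b'a] _]] := sq.
have -> : [set a; b] = ends (Edge ab) by [].
have -> : [set b'; c] = ends (Edge (adjacentC cb')) by [].
rewrite !separates_ends.
have H z : side (Edge ab) z = side (Edge (adjacentC cb')) z.
  apply/idP/idP; first exact: closer_square.
  by apply: (@closer_square b' c b a); exact/square_rot/square_flip.
by rewrite !H.
Qed.

(** Induction towards [e]: the next vertex from [v] towards [src e] and the vertex [w] are both
    closer to [tgt e] than [v], so the quadrangle condition gives the next square of a strip ending
    at [e]. *)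
Lemma separated_adjacent_parallel e v w (vw : adjacent v w) :
  side e v != side e w -> par (Edge vw) e.
Proof.
wlog sv : e v w vw / side e v.
  move=> W h; case sv : (side e v); first exact: W.
  have := W (edge_rev e) v w vw; rewrite !side_rev sv => /(_ isT).
  by rewrite /par ends_rev; apply; move: h; rewrite sv; case: (side e w).
rewrite sv => /= sw.
have h1 := sideE e v; have h2 := sideE e w; rewrite sv in h1.
case: (side e w) sw h2 => // _ h2.
have := edge_dist_adjacent hX (src e) vw; have := edge_dist_adjacent hX (tgt e) vw.
rewrite !(dC _ v) !(dC _ w) => h3 h4.
have {h3 h4} hw : d w (tgt e) = d v (src e) by lia.
move En : (d v (src e)) => n; elim: n v w vw En sv h1 h2 hw => [|n IH] v w vw En sv h1 h2 hw.
  rewrite /par /ends /= -(edge_dist_eq0 En) (edge_dist_eq0 (etrans hw En)); exact: rst_refl.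
have [|v' hv1 hv2] := @dG v (src e) 1; first by rewrite En.
have vv' : adjacent v v' by apply/(edge_dist_eq1 hX).
have h3 := dT v' v (tgt e); have h4 := dT v v' (tgt e); have h5 := edge_dist_adjacent hX (tgt e) (edgeP e).
have h6 := edge_dist_adjacent hX v' (edgeP e).
have nv : v' <> w by move=> E; subst v'; lia.
have [||u sq hu] := @quadrangle X hX v v' w (tgt e) vv' vw nv; [lia|lia|].
have [_ [[_ v'u uw _] _]] := sq.
have h7 := edge_dist_adjacent hX (src e) v'u; have h8 := edge_dist_adjacent hX (src e) uw.
rewrite !(dC (src e)) in h7 h8.
apply: par_trans (IH v' u v'u _ _ _ _ _); try (rewrite /side; lia).
rewrite /par /ends /=; apply: square_parallel; exact: square_flip.
Qed.

Lemma crossing_edge e x y : side e x != side e y -> exists v w (vw : adjacent v w),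
  [/\ par (Edge vw) e, side e v = side e x, side e w = side e y & d x v + 1 + d w y = d x y].
Proof.
move En : (d x y) => n; elim: n x En => [|n IH] x En h.
  by rewrite (edge_dist_eq0 En) eqxx in h.
have [|x' h1 h2] := @dG x y 1; first by rewrite En.
have xx' : adjacent x x' by apply/(edge_dist_eq1 hX).
case: (eqVneq (side e x) (side e x')) => hs.
  have [||v [w [vw [hp hv hw hd]]]] := IH x'; [lia|by rewrite -hs|].
  exists v, w, vw; split=> //; first by rewrite hs.
  by have := dT x x' v; have := dT x v y; have := dT v w y; have := (edge_dist_eq1 hX _ _).2 vw; lia.
exists x, x', xx'; split=> //; first exact: separated_adjacent_parallel.
  by move: h hs; case: (side e x); case: (side e x'); case: (side e y).
by rewrite d0; lia.
Qed.

(** If a geodesic crossed the wall twice, its start would be nearer to the far end of the second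
    dual edge, contrary to the order in which the geodesic traverses that edge. *)
Lemma side_convex e x y z : side e x = side e y -> btw d 0 x z y -> side e z = side e x.
Proof.
move=> hxy; rewrite /btw addn0 => hb; apply: contrapT => /eqP hn.
have hxz : side e x != side e z by rewrite eq_sym.
have hzy : side e z != side e y by rewrite -hxy.
have [v [w [vw [p1 sv sw hd]]]] := crossing_edge hxz.
have [w' [v' [wv' [p2 sw' sv' hd']]]] := crossing_edge hzy.
have hs a b : side (Edge vw) a = side (Edge vw) b <-> side (Edge wv') a = side (Edge wv') b.
  have : (side (Edge vw) a != side (Edge vw) b) = (side (Edge wv') a != side (Edge wv') b).
    by rewrite (par_side _ _ p1) (par_side _ _ p2).
  by case: (side (Edge vw) a); case: (side (Edge vw) b); case: (side (Edge wv') a); case: (side (Edge wv') b).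
have h1 : side (Edge vw) v by apply: side_src.
have h2 : ~~ side (Edge wv') v' by apply: (side_tgt (Edge wv')).
have h3 : side (Edge vw) v = side (Edge vw) v'.
  have := par_side v v' p1; rewrite sv sv' hxy eqxx.
  by case: (side (Edge vw) v); case: (side (Edge vw) v').
have h4 : side (Edge vw) x = side (Edge vw) v.
  have := par_side x v p1; rewrite sv eqxx.
  by case: (side (Edge vw) v); case: (side (Edge vw) x).
have h5 : side (Edge wv') x = side (Edge wv') v by apply/hs.
have h6 : side (Edge wv') v = side (Edge wv') v' by apply/hs.
move: h2; rewrite -h6 -h5 /side /=.
have := dT x z w'; have := dT x v' y; have := edge_dist_adjacent hX x wv'.
by clear h1 h3 h4 h5 h6 hs hxy hxz hzy hn sv sw sw' sv'; lia.
Qed.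

Definition carrier e x : Prop := exists y (xy : adjacent x y), par (Edge xy) e.

(** The next vertex [x1] and the other end [a'] of the dual edge at [a] are both closer to [b'] than
    [a]; the square they span with [a] carries the dual edge over to [x1]. *)
Lemma carrier_convex e a b x : side e a = side e b -> carrier e a -> carrier e b ->
  btw d 0 a x b -> carrier e x.
Proof.
move En : (d a x) => n; elim: n a En => [|n IH] a En hs ca cb hb.
  by rewrite -(edge_dist_eq0 En).
have [|x1 h1 h2] := @dG a x 1; first by rewrite En.
have ax1 : adjacent a x1 by apply/(edge_dist_eq1 hX).
have hb1 : btw d 0 a x1 b.
  by move: hb; rewrite /btw; have := dT x1 x b; lia.
have hb1x : btw d 0 x1 x b.
  by move: hb; rewrite /btw; have := dT a x1 b; lia.
have hs1 := side_convex hs hb1.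
apply: (IH x1) => //; [lia|by rewrite hs1|].
have [a' [aa' pa]] := ca; have [b' [bb' pb]] := cb.
have sE y z (yz : adjacent y z) : par (Edge yz) e -> side e z = ~~ side e y.
  move=> p; have := par_side y z p; rewrite (side_src (Edge yz)) /=.
  by have /= /negbTE -> := side_tgt (Edge yz) => /=; case: (side e y); case: (side e z).
have nx : x1 <> a' by move=> E; move: (sE _ _ _ pa); rewrite -E hs1; case: (side e a).
have close y z t (yz : adjacent y z) : par (Edge yz) e -> side e t = side e y -> d t z = (d t y).+1.
  move=> p st; have := sideE (Edge yz) t.
  have := par_side t y p; rewrite st eqxx (side_src (Edge yz)) /=.
  by case: (side _ t).
have e1 := close _ _ a _ pb hs; have e2 := close _ _ x1 _ pb (etrans hs1 hs).
have e3 := close _ _ b _ pa (esym hs).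
have e4 : d a' b = (d a' b').+1.
  apply: (close _ _ a' (adjacentC bb')); last by rewrite (sE _ _ _ pa) (sE _ _ _ pb) hs.
  have -> : Edge (adjacentC bb') = edge_rev (Edge bb') by [].
  by rewrite /par ends_rev.
have [||u sq _] := @quadrangle X hX a x1 a' b' ax1 aa' nx.
- by move: hb1; rewrite /btw; have := dT a x1 b; lia.
- by rewrite (dC b a') in e3; have := dC b a; lia.
have [_ [[_ x1u _ _] _]] := sq.
exists u, x1u; apply: par_trans pa.
rewrite /par /ends /=; apply: rst_sym; have := square_parallel (square_flip sq).
by [].
Qed.

(** If the equation fails at [z], the quadrangle condition at the next vertex towards [y] yields a
    point [u] of [S] closer to [v] than the equation for [u], known by induction, permits. *)
Lemma gate (S : set X) v y : (forall a b z, S a -> S b -> btw d 0 a z b -> S z) ->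
  S y -> (forall z, S z -> d v y <= d v z) -> forall z, S z -> d v z = d v y + d y z.
Proof.
move=> cS Sy hmin z; move En : (d z y) => n.
elim: n {-2}n (leqnn n) z En => [|m IH] [|n] hn z En Sz //.
- by rewrite -(edge_dist_eq0 En) d0 addn0.
- by rewrite -(edge_dist_eq0 En) d0 addn0.
have [|z1 h1 h2] := @dG z y 1; first by rewrite En.
have zz1 : adjacent z z1 by apply/(edge_dist_eq1 hX).
have Sz1 : S z1 by apply: cS Sz Sy _; rewrite /btw; lia.
have e1 := IH n hn z1 ltac:(lia) Sz1.
rewrite (dC y z1) in e1; rewrite (dC y z).
case: (edge_dist_adjacent hX v zz1) => e2; first by lia.
case: n hn En e1 => [|n] hn En e1.
  by have := hmin z Sz; lia.
have [|z2 h3 h4] := @dG z1 y 1; first by lia.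
have z12 : adjacent z1 z2 by apply/(edge_dist_eq1 hX).
have Sz2 : S z2 by apply: cS Sz1 Sy _; rewrite /btw; lia.
have e3 := IH n (ltnW hn) z2 ltac:(lia) Sz2; rewrite (dC y z2) in e3.
have nz : z <> z2 by move=> E; subst z2; lia.
have [||u sq eu] := @quadrangle X hX z1 z z2 v (adjacentC zz1) z12 nz.
- by rewrite !(dC _ v); lia.
- by rewrite !(dC _ v); lia.
have [_ [[_ zu uz2 _] _]] := sq.
have hz : d z z2 = 2.
  have := dT z z1 z2; have := edge_dist_adjacent hX y zz1; have := edge_dist_adjacent hX y z12.
  have := (edge_dist_eq1 hX z z2).1; case E : (d z z2) => [|[|k]]; try lia.
    by have := nz (edge_dist_eq0 E).
  move/(_ erefl) => zz2; have := edge_dist_adjacent hX y zz2; rewrite !(dC y); lia.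
have Su : S u.
  apply: cS Sz Sz2 _; rewrite /btw hz.
  by rewrite (edge_dist_eq1 hX _ _).2 // (edge_dist_eq1 hX _ _).2.
have huy : d u y = n.+1.
  have := edge_dist_adjacent hX y zu; have := edge_dist_adjacent hX y uz2.
  rewrite !(dC y); lia.
have e4 := IH n.+1 hn u huy Su; rewrite (dC y u) in e4.
by rewrite !(dC _ v) in eu; lia.
Qed.

Definition crossing e f : Prop := forall s t, exists x, side e x = s /\ side f x = t.

(** Apply the quadrangle condition towards a vertex of the quadrant opposite to that of [v]. *)
Lemma crossing_square e f v a b (va : adjacent v a) (vb : adjacent v b) :
  crossing e f -> par (Edge va) e -> par (Edge vb) f -> exists c, square v a c b.
Proof.
move=> cr pa pb; have [w [h1 h2]] := cr (~~ side e v) (~~ side f v).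
have sa : ~~ side (Edge va) w.
  have := par_side v w pa; rewrite (side_src (Edge va)) h1.
  by case: (side e v); case: (side _ w).
have sb : ~~ side (Edge vb) w.
  have := par_side v w pb; rewrite (side_src (Edge vb)) h2.
  by case: (side f v); case: (side _ w).
have ha := sideE (Edge va) w; rewrite (negbTE sa) /= in ha.
have hb := sideE (Edge vb) w; rewrite (negbTE sb) /= in hb.
have nab : a <> b.
  move=> eab; subst b; have [w' [h3 h4]] := cr (side e v) (~~ side f v).
  have := par_side v w' pa; have := par_side v w' pb.
  rewrite (Prop_irrelevance vb va) h3 h4 eqxx => ->.
  by case: (side f v).
have [||c sq _] := @quadrangle X hX v a b w va vb nab.
- by rewrite !(dC _ w).
- by rewrite !(dC _ w).
by exists c.
Qed.

(** Walk from [v] towards its gate in the opposite halfspace of [k]. By the gate property that whole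
    halfspace lies beyond the wall of each edge walked before the last, so this wall is [T i] itself
    or crosses [T i]; either way the next vertex is still on the carrier of [T i]. *)
Lemma common_carrier (I : Type) (T : I -> edge X) k v :
  (forall j, crossing (T j) k) -> (forall j, carrier (T j) v) ->
  exists v', (forall j, carrier (T j) v') /\ carrier k v'.
Proof.
move=> cr; have [z hz] : exists z, side k z != side k v.
  case sv : (side k v); [exists (tgt k)|exists (src k)].
    by rewrite (negbTE (side_tgt k)).
  by rewrite side_src.
move: (leqnn (d v z)) hz; move: {2}(d v z) => n.
elim: n z v => [|n IH] z v hn hz hv.
  have E : v = z by apply: edge_dist_eq0; lia.
  by rewrite E eqxx in hz.
have [m /asboolP [y [sy ey]] hm] : exists2 m, `[< exists y, side k y != side k v /\ d v y = m >] &
    forall y, side k y != side k v -> m <= d v y.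
  have ex : exists m, `[< exists y, side k y != side k v /\ d v y = m >].
    by exists (d v z); apply/asboolP; exists z.
  exists (ex_minn ex); case: ex_minnP => // m _ hm y hy.
  by apply: hm; apply/asboolP; exists y.
have hg := @gate [set y | side k y != side k v] v y.
have {}hg : forall t, side k t != side k v -> d v t = d v y + d y t.
  apply: hg => //; last by move=> t ht; rewrite ey; apply: hm.
  move=> a b t /= ha hb hab; rewrite (side_convex _ hab) //.
  by move: ha hb; case: (side k a); case: (side k b); case: (side k v).
case: m ey hm => [|[|m]] ey hm.
- by rewrite (edge_dist_eq0 ey) eqxx in sy.
- have vy : adjacent v y by apply/(edge_dist_eq1 hX).
  exists v; split=> //; exists y, vy.
  by apply: separated_adjacent_parallel; rewrite eq_sym.
have [|x h1 h2] := @dG v y 1; first by rewrite ey.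
have vx : adjacent v x by apply/(edge_dist_eq1 hX).
have sx : side k x = side k v.
  by apply: contrapT => /eqP /hm; rewrite h1.
apply: (IH y x).
- by have := hm z hz; lia.
- by rewrite sx.
pose j := Edge vx.
have hj t : side k t != side k v -> ~~ side j t.
  by move=> /hg ht; have := dT x y t; rewrite /side /= !(dC t); lia.
move=> i; have [a [va pa]] := hv i.
have [sa|sa] := boolP (side j a); last first.
  have p : par (Edge va) j.
    by apply: separated_adjacent_parallel; rewrite (negbTE sa) (side_src j).
  exists v, (adjacentC vx); apply: par_trans (pa); apply: par_sym; apply: par_trans p _.
  have -> : Edge (adjacentC vx) = edge_rev j by [].
  by rewrite /par ends_rev; apply: rst_refl.
have [c sq] : exists c, square v x c a.
  apply: (crossing_square (e := j) (f := T i) (va := vx) (vb := va)) => //; last exact: par_refl.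
  case=> t.
    have sva : side (T i) v != side (T i) a.
      rewrite -(par_side _ _ pa) (side_src (Edge va)).
      by have /= /negbTE -> := side_tgt (Edge va).
    case: (eqVneq (side (T i) v) t) => ht; [exists v|exists a]; split=> //.
      exact: (side_src j).
    by move: sva ht; case: (side _ v); case: (side _ a); case: t.
  have [s [h3 h4]] := cr i t (~~ side k v).
  exists s; split=> //; apply/negbTE/hj.
  by rewrite h4; case: (side k v).
have [_ [[_ xc _ _] _]] := sq.
exists c, xc; apply: par_trans pa; apply: rst_sym.
exact: square_parallel (square_flip sq).
Qed.

(** The neighbours of [v] across the walls pairwise span squares, so the flag condition puts them in
    one cube. *)
Lemma common_cube n (T : 'I_n -> edge X) v : (forall i j, i <> j -> crossing (T i) (T j)) ->
  (forall i, carrier (T i) v) ->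
  exists c m (f : hypercube m -> X), [/\ cube c, chart c f &
    forall i, exists j (x : hypercube m), parallel (ends (T i)) [set f x; f (flip x j)]].
Proof.
move=> cr hv; have [_ flagX] := hX.
have hv' i : exists y, exists vy : adjacent v y, par (Edge vy) (T i) := hv i.
have [a ha] := choice hv'.
have [|c [m [f [x [cc hf ex hA]]]]] := @link_chart X v (range a).
  apply: flagX.
  - exact: finite_image.
  - by move=> _ [i _ <-]; case: (ha i).
  - move=> _ _ [i _ <-] [j _ <-] nij.
    have [vi pi] := ha i; have [vj pj] := ha j.
    have nij' : i <> j by move=> E; apply: nij; rewrite E.
    have [c sq] := crossing_square (cr _ _ nij') pi pj.
    exact: square_link sq.
exists c, m, f; split=> // i.
have [|j ej] := (hA (a i)).1; first by exists i.
exists j, x; rewrite ex -ej; have [vi pi] := ha i.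
exact: rst_sym.
Qed.

End Halfspaces.

(** * Hyperplanes in the realization *)

Section Realization.
Import Order.TTheory GRing.Theory Num.Theory.
Variables (R : realType) (X : cubeComplex).
Local Open Scope ring_scope.
Local Notation realization := (@realization X R).

Lemma chart_parallel c n (f : hypercube n -> X) x y i : chart c f ->
  parallel [set f x; f (flip x i)] [set f y; f (flip y i)].
Proof.
move=> hf; move Em : #|[set j | x j != y j]%SET| => m.
elim: m x Em => [|m IH] x Em.
  have -> : x = y; last exact: rst_refl.
  apply/ffunP => j; apply/eqP/negPn/negP => hj.
  by move/eqP: Em; rewrite cards_eq0 => /eqP/setP/(_ j); rewrite !inE hj.
have [j hj] : exists j, j \in [set j | x j != y j]%SET by apply/card_gt0P; rewrite Em.
apply: rst_trans (IH (flip x j) _); last first.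
  move: Em; rewrite (cardsD1 j) hj => -[<-]; congr #|pred_of_set _|.
  apply/setP => k; rewrite !inE ffunE; case: (eqVneq k j) => [->|_]; last by rewrite addbF.
  by move: hj; rewrite inE; case: (x j); case: (y j).
case: (eqVneq i j) => [->|/eqP ij].
  by rewrite flipK setUC; apply: rst_refl.
by rewrite (flipC x j); apply: square_parallel; apply: chart_square hf _ _ _ ij.
Qed.

Lemma chart_pointE n (f : hypercube n -> X) (p : 'I_n -> R) (x : hypercube n) : injective f ->
  chart_point f p (f x) = \prod_(i < n) (if x i then p i else 1 - p i).
Proof.
move=> fI; rewrite /chart_point (big_pred1 x) // => y.
by apply/asboolP/eqP => [/fI|->].
Qed.

Lemma chart_point_supp n (f : hypercube n -> X) (p : 'I_n -> R) v :
  chart_point f p v <> 0 -> exists x, v = f x.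
Proof.
move=> h; apply: contrapT => hn; apply: h; rewrite /chart_point big_pred0 // => x.
by apply/negbTE/asboolP => e; apply: hn; exists x.
Qed.

Lemma chart_point_neq0 n (f : hypercube n -> X) (p : 'I_n -> R) (x : hypercube n) : injective f ->
  (forall i, if x i then p i != 0 else p i != 1) -> chart_point f p (f x) <> 0.
Proof.
move=> fI h; rewrite chart_pointE //; apply/eqP/prodf_neq0 => i _.
by have := h i; case: (x i) => //; rewrite subr_eq0 eq_sym.
Qed.

Lemma half_neq : (2^-1 != 0 :> R) /\ (2^-1 != 1 :> R).
Proof. by rewrite invr_eq0 invr_eq1 pnatr_eq0 (eqr_nat _ 2 1). Qed.

Lemma dual_edge E c n (g : hypercube n -> X) (q : 'I_n -> R) : chart c g ->
  dual_hyperplane E (chart_point g q) ->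
  exists x i, parallel E [set g x; g (flip x i)].
Proof.
move=> hg [c' [m [f [p [i [hf _ hpi ew [a pa]]]]]]].
(* The vertex [x] and its flip in the coordinate equal to one half both have nonzero weight. So the
   point, as a function, determines an edge dual to [E], whichever chart presents it. *)
pose x : hypercube m := [ffun j => p j != 0].
have [h0 h1] := half_neq.
have s1 : chart_point f p (f x) <> 0.
  apply: chart_point_neq0 (chart_inj hf) _ => j; rewrite ffunE.
  by case: eqVneq => //= ->; rewrite eq_sym oner_eq0.
have s2 : chart_point f p (f (flip x i)) <> 0.
  apply: chart_point_neq0 (chart_inj hf) _ => j; rewrite !ffunE.
  case: (eqVneq j i) => [->|_]; first by rewrite hpi h0.
  by rewrite addbF; case: eqVneq => //= ->; rewrite eq_sym oner_eq0.
rewrite -ew in s1 s2.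
have [y ey] := chart_point_supp s1; have [y' ey'] := chart_point_supp s2.
have := chart_adjacent hf x i; rewrite ey ey' => /(chart_adjacentP hg) [k ek].
exists y, k; rewrite -ek -ey -ey'; apply: rst_trans pa _.
by rewrite face_edge image_setU !image_set1; apply: chart_parallel hf.
Qed.

Definition center n (g : hypercube n -> X) : X -> R := chart_point g (fun=> 2^-1).

Lemma half_unit n : unit_cube (fun _ : 'I_n => 2^-1 : R).
Proof. by move=> i; rewrite invr_ge0 ler0n invf_le1 ?ltr0n // ler1n. Qed.

Lemma center_dual E c n (g : hypercube n -> X) x i : chart c g ->
  parallel E [set g x; g (flip x i)] -> dual_hyperplane E (center g).
Proof.
move=> hg pE; exists c, n, g, (fun=> 2^-1), i; split=> //; first exact: half_unit.
by exists x; rewrite face_edge image_setU !image_set1.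
Qed.

Lemma center_realization c n (g : hypercube n -> X) : chart c g -> realization (center g).
Proof. by move=> hg; exists c, n, g, (fun=> 2^-1); split=> //; exact: half_unit. Qed.

Lemma dual_hyperplane_parallel E E' : parallel E E' ->
  dual_hyperplane E = dual_hyperplane E' :> set (X -> R).
Proof.
have H D D' : parallel D D' -> dual_hyperplane D `<=` (dual_hyperplane D' : set (X -> R)).
  move=> h w [c [n [f [p [i [h1 h2 h3 h4 [a h5]]]]]]].
  exists c, n, f, p, i; split=> //; exists a; apply: rst_trans h5; exact: rst_sym.
by move=> h; apply/seteqP; split; apply: H => //; apply: rst_sym.
Qed.

Section Family.
Variables (n : nat) (T : 'I_n -> edge X).

Definition family_set : set (X -> R) :=
  realization `&` \bigcap_(i in [set: 'I_n]) dual_hyperplane (ends (T i)).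

Definition family_cube m (f : hypercube m -> X) : Prop :=
  forall i, exists j (x : hypercube m), parallel (ends (T i)) [set f x; f (flip x j)].

Lemma family_set_cube : family_set !=set0 ->
  exists c m (f : hypercube m -> X), [/\ cube c, chart c f & family_cube f].
Proof.
case=> w [[c [m [f [p [hf _ ew]]]]] hw]; exists c, m, f; split=> //.
  have [_ <- _] := hf; have := chart_face hf (finset.set0) [ffun=> false].
  congr cube; apply/seteqP; split=> _ [x _ <-]; exists x => //.
  by move=> i; rewrite inE.
move=> i; have [] := dual_edge hf (_ : dual_hyperplane (ends (T i)) (chart_point f p)).
  by rewrite -ew; apply: hw.
by move=> x [j h]; exists j, x.
Qed.

Lemma family_cube_set c m (f : hypercube m -> X) : chart c f -> family_cube f ->
  family_set !=set0.
Proof.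
move=> hf h; exists (center f); split; first exact: center_realization hf.
by move=> i _; have [j [x p]] := h i; apply: center_dual hf p.
Qed.

(* The centre of a cube lies on no hyperplane other than those dual to that cube. *)
Lemma family_center : family_set !=set0 -> exists2 w, family_set w &
  forall E, dual_hyperplane E w -> exists i, parallel E (ends (T i)).
Proof.
move=> /family_set_cube [c [m [f [cc hf /choice [jj hj]]]]].
(* Freezing the directions chosen for no [T i] leaves a face all of whose directions belong to the
   family; its centre is the point sought. *)
pose J : {set 'I_m} := [set j | j \notin codom jj]%SET.
pose x0 : hypercube m := [ffun=> false].
have [m' [g hg]] := cubeP (chart_face hf J x0).
have rg y : exists2 z, face J x0 z & g y = f z.
  by have [z hz <-] := chart_in hg y; exists z.
have hpar i x : parallel (ends (T i)) [set f x; f (flip x (jj i))].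
  by have [y hy] := hj i; apply: rst_trans hy (chart_parallel _ _ _ hf).
exists (center g).
  split; first exact: center_realization hg.
  move=> i _.
  have [y ey] : exists y, f x0 = g y by apply: (chartP hg); exists x0.
  have [y' ey'] : exists y, f (flip x0 (jj i)) = g y.
    apply: (chartP hg); exists (flip x0 (jj i)) => // k; rewrite inE ffunE => hk.
    case: (eqVneq k (jj i)) => [e|_]; last by rewrite addbF.
    by move: hk; rewrite e codom_f.
  have := chart_adjacent hf x0 (jj i); rewrite ey ey' => /(chart_adjacentP hg) [k ek].
  by apply: (center_dual (x := y) (i := k) hg); rewrite -ek -ey -ey'.
move=> E /(dual_edge hg) [y [k pE]].
have [z hz ez] := rg y; have [z' hz' ez'] := rg (flip y k).
have := chart_adjacent hg y k; rewrite ez ez' => /(chart_adjacentP hf) [l el].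
have : l \in codom jj.
  apply: contrapT => /negP hl; have hlJ : l \in J by rewrite inE.
  have := hz' l hlJ; rewrite -(hz l hlJ) el ffunE eqxx.
  by case: (z l).
case/codomP => i ei; exists i; apply: rst_trans pE _.
by rewrite ez ez' el ei; exact: (rst_sym _ _ _ _ (hpar _ _)).
Qed.

End Family.

Variables (G : groupType) (a : cubicalAction G X).
Implicit Types (g h : G).

Lemma actK g : cancel (a g) (a g^-1%g).
Proof. by move=> v; rewrite -actM mulVg act1. Qed.

Lemma actVK g : cancel (a g^-1%g) (a g).
Proof. by move=> v; rewrite -actM mulgV act1. Qed.

Lemma act_inj g : injective (a g).
Proof. exact: can_inj (actK g). Qed.

Lemma image_act g h (E : set X) : a (g * h)%g @` E = a g @` (a h @` E).
Proof.
apply/seteqP; split=> [_ [v hv <-]|_ [_ [v hv <-] <-]].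
  by exists (a h v); [exists v|rewrite actM].
by exists v; rewrite ?actM.
Qed.

Lemma image_act1 (E : set X) : a 1%g @` E = E.
Proof.
apply/seteqP; split=> [_ [v hv <-]|v hv]; first by rewrite act1.
by exists v; rewrite ?act1.
Qed.

Lemma act_adjacent g v w : adjacent v w -> adjacent (a g v) (a g w).
Proof.
case=> n c; split; first by move=> /act_inj.
by have := act_cube a g c; rewrite image_setU !image_set1.
Qed.

Definition eact g (e : edge X) : edge X := Edge (act_adjacent g (edgeP e)).

Lemma ends_eact g e : ends (eact g e) = a g @` ends e.
Proof. by rewrite /ends /= image_setU !image_set1. Qed.

Lemma act_square g x y z t : square x y z t -> square (a g x) (a g y) (a g z) (a g t).
Proof.
case=> c [[h1 h2 h3 h4] [h5 h6]]; split; last first.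
  by split; [split; exact: act_adjacent|split=> /act_inj].
have := act_cube a g c; congr cube; apply/seteqP; split=> [_ [u hu <-]|u] /=.
  by case: hu => ->; [apply: Or41|apply: Or42|apply: Or43|apply: Or44].
by case=> ->; [exists x|exists y|exists z|exists t] => //=;
  [apply: Or41|apply: Or42|apply: Or43|apply: Or44].
Qed.

Lemma act_parallel g E E' : parallel E E' -> parallel (a g @` E) (a g @` E').
Proof.
elim=> [D D' [x [y [z [t [sq -> ->]]]]]|D|D D' _ h|D D' D'' _ h _ h'].
- rewrite !image_setU !image_set1; exact: square_parallel (act_square g sq).
- exact: rst_refl.
- exact: rst_sym.
- exact: rst_trans h h'.
Qed.

Lemma act_chart g c n (f : hypercube n -> X) : chart c f -> chart (a g @` c) (a g \o f).
Proof.
case=> fI fc h; split; first exact: inj_comp (@act_inj g) fI.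
  by rewrite -fc image_comp.
move=> D; split.
  case=> cD Dc; have [|J [x e]] := (h (a g^-1%g @` D)).1.
    split; first exact: act_cube.
    by move=> _ [v /Dc [w hw <-] <-]; rewrite actK.
  by exists J, x; rewrite -image_comp -e -image_act mulgV image_act1.
case=> J [x ->]; have [cD Dc] : cube (f @` face J x) /\ f @` face J x `<=` c by apply/h; exists J, x.
rewrite -image_comp; split; first exact: act_cube.
exact: image_subset.
Qed.

Lemma act_chart_point g n (f : hypercube n -> X) (p : 'I_n -> R) :
  act_point a g (chart_point f p) = chart_point (a g \o f) p.
Proof.
apply/funext => v; rewrite /act_point /chart_point; apply: eq_bigl => x /=.
apply/asboolP/asboolP => [->|<-]; [exact: actVK|by rewrite actK].
Qed.

Lemma act_pointK g (w : X -> R) : act_point a g (act_point a g^-1%g w) = w.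
Proof. by apply/funext => v; rewrite /act_point invgK actVK. Qed.

Lemma act_pointVK g (w : X -> R) : act_point a g^-1%g (act_point a g w) = w.
Proof. by apply/funext => v; rewrite /act_point invgK actK. Qed.

Lemma act_dual g E w : dual_hyperplane E w ->
  dual_hyperplane (a g @` E) (act_point a g w : X -> R).
Proof.
case=> c [n [f [p [i [hf up hpi -> [x px]]]]]].
exists (a g @` c), n, (a g \o f), p, i; split=> //; first exact: act_chart.
  exact: act_chart_point.
by exists x; rewrite -image_comp; apply: act_parallel.
Qed.

Lemma act_realization g w : realization w -> realization (act_point a g w : X -> R).
Proof.
case=> c [n [f [p [hf up ->]]]]; exists (a g @` c), n, (a g \o f), p; split=> //.
  exact: act_chart.
exact: act_chart_point.
Qed.

Definition permutes n (T : 'I_n -> edge X) g : Prop :=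
  forall i, exists j, par (eact g (T i)) (T j).

Lemma act_family_set n (T : 'I_n -> edge X) g w : permutes T g^-1%g ->
  family_set T w -> family_set T (act_point a g w).
Proof.
move=> hT [hr hw]; split; first exact: act_realization.
move=> i _; have [j pj] := hT i.
have := act_dual g (hw j I).
have : parallel (a g @` ends (T j)) (ends (T i)).
  have := act_parallel g (rst_sym _ _ _ _ pj).
  by rewrite ends_eact -image_act mulgV image_act1.
by move/dual_hyperplane_parallel => ->.
Qed.

(** The point of [family_center] lies on no hyperplane outside the family, so preserving the
    intersection forces [g] and its inverse to permute the family up to parallelism. *)
Lemma stab_family (H : set G) n (T : 'I_n -> edge X) : family_set T !=set0 ->
  stab a H (family_set T) = [set g | [/\ H g, permutes T g & permutes T g^-1%g]].
Proof.
move=> /family_center [w hw hE]; apply/seteqP; split=> g; last first.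
  case=> Hg h1 h2; split=> //; apply/seteqP; split=> [_ [v hv <-]|v hv].
    exact: act_family_set.
  exists (act_point a g^-1%g v); last exact: act_pointK.
  by apply: act_family_set; rewrite ?invgK.
case=> Hg ht; split=> // i.
  have [v hv ev] : (act_point a g @` family_set T) w by rewrite ht.
  have := act_dual g (hv.2 i I); rewrite ev -ends_eact => /hE.
  by [].
have : family_set T (act_point a g w) by rewrite -ht; exists w.
case=> _ /(_ i I) /(act_dual g^-1%g); rewrite act_pointVK -ends_eact => /hE.
by [].
Qed.

End Realization.

(** * Word metrics *)

Lemma finite_set_bound T (A : set T) (f : T -> nat) : finite_set A ->
  exists N, forall x, A x -> f x <= N.
Proof.
move=> fA; have /finite_seqP [s es] : finite_set (f @` A) by apply: finite_image.
exists (\max_(i <- s) i) => x Ax.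
have : f x \in s by have : [set` s] (f x) by rewrite -es; exists x.
by elim: s {es} => // y s IH; rewrite in_cons big_cons => /orP[/eqP ->|/IH]; lia.
Qed.

Lemma finite_set_choice_bound T (A : set T) (P : T -> nat -> Prop) : finite_set A ->
  (forall x m n, m <= n -> P x m -> P x n) -> (forall x, A x -> exists n, P x n) ->
  exists N, forall x, A x -> P x N.
Proof.
move=> fA mono ex; have ex' x : exists n, A x -> P x n.
  by case: (EM (A x)) => [/ex [n hn]|h]; [exists n|exists 0].
have [f hf] := choice ex'; have [N hN] := finite_set_bound f fA.
by exists N => x Ax; apply: mono (hN x Ax) _; apply: hf.
Qed.

Lemma finite_set_functions m (T : eqType) (D : set T) : finite_set D ->
  finite_set [set f : 'I_m -> T | forall i, D (f i)].
Proof.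
move=> /finite_seqP [s ->].
have : finite_set ((fun (f : {ffun 'I_m -> 'I_(size s)}) i => tnth (in_tuple s) (f i)) @` setT).
  exact/finite_image/finite_finset.
apply: sub_finite_set => f hf.
have hf' i : exists j : 'I_(size s), f i = tnth (in_tuple s) j.
  have hi : index (f i) s < size s by rewrite index_mem; apply: hf.
  exists (Ordinal hi); rewrite (tnth_nth (f i)) /= nth_index //; exact: hf.
have [j hj] := choice hf'; exists [ffun i => j i] => //.
by apply/funext => i; rewrite ffunE hj.
Qed.

Section WordBalls.
Local Open Scope group_scope.
Variables (G : groupType) (S : set G).
Implicit Types g h x y : G.

Lemma word_ball1 n : word_ball S n 1.
Proof. by exists [::]; rewrite big_nil. Qed.

Lemma word_ball0 g : word_ball S 0 g -> g = 1.
Proof. by case=> -[|x w] [// _ _ ->]; rewrite big_nil. Qed.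

Lemma word_ball_mono m n g : m <= n -> word_ball S m g -> word_ball S n g.
Proof. by move=> h [w [sw hw ->]]; exists w; split=> //; apply: leq_trans h. Qed.

Lemma word_ballM m n g h : word_ball S m g -> word_ball S n h ->
  word_ball S (m + n) (g * h).
Proof.
move=> [w [sw hw ->]] [v [sv hv ->]]; exists (w ++ v); rewrite big_cat size_cat; split=> //.
  exact: leq_add.
by move=> x; rewrite mem_cat => /orP[/hw|/hv].
Qed.

Lemma word_ballV n g : word_ball S n g -> word_ball S n g^-1.
Proof.
move=> [w [sw hw ->]]; exists (rev [seq x^-1 | x <- w]); split.
- by rewrite size_rev size_map.
- by move=> x; rewrite mem_rev => /mapP [y /hw hy ->]; rewrite invgK; tauto.
by rewrite -map_rev big_map prodgV revK.
Qed.

Lemma word_ball_split m n g : word_ball S (m + n) g ->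
  exists g1 g2, [/\ word_ball S m g1, word_ball S n g2 & g = g1 * g2].
Proof.
move=> [w [sw hw ->]]; exists (\prod_(x <- take m w) x), (\prod_(x <- drop m w) x).
split; last by rewrite -big_cat cat_take_drop.
  exists (take m w); split=> //; first by rewrite size_take; case: ltnP => //; lia.
  by move=> x /mem_take; apply: hw.
exists (drop m w); split=> //; first by rewrite size_drop; lia.
by move=> x /mem_drop; apply: hw.
Qed.

Lemma word_ball_gen g : S g -> word_ball S 1 g.
Proof.
by move=> Sg; exists [:: g]; rewrite big_seq1; split=> // x; rewrite inE => /eqP ->; left.
Qed.

Lemma word_ball_finite n : finite_set S -> finite_set (word_ball S n).
Proof.
move=> fS; elim: n => [|n IH].
  by apply: (sub_finite_set _ (finite_set1 1)) => g /word_ball0.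
pose S1 := S `|` (fun x => x^-1) @` S.
have fS1 : finite_set S1 by rewrite finite_setU; split=> //; apply: finite_image.
have : finite_set ([set 1] `|` [set x * y | x in S1 & y in word_ball S n]).
  by rewrite finite_setU; split=> //; apply: finite_image2.
apply: sub_finite_set => g [[|x w] [sw hw ->]]; first by left; rewrite big_nil.
right; rewrite big_cons; exists x.
  case: (hw x (mem_head _ _)) => h; [by left|right; exists x^-1 => //; exact: invgK].
exists (\prod_(y <- w) y) => //; exists w; split=> // y hy.
by apply: hw; rewrite in_cons hy orbT.
Qed.

Hypothesis hS : generates S [set: G].

Let word_dist_exists x y : exists n, `[< word_dist_le S n x y >].
Proof.
have : [set: G] (x^-1 * y) by [].
by rewrite hS => -[n _ h]; exists n; apply/asboolP.
Qed.

Definition word_dist x y := ex_minn (word_dist_exists x y).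

Local Notation d := word_dist.

Lemma word_distP n x y : word_dist_le S n x y <-> d x y <= n.
Proof.
rewrite /word_dist; case: ex_minnP => m /asboolP h1 h2; split=> [h|h].
  by apply: h2; apply/asboolP.
exact: word_ball_mono h h1.
Qed.

Lemma word_distM g x y : d (g * x) (g * y) = d x y.
Proof.
have H n : word_dist_le S n (g * x) (g * y) <-> word_dist_le S n x y.
  by rewrite /word_dist_le invgM -mulgA mulKg.
by apply/eqP; rewrite eqn_leq; apply/andP; split; apply/word_distP/H/word_distP.
Qed.

Lemma word_dist_metric : geodesic_metric d.
Proof.
have sym x y : d x y <= d y x.
  apply/word_distP; rewrite /word_dist_le -(invgK (x^-1 * y)) invgM invgK.
  by apply: word_ballV; apply/word_distP.
split=> [x|x y|x y z|x y i hi].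
- by apply/eqP; rewrite -leqn0; apply/word_distP; rewrite /word_dist_le mulVg; apply: word_ball1.
- by apply/eqP; rewrite eqn_leq !sym.
- apply/word_distP; rewrite /word_dist_le; have -> : x^-1 * z = (x^-1 * y) * (y^-1 * z).
    by rewrite mulgA mulgK.
  by apply: word_ballM; apply/word_distP.
- have : word_dist_le S (i + (d x y - i)) x y by apply/word_distP; lia.
  case/word_ball_split => g1 [g2 [h1 h2 e]].
  have hh1 : d x (x * g1) <= i by apply/word_distP; rewrite /word_dist_le mulKg.
  have hh2 : d (x * g1) y <= d x y - i.
    apply/word_distP; rewrite /word_dist_le.
    suff -> : (x * g1)^-1 * y = g2 by [].
    by apply: (mulgI g1); rewrite invgM !mulgA mulgV mul1g -e.
  have : d x y <= d x (x * g1) + d (x * g1) y.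
    apply/word_distP; rewrite /word_dist_le; have -> : x^-1 * y = (x^-1 * (x * g1)) * ((x * g1)^-1 * y).
      by rewrite mulgA mulgK.
    by apply: word_ballM; apply/word_distP.
  by exists (x * g1); lia.
Qed.

Lemma word_dist_finite n : finite_set S -> finite_set [set g | d 1 g <= n].
Proof.
move=> fS; apply: sub_finite_set (word_ball_finite n fS) => g /word_distP.
by rewrite /word_dist_le invg1 mul1g.
Qed.

Let d0 x : d x x = 0. Proof. by case: word_dist_metric. Qed.
Let dC x y : d x y = d y x. Proof. by case: word_dist_metric. Qed.
Let dT x y z : d x z <= d x y + d y z. Proof. by case: word_dist_metric. Qed.

Lemma word_dist_eq0 x y : d x y = 0 -> x = y.
Proof.
move=> h; have /word_distP/word_ball0 e : d x y <= 0 by rewrite h.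
by rewrite -(mulVKg x y) e mulg1.
Qed.

Lemma geodesic_word_dist n p i j : geodesic S n p -> i <= j <= n -> d (p i) (p j) = j - i.
Proof.
move=> hp /hp [h1 h2]; apply/eqP; rewrite eqn_leq; apply/andP; split; first exact/word_distP.
by apply: h2; apply/word_distP.
Qed.

Lemma word_dist_geodesic n (p : nat -> G) :
  (forall i j, i <= j <= n -> d (p i) (p j) = j - i) -> geodesic S n p.
Proof.
move=> h i j /h e; split; first by apply/word_distP; rewrite e.
by move=> m /word_distP; rewrite e.
Qed.

Lemma geodesic_exists x y : exists p, geodesic_between S x y (d x y) p.
Proof.
have : word_dist_le S (d x y) x y by apply/word_distP.
case=> w [sw hw e].
pose p i := x * \prod_(g <- take i w) g.
have hp0 : p 0 = x by rewrite /p take0 big_nil mulg1.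
have hpn : p (d x y) = y by rewrite /p take_oversize // -e mulVKg.
have hs i : d (p i) (p i.+1) <= 1.
  apply/word_distP; rewrite /word_dist_le /p.
  case: (ltnP i (size w)) => hi; last first.
    by rewrite !take_oversize ?mulVg; [apply: word_ball1|lia|].
  rewrite (take_nth 1 hi) -cats1 big_cat big_seq1 /= (mulgA x) mulKg.
  exists [:: nth 1 w i]; rewrite big_seq1; split=> // z; rewrite inE => /eqP ->.
  by apply: hw; apply: mem_nth.
have hl i k : d (p i) (p (i + k)) <= k.
  elim: k => [|k IH]; first by rewrite addn0 d0.
  by have := dT (p i) (p (i + k)) (p (i + k.+1)); have := hs (i + k); rewrite addnS; lia.
exists p; split=> //; apply: word_dist_geodesic => i j hij.
have h1 := hl 0 i; have h2 := hl i (j - i); have h3 := hl j (d x y - j).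
move: h1 h2 h3; rewrite add0n !subnKC; try lia.
rewrite hp0 hpn; have := dT x (p i) y; have := dT (p i) (p j) y; lia.
Qed.

Lemma word_dist1 x y : d x y = d 1 (x^-1 * y).
Proof. by rewrite -[RHS](word_distM x) mulVKg mulg1. Qed.

Lemma word_dist_mulr x y : d x (x * y) = d 1 y.
Proof. by rewrite word_dist1 mulKg. Qed.

Lemma word_distV y : d 1 y^-1 = d 1 y.
Proof. by rewrite -(word_distM y) mulg1 mulgV dC. Qed.

(** A point of [[x, y]] where closeness to [[x, w]] stops is also close to [[y, w]], so its distance
    to [w] is about the Gromov product of [x] and [y] at [w]. Slimness of the triangle [x], [y], [z]
    at that point gives the inequality. *)
Lemma slim_four_point dl : slim_triangles S [set: G] dl -> four_point d (6 * dl + 2).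
Proof.
move=> slim x y z w.
have [p hp] := geodesic_exists x y; have [q hq] := geodesic_exists y w.
have [r hr] := geodesic_exists x w; have [q' hq'] := geodesic_exists y z.
have [r' hr'] := geodesic_exists x z.
have on_geo u v n (t : nat -> G) i : geodesic_between S u v n t -> i <= n ->
    d u (t i) + d (t i) v = d u v.
  case=> ht <- <- hi; rewrite !(geodesic_word_dist ht); lia.
have [_ hp0 hpn] := hp.
have [i hi [[a ha hia] [b hb hib]]] : exists2 i, i <= d x y &
    (exists2 a, d x a + d a w = d x w & d (p i) a <= dl) /\
    (exists2 b, d y b + d b w = d y w & d (p i) b <= dl + 1).
  pose P i := exists2 a, d x a + d a w = d x w & d (p i) a <= dl.
  have [i [Pi hi hii]] : exists i, [/\ P i, i <= d x y & i = d x y \/ ~ P i.+1].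
    apply: contrapT => hn.
    have hall i : i <= d x y -> P i.
      elim: i => [_|i IH hi]; first by exists x; rewrite ?hp0 d0.
      apply: contrapT => h; apply: hn; exists i; split; [exact/IH/ltnW|exact: ltnW|by right].
    by apply: hn; exists (d x y); split; [exact: hall| |left].
  exists i => //; split=> //; case: (leqP (d x y) i) => hi'.
    exists y; first by rewrite d0.
    have -> : i = d x y by lia.
    by rewrite hpn d0.
  case: hii => [|hn]; first by lia.
  have := slim x y w _ _ _ p q r I I I hp hq hr i.+1 hi'.
  case=> [[j hj /word_distP h]|[j hj /word_distP h]].
    exists (q j); first exact: on_geo hq hj.
    have := dT (p i) (p i.+1) (q j); case: (hp) => hp' _ _.
    by rewrite (geodesic_word_dist hp' (i := i) (j := i.+1)); lia.
  by case: hn; exists (r j) => //; exact: on_geo hr hj.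
have hv := on_geo _ _ _ _ _ hp hi.
have C1 := dC w (p i); have C2 := dC w x; have C3 := dC w y; have C4 := dC (p i) x.
have hpw : 2 * d w (p i) <= d x w + d y w - d x y + 4 * dl + 2.
  have := dT x a (p i); have := dT (p i) a w; have := dT y b (p i); have := dT (p i) b w.
  rewrite (dC a (p i)) (dC b (p i)) (dC y (p i)); lia.
have tri := dT x w y; rewrite (dC w y) in tri.
have [[j hj /word_distP h]|[j hj /word_distP h]] := slim x y z _ _ _ p q' r' I I I hp hq' hr' i hi.
  have hu := on_geo _ _ _ _ _ hq' hj.
  have := dT w (p i) (q' j); have := dT w (q' j) y; have := dT w (q' j) z.
  have := dC w z; have := dC y (q' j); have := dC y z; have := dC x w; lia.
have hu := on_geo _ _ _ _ _ hr' hj.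
have := dT w (p i) (r' j); have := dT w (r' j) x; have := dT w (r' j) z.
have := dC w z; have := dC x (r' j); lia.
Qed.

End WordBalls.

Lemma word_dist_lipschitz (G : groupType) (S S' : set G) (hS : generates S [set: G])
    (hS' : generates S' [set: G]) : finite_set S ->
  exists A, forall x y, word_dist hS' x y <= A * word_dist hS x y.
Proof.
move=> fS; have [A hA] := finite_set_bound (word_dist hS' 1%g) fS.
have [d0 _ dT _] := word_dist_metric hS'.
have key (w : seq G) : (forall x, x \in w -> S x \/ S x^-1%g) ->
    word_dist hS' 1%g (\prod_(x <- w) x)%g <= A * size w.
  elim: w => [|x w IH] hw; first by rewrite big_nil d0.
  rewrite big_cons /= mulnS.
  have h1 : word_dist hS' 1%g x <= A.
    by case: (hw x (mem_head _ _)) => /hA //; rewrite word_distV.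
  apply: leq_trans (dT _ x _) _; rewrite word_dist_mulr; apply: leq_add => //.
  by apply: IH => y hy; apply: hw; rewrite in_cons hy orbT.
exists A => x y; have /word_distP [w [sw hw e]] : word_dist hS x y <= word_dist hS x y by [].
rewrite word_dist1 e; apply: leq_trans (key _ hw) _.
by rewrite leq_mul2l sw orbT.
Qed.

(** * Quasiconvex subgroups *)

Section FixedGenerators.
Local Open Scope group_scope.
Variables (G : groupType) (S : set G).
Hypothesis fS : finite_set S.
Hypothesis hS : generates S [set: G].
Variable dl : nat.
Local Notation d := (word_dist hS).
Implicit Types g h x y : G.

Let dM := word_dist_metric hS.
Let d0 x : d x x = 0. Proof. by case: dM. Qed.
Let dC x y : d x y = d y x. Proof. by case: dM. Qed.
Let dT x y z : d x z <= d x y + d y z. Proof. by case: dM. Qed.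

(** Dividing [x] by a fixed representative of its type is a right multiplication by one of finitely
    many elements, which moves [x] boundedly in the left-invariant metric. *)
Lemma cofinite_types (F : Type) (t : G -> F) (A N : set G) : finite_set (t @` N) ->
  (forall x y, N x -> N y -> t x = t y -> A (x * y^-1)) ->
  exists c, forall x, N x -> exists2 z, A z & d x z <= c.
Proof.
move=> fN hA.
have hr f : exists y, (t @` N) f -> N y /\ t y = f.
  case: (EM ((t @` N) f)) => [[y Ny ty]|h]; first by exists y.
  by exists 1.
have [r hr'] := choice hr; have [c hc] := finite_set_bound (fun f => d 1 (r f)) fN.
exists c => x Nx; have tx : (t @` N) (t x) by exists x.
have [Ny ty] := hr' _ tx; exists (x * (r (t x))^-1); first exact: hA.
by rewrite word_dist_mulr word_distV; apply: hc.
Qed.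

Hypothesis d4 : four_point d dl.

(** Independence of the generating set: geodesics for another finite one are quasigeodesics for [S],
    and the Morse lemma applies. *)
Lemma quasiconvex_word_dist K : quasiconvex K [set: G] -> exists C, quasiconvex_set d C K.
Proof.
move=> [S' [fS' hS' [_ [C hC]]]].
have [A hA] := word_dist_lipschitz hS' hS fS'.
have [A' hA'] := word_dist_lipschitz hS hS' fS.
have [D0 hD0] := quasi_geodesic_near dM d4 A A' 0 0.
exists (D0 + A * C) => x y v Kx Ky hv.
have [p hp] := geodesic_exists hS' x y; have [hp1 hp2 hp3] := hp.
set n := word_dist hS' x y in hp hp1 hp3.
have qg : quasi_geodesic d A A' 0 p n.
  split=> [i hi|i j hij].
    apply: leq_trans (hA _ _) _.
    by rewrite (geodesic_word_dist hS' hp1) ?subSnn ?muln1 //; lia.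
  by rewrite addn0 -(geodesic_word_dist hS' hp1 hij); apply: hA'.
have [|i hi hvi] := hD0 p n qg v; first by rewrite hp2 hp3.
have [k Kk /(word_distP hS') hk] := hC x y n p Kx Ky hp i hi.
exists k => //; have := dT v (p i) k; have := hA (p i) k.
have : A * word_dist hS' (p i) k <= A * C by rewrite leq_mul2l hk orbT.
lia.
Qed.

Lemma quasiconvex_intro C K : quasiconvex_set d C K -> quasiconvex K [set: G].
Proof.
move=> hK; exists S; split=> //; split=> //; exists C => x y n p Kx Ky [hp hp0 hpn] i hi.
have [|z Kz hz] := hK x y (p i) Kx Ky; last by exists z => //; apply/(word_distP hS).
by rewrite /btw -hp0 -hpn !(geodesic_word_dist hS hp); lia.
Qed.

Lemma finite_ball_functions m c :
  finite_set [set f : 'I_m -> G | forall i, d 1 (f i) <= c].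
Proof. exact: finite_set_functions (word_dist_finite hS c fS). Qed.

(** A point near all [A i] has one of finitely many tuples of displacements from them, and two
    points with the same tuple differ by an element of every [A i]. Allowing [B] to be coarsely
    larger than the intersection covers setwise stabilisers. *)
Lemma quasiconvex_setI m (A : 'I_m -> set G) (B : set G) :
  (forall i, subgroup (A i)) -> (forall i, exists C, quasiconvex_set d C (A i)) ->
  (forall g, (forall i, A i g) -> B g) ->
  (exists c, forall b, B b -> exists2 z, (forall i, A i z) & d b z <= c) ->
  exists C, quasiconvex_set d C B.
Proof.
move=> sA qA AB [c hc].
have [C hC] : exists C, forall i, quasiconvex_set d C (A i).
  have [f hf] := choice qA; exists (\max_i f i) => i x y v Ax Ay hv.
  have [z Az hz] := hf i x y v Ax Ay hv; exists z => //; apply: leq_trans hz _.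
  exact: leq_bigmax.
pose D := 4 * c + dl + C.
pose N := [set v | forall i, exists z, A i z /\ d v z <= D].
have hs v : exists f : 'I_m -> G, N v -> forall i, A i (f i) /\ d v (f i) <= D.
  case: (EM (N v)) => hN; last by exists (fun=> 1).
  by have [f hf] := choice hN; exists f.
have [t ht] := choice hs.
have [||E hE] := @cofinite_types _ (fun v i => (t v i)^-1 * v) B N.
- apply: sub_finite_set (finite_ball_functions m D) => _ [v Nv <-] i /=.
  by have [_ h] := ht v Nv i; rewrite -word_dist1 dC.
- move=> x y Nx Ny e; apply: AB => i.
  have [Ax _] := ht x Nx i; have [Ay _] := ht y Ny i.
  have [_ hM hV] := sA i.
  have := congr1 (fun f => f i) e => /= e'.
  have -> : x * y^-1 = t x i * (t y i)^-1.
    by rewrite -{1}(mulVKg (t x i) x) e' mulgA mulgK.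
  by apply: hM => //; apply: hV.
exists E => x y v Bx By hv; apply: hE => i.
have [x' Ax hx] := hc x Bx; have [y' Ay hy] := hc y By.
have hv' : btw d (0 + 2 * c + 2 * c + 2 * 0) x' v y' by apply: (btw_shift dM hv hx hy); rewrite d0.
have [z Az hz] := quasiconvex_btw dM d4 (hC i) (Ax i) (Ay i) hv'.
exists z; split=> //; rewrite /D; lia.
Qed.

(** * Words modulo all relators of bounded length *)

Section Presentation.
Variables (n : nat) (s : 'I_n -> G).
Implicit Types u v w : word n.

Lemma word_eval_cat u v : word_eval s (u ++ v) = word_eval s u * word_eval s v.
Proof. by rewrite /word_eval big_cat. Qed.

Definition word_inv u : word n := rev [seq (l.1, ~~ l.2) | l <- u].

Lemma word_eval_inv u : word_eval s (word_inv u) = (word_eval s u)^-1.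
Proof.
elim: u => [|[i b] u IH]; first by rewrite /word_eval /= !big_nil invg1.
rewrite /word_inv /= rev_cons -cats1 word_eval_cat IH -[(i, b) :: u]cat1s word_eval_cat.
by rewrite invgM; congr (_ * _); rewrite /word_eval !big_seq1; case: b => //=; rewrite invgK.
Qed.

Definition short_relators (L : nat) : seq (word n) :=
  [seq w <- flatten [seq [seq tval t | t <- enum {: k.-tuple ('I_n * bool)}] | k <- iota 0 L.+1]
   | word_eval s w == 1].

Lemma short_relatorsP L w : w \in short_relators L <-> size w <= L /\ word_eval s w = 1.
Proof.
rewrite mem_filter; split.
  case/andP=> /eqP -> /flattenP [ws /mapP [k]]; rewrite mem_iota add0n => /andP[_ hk] ->.
  by case/mapP=> t _ ->; rewrite size_tuple.
case=> hw ->; rewrite eqxx andTb; apply/flattenP.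
exists [seq tval t | t <- enum {: (size w).-tuple ('I_n * bool)}].
  by apply/mapP; exists (size w) => //; rewrite mem_iota.
by apply/mapP; exists (in_tuple w) => //; rewrite mem_enum.
Qed.

Definition word_equiv L : word n -> word n -> Prop :=
  clos_refl_sym_trans _ (word_step (short_relators L)).

Lemma word_equiv_eval L u v : word_equiv L u v -> word_eval s u = word_eval s v.
Proof.
elim=> [u1 v1 h|//|u1 v1 _ -> //|u1 v1 w1 _ -> _ //].
case: h => [u2 v2 i b|u2 v2 r /short_relatorsP [_ hr]]; rewrite !word_eval_cat.
  suff -> : word_eval s [:: (i, b); (i, ~~ b)] = 1 by rewrite mul1g.
  by rewrite /word_eval big_cons big_seq1; case: b => /=; rewrite ?mulgV ?mulVg.
by rewrite hr mul1g.
Qed.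

Lemma word_equiv_cat L p q u v : word_equiv L u v -> word_equiv L (p ++ u ++ q) (p ++ v ++ q).
Proof.
elim=> [u1 v1 h|u1|u1 v1 _ h|u1 v1 w1 _ h _ h']; [|exact: rst_refl|exact: rst_sym|exact: rst_trans h h'].
apply: rst_step; case: h => [u2 v2 i b|u2 v2 r hr].
  by have := step_cancel (short_relators L) (p ++ u2) (v2 ++ q) i b; rewrite -!catA.
by have := step_relator (p ++ u2) (v2 ++ q) hr; rewrite -!catA.
Qed.

Lemma word_equiv_inv L u : word_equiv L (word_inv u ++ u) [::].
Proof.
elim: u => [|[i b] u IH]; first exact: rst_refl.
apply: rst_trans IH; rewrite /word_inv /= rev_cons -cats1 -catA.
apply: rst_step; have := step_cancel (short_relators L) (word_inv u) u i (~~ b).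
by rewrite negbK.
Qed.

Lemma word_equiv_short L u v : size u + size v <= L -> word_eval s u = word_eval s v ->
  word_equiv L u v.
Proof.
move=> hL e; apply: (rst_trans _ _ _ (u ++ word_inv v ++ v)).
  apply: rst_sym; have := @word_equiv_cat L u [::] _ _ (word_equiv_inv L v).
  by rewrite !cats0.
apply: rst_step; have := @step_relator _ (short_relators L) [::] v (u ++ word_inv v).
rewrite /= -catA; apply; apply/short_relatorsP; split.
  by rewrite size_cat /word_inv size_rev size_map.
by rewrite word_eval_cat word_eval_inv e mulgV.
Qed.

End Presentation.

(* Words are compared with the words read along a quasigeodesic combing of [B];
   neighbouring combing lines fellow-travel, so all relators are short. *)
Lemma quasiconvex_finitely_presented C B : subgroup B -> quasiconvex_set d C B ->
  finitely_presented B.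
Proof.
case=> B1 BM BV qB.
(* [e0] bounds a step along a combing line, [E] the gap between neighbouring lines at the same time;
   [2 * C] accounts for projecting to [B], the rest for [btw_close]. *)
pose e0 := 2 * C + 1 + dl.
pose E := 2 * C + 3 * e0 + dl.
case: (dM) => _ _ _ dG.
(* The combing line of [b] projects to [B] a point at height [i] between 1 and [b]. It starts
   exactly at 1, reaches [b] exactly and then rests there. *)
have hg b i : exists z, B b -> [/\ B z, i = 0 -> z = 1, d 1 b <= i -> z = b &
    exists2 v, btw d 0 1 v b /\ d 1 v = minn i (d 1 b) & d v z <= C].
  case: (EM (B b)) => Bb; last by exists 1.
  have [v hv1 hv2] := dG 1 b (minn i (d 1 b)) (geq_minr _ _).
  have hv : btw d 0 1 v b by rewrite /btw; lia.
  case: (posnP i) => [i0|ipos].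
    have v1 : d 1 v = 0 by rewrite hv1 i0 min0n.
    exists 1 => _; split=> //; first by move=> hb; apply: (@word_dist_eq0 _ S hS); lia.
    by exists v => //; rewrite dC v1.
  case: (leqP (d 1 b) i) => hi.
    exists b => _; split=> //; first by move=> e; rewrite e in ipos.
    by exists v; [split=> //; lia|lia].
  have [z Bz hz] := qB _ _ _ B1 Bb hv; exists z => _; split=> //; first by lia.
  by exists v => //; split=> //; lia.
have hg' b : exists f : nat -> G, forall i, B b -> [/\ B (f i), i = 0 -> f i = 1,
    d 1 b <= i -> f i = b &
    exists2 v, btw d 0 1 v b /\ d 1 v = minn i (d 1 b) & d v (f i) <= C].
  by have [f hf] := choice (hg b); exists f.
have [be hbe] := choice hg'.
have beB b i : B b -> B (be b i) by move=> Bb; case: (hbe b i Bb).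
have be0 b : B b -> be b 0 = 1 by move=> Bb; case: (hbe b 0 Bb) => _ ->.
have bel b i : B b -> d 1 b <= i -> be b i = b by move=> Bb h; case: (hbe b i Bb) => _ _ ->.
have bfar b b' i j e : B b -> B b' -> d b b' <= e -> i <= j + e -> j <= i + e ->
    d (be b i) (be b' j) <= 2 * C + 3 * e + dl.
  move=> Bb Bb' hbb hij hji.
  have [_ _ _ [v [hv hv1] hvz]] := hbe b i Bb.
  have [_ _ _ [v' [hv' hv1'] hvz']] := hbe b' j Bb'.
  have h0 : d 1 1 <= 0 by rewrite d0.
  have h1 : d v v <= 0 by rewrite d0.
  have hw := btw_shift dM hv h0 hbb h1.
  have hw' : btw d (0 + 2 * 0 + 2 * e + 2 * 0) 1 v' b' by move: hv'; rewrite /btw; lia.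
  have hbd := dT 1 b b'; have hbd' := dT 1 b' b; have cb := dC b b'.
  have := btw_close dM d4 (t := e) hw hw' ltac:(lia) ltac:(lia).
  have := dT (be b i) v (be b' j); have := dT v v' (be b' j).
  by have := dC v (be b i); have := dC v v'; lia.
have bstep b i : B b -> d (be b i) (be b i.+1) <= e0.
  move=> Bb; have [_ _ _ [v [hv hv1] hvz]] := hbe b i Bb.
  have [_ _ _ [v' [hv' hv1'] hvz']] := hbe b i.+1 Bb.
  have := btw_close dM d4 (t := 1) hv hv' ltac:(lia) ltac:(lia).
  have := dT (be b i) v (be b i.+1); have := dT v v' (be b i.+1).
  by have := dC v (be b i); have := dC v v'; rewrite /e0; lia.
pose T0 := [set g | B g /\ d 1 g <= e0].
have fT0 : finite_set T0 by apply: sub_finite_set (word_dist_finite hS e0 fS) => g [].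
have [sq esq] := (finite_seqP _).1 fT0.
pose n := size sq; pose s (i : 'I_n) := tnth (in_tuple sq) i.
have sT i : T0 (s i) by rewrite esq /= /s mem_tnth.
have Ts g : exists l : 'I_n * bool, T0 g -> word_eval s [:: l] = g.
  have hT h : T0 h -> exists i, s i = h.
    rewrite esq => hh; have hi : index h sq < n by rewrite index_mem.
    by exists (Ordinal hi); rewrite /s (tnth_nth h) /= nth_index.
  have [i1 _] : exists i, s i = 1 by apply: hT; split=> //; rewrite d0.
  case: (EM (T0 g)) => [/hT [i hi]|h]; last by exists (i1, true).
  by exists (i, true) => _; rewrite /word_eval big_seq1.
have [lt hlt] := choice Ts.
pose cw b m : word n := [seq lt ((be b i)^-1 * be b i.+1) | i <- iota 0 m].
have cwS b m : cw b m.+1 = cw b m ++ [:: lt ((be b m)^-1 * be b m.+1)].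
  by rewrite /cw -[in iota _ m.+1]addn1 iotaD map_cat add0n.
have T0step b i : B b -> T0 ((be b i)^-1 * be b i.+1).
  move=> Bb; split; first by apply: BM; [apply: BV|]; exact: beB.
  by rewrite -word_dist1; exact: bstep.
have cwE b m : B b -> word_eval s (cw b m) = be b m.
  move=> Bb; elim: m => [|m IH]; first by rewrite /word_eval big_nil be0.
  by rewrite cwS word_eval_cat IH hlt ?mulVKg //; exact: T0step.
(* A rung is spelled by its own combing word, whose length is the distance it spans; a cell of a
   ladder, with two rungs and two steps, thus fits the bound [L]. *)
pose rung g := cw g (d 1 g).
have rungE g : B g -> word_eval s (rung g) = g.
  by move=> Bg; rewrite /rung cwE // bel.
have rung_size g : size (rung g) = d 1 g by rewrite size_map size_iota.
pose L := 2 * E + 2.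
have ladder b b' m : B b -> B b' -> d b b' <= e0 ->
    word_equiv s L (cw b m ++ rung ((be b m)^-1 * be b' m)) (cw b' m).
  move=> Bb Bb' hbb; elim: m => [|m IH].
    rewrite !be0 // mulVg /cw /= /rung d0; exact: rst_refl.
  have BB k : B ((be b k)^-1 * be b' k) by apply: BM; [apply: BV|]; exact: beB.
  have hr k : size (rung ((be b k)^-1 * be b' k)) <= E.
    by rewrite rung_size -word_dist1; apply: bfar => //; lia.
  rewrite (cwS b) (cwS b') -catA.
  apply: rst_trans (word_equiv_cat [::] [:: lt ((be b' m)^-1 * be b' m.+1)] IH).
  rewrite cat0s -[in X in _ X]catA.
  set u := [:: lt _] ++ _; set v := rung _ ++ _.
  have uv : word_equiv s L u v.
    apply: word_equiv_short; first by rewrite !size_cat /=; have := hr m; have := hr m.+1; rewrite /L; lia.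
    rewrite !word_eval_cat !rungE // !hlt; try exact: T0step.
    by rewrite mulgA mulgK -mulgA mulVKg.
  by have := word_equiv_cat (cw b m) [::] uv; rewrite !cats0.
(* Stated for all large [N] because lines of different lengths are compared at a common time, after
   both have come to rest. *)
have main w : exists N0, forall N, N0 <= N -> word_equiv s L w (cw (word_eval s w) N).
  elim/last_ind: w => [|w l [N0 IH]].
    exists 0 => N _; rewrite /word_eval big_nil; elim: N => [|N IHN]; first exact: rst_refl.
    rewrite cwS; apply: rst_trans (IHN) _.
    have := @word_equiv_cat _ s L (cw 1 N) [::] [:: lt ((be 1 N)^-1 * be 1 N.+1)] [::].
    rewrite !cats0 => h; apply: rst_sym; apply: h.
    apply: word_equiv_short; first by rewrite /= /L; lia.
    rewrite hlt; last exact: T0step.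
    by rewrite !bel ?d0 // mulVg /word_eval big_nil.
  have [Bw Bl] : B (word_eval s w) /\ T0 (word_eval s [:: l]).
    have BT k : T0 (word_eval s [:: k]).
      rewrite /word_eval big_seq1; case: k.2; first exact: sT.
      by have [h1 h2] := sT k.1; split; [exact: BV|rewrite word_distV].
    split=> //; elim: w {IH} => [|k w IH]; first by rewrite /word_eval big_nil.
    by rewrite -cat1s word_eval_cat; apply: BM => //; case: (BT k).
  have [Bl' hl] := Bl.
  rewrite -cats1 word_eval_cat; set g := word_eval s w in Bw IH *; set t := word_eval s _ in Bl Bl' hl *.
  exists (maxn N0 (maxn (d 1 g) (d 1 (g * t)))) => N hN.
  have hgN : be g N = g by apply: bel => //; lia.
  have hgtN : be (g * t) N = g * t by apply: bel; [exact: BM|lia].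
  have hN0 : N0 <= N by lia.
  apply: rst_trans (word_equiv_cat [::] [:: l] (IH N hN0)) _; rewrite cat0s.
  have := ladder g (g * t) N Bw (BM _ _ Bw Bl'); rewrite word_dist_mulr => /(_ hl).
  rewrite hgN hgtN mulKg; apply: rst_trans.
  have := @word_equiv_cat _ s L (cw g N) [::] [:: l] (rung t); rewrite !cats0; apply.
  apply: word_equiv_short; last by rewrite rungE.
  by rewrite rung_size /L /E /=; lia.
exists n, s, (short_relators s L); split.
  apply/seteqP; split=> [g Bg|g [w _ <-]].
    by exists (rung g) => //; exact: rungE.
  elim: w => [|k w IH]; first by rewrite /word_eval big_nil.
  rewrite -cat1s word_eval_cat; apply: BM => //; rewrite /word_eval big_seq1.
  by have [h _] := sT k.1; case: k.2 => //; exact: BV.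
move=> w; split=> [e|h]; last by rewrite (word_equiv_eval h) /word_eval big_nil.
have [N0 hN] := main w; have [M0 hM] := main [::].
apply: rst_trans (hN (maxn N0 M0) (leq_maxl _ _)) _.
apply: rst_sym; have := hM (maxn N0 M0) (leq_maxr _ _).
by rewrite e {1}/word_eval big_nil.
Qed.

End FixedGenerators.

(** * Subgroups as groups in their own right *)

Section SubgroupType.
Local Open Scope group_scope.
Variables (G : groupType) (M : set G).

(** The proof argument lets the group structure, which depends on it, be attached to the type.
    Properties relative to [M] become properties of a whole group, to which the preceding results
    apply. *)
Definition subgroup_sort of subgroup M := {x : G | x \in M}.

Hypothesis sM : subgroup M.
Local Notation T := (subgroup_sort sM).

HB.instance Definition _ := Choice.on T.

Let M1 : 1 \in M. Proof. by rewrite inE; case: sM. Qed.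
Let MM (x y : T) : val x * val y \in M.
Proof. by case: sM => _ h _; have := valP x; have := valP y; rewrite !inE => hy hx; apply: h. Qed.
Let MV (x : T) : (val x)^-1 \in M.
Proof. by case: sM => _ _ h; have := valP x; rewrite !inE; apply: h. Qed.

Definition sub_one : T := exist _ 1 M1.
Definition sub_mul (x y : T) : T := exist _ (val x * val y) (MM x y).
Definition sub_inv (x : T) : T := exist _ (val x)^-1 (MV x).

Let mulA : associative sub_mul. Proof. by move=> x y z; apply: val_inj; rewrite /= mulgA. Qed.
Let mul1 : left_id sub_one sub_mul. Proof. by move=> x; apply: val_inj; rewrite /= mul1g. Qed.
Let mulr1 : right_id sub_one sub_mul. Proof. by move=> x; apply: val_inj; rewrite /= mulg1. Qed.
Let mulV : left_inverse sub_one sub_inv sub_mul.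
Proof. by move=> x; apply: val_inj; rewrite /= mulVg. Qed.
Let mulrV : right_inverse sub_one sub_inv sub_mul.
Proof. by move=> x; apply: val_inj; rewrite /= mulgV. Qed.

HB.instance Definition _ := isGroup.Build T mulA mul1 mulr1 mulV mulrV.

Definition sub_set (K : set G) : set T := [set x | K (val x)].

Lemma sub_val_prod I (w : seq I) (F : I -> T) :
  val (\prod_(x <- w) F x) = \prod_(x <- w) val (F x).
Proof. by elim: w => [|x w IH]; rewrite ?big_nil ?big_cons //= -IH. Qed.

Lemma sub_subgroup K : subgroup K -> subgroup (sub_set K).
Proof. by case=> h1 h2 h3; split=> // [x y|x]; [exact: h2|exact: h3]. Qed.

Lemma sub_finite (K : set G) : finite_set K -> finite_set (sub_set K).
Proof.
move=> fK; have := @finite_preimage T G K val (in2W val_inj) fK.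
by [].
Qed.

Section Transfer.
Variable S : set G.
Hypothesis hS : generates S M.

Let SM y : S y \/ S y^-1 -> y \in M.
Proof.
rewrite inE => h; case: sM => _ _ hV; case: h => h; last rewrite -[y]invgK; last apply: hV.
all: by rewrite hS; exists 1%N => //; apply: word_ball_gen.
Qed.

Lemma sub_word_ball n (x : T) : word_ball (sub_set S) n x <-> word_ball S n (val x).
Proof.
split=> [[w [sw hw ->]]|[w [sw hw e]]].
  exists [seq val y | y <- w]; split; first by rewrite size_map.
    by move=> y /mapP [z /hw hz ->].
  by rewrite sub_val_prod big_map.
have [w' ew] : exists w' : seq T, [seq val y | y <- w'] = w.
  elim: w hw {sw e} => [|y w IH] hw; first by exists [::].
  have [w' <-] := IH (fun z hz => hw z (mem_behead (s := y :: w) hz)).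
  by exists (exist _ y (SM (hw y (mem_head _ _))) :: w').
exists w'; split; first by rewrite -(size_map val) ew.
  by move=> y hy; apply: (hw (val y)); rewrite -ew map_f.
by apply: val_inj; rewrite e -ew big_map sub_val_prod.
Qed.

Lemma sub_generates : generates (sub_set S) [set: T].
Proof.
apply/seteqP; split=> // x _; have := valP x; rewrite inE => Mx.
have [n _ h] : (\bigcup_n word_ball S n) (val x) by rewrite -hS.
by exists n => //; apply/sub_word_ball.
Qed.

Lemma sub_word_dist_le n (x y : T) :
  word_dist_le (sub_set S) n x y <-> word_dist_le S n (val x) (val y).
Proof. exact: (sub_word_ball n (x^-1 * y)). Qed.

Lemma sub_geodesic_between x y n p : geodesic_between (sub_set S) x y n p ->
  geodesic_between S (val x) (val y) n (val \o p).
Proof.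
case=> hp <- <-; split=> // i j /hp [h1 h2]; split; first exact/sub_word_dist_le.
by move=> m h; apply: h2; apply/sub_word_dist_le.
Qed.

Lemma sub_slim dl : slim_triangles S M dl -> slim_triangles (sub_set S) [set: T] dl.
Proof.
move=> slim x y z nxy nyz nxz pxy pyz pxz _ _ _ h1 h2 h3 i hi.
have Mv (t : T) : M (val t) by have := valP t; rewrite inE.
have := slim _ _ _ _ _ _ _ _ _ (Mv x) (Mv y) (Mv z) (sub_geodesic_between h1)
  (sub_geodesic_between h2) (sub_geodesic_between h3) i hi.
by case=> -[j hj h]; [left|right]; exists j => //; apply/sub_word_dist_le.
Qed.

End Transfer.

Lemma sub_hyperbolic : hyperbolic M -> hyperbolic [set: T].
Proof.
case=> S [fS hS [dl slim]]; exists (sub_set S); split; first exact: sub_finite.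
  exact: sub_generates.
by exists dl; apply: sub_slim.
Qed.

Lemma sub_quasiconvex K : quasiconvex K M -> quasiconvex (sub_set K) [set: T].
Proof.
case=> S [fS hS [_ [C hC]]]; exists (sub_set S); split; first exact: sub_finite.
  exact: sub_generates.
split=> //; exists C => x y n p Kx Ky /(sub_geodesic_between hS) hp i hi.
have [k Kk hk] := hC _ _ _ _ Kx Ky hp i hi.
have Mk : k \in M.
  have := valP (p i); rewrite !inE => Mp.
  have -> : k = val (p i) * ((val (p i))^-1 * k) by rewrite mulVKg.
  have Mk : (\bigcup_n word_ball S n) ((val (p i))^-1 * k) by exists C.
  by case: (sM) => _ hM _; apply: hM => //; move: Mk; rewrite -hS.
by exists (exist _ k Mk) => //; apply/(sub_word_dist_le hS).
Qed.

Lemma sub_finitely_presented K : K `<=` M ->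
  finitely_presented (sub_set K) -> finitely_presented K.
Proof.
move=> KM [n [s [rels [hK hs]]]].
have E w : word_eval (val \o s) w = val (word_eval s w).
  by rewrite /word_eval sub_val_prod; apply: eq_bigr => -[i b] _ /=; case: b.
exists n, (val \o s), rels; split.
  apply/seteqP; split=> [k Kk|k [w _ <-]].
    have Mk : k \in M by rewrite inE; apply: KM.
    have : sub_set K (exist _ k Mk) by [].
    by rewrite hK => -[w _ ew]; exists w => //; rewrite E ew.
  rewrite E; have : sub_set K (word_eval s w) by rewrite hK; exists w.
  by [].
move=> w; rewrite E -hs; split=> [e|->//]; exact: val_inj.
Qed.

End SubgroupType.

(** * The wall criterion for subgroups *)

Lemma geodesic_path V (d : V -> V -> nat) x y : geodesic_metric d ->
  (forall x y, d x y = 0 -> x = y) ->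
  exists q : nat -> V, [/\ q 0 = x, q (d x y) = y &
    forall i j, i <= j <= d x y -> d (q i) (q j) = j - i].
Proof.
case=> d0 dC dT dG dE.
have hn z : exists z', 0 < d z y -> d z z' = 1 /\ d z' y = d z y - 1.
  case: (posnP (d z y)) => h; first by exists z.
  by have [z' h1 h2] := dG z y 1 h; exists z'.
have [nx hnx] := choice hn; pose q i := iter i nx x.
have hq i : i <= d x y -> d (q i) y = d x y - i.
  elim: i => [|i IH] hi; first by rewrite subn0.
  have h := IH (ltnW hi); have hp : 0 < d (q i) y by lia.
  by have [_ h2] := hnx _ hp; rewrite [LHS]h2; lia.
have hs i k : i + k <= d x y -> d (q i) (q (i + k)) <= k.
  elim: k => [|k IH] hik; first by rewrite addn0 d0.
  have h := IH ltac:(lia); have hp : 0 < d (q (i + k)) y by rewrite hq; lia.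
  have [h1 _] := hnx _ hp; rewrite addnS.
  have := dT (q i) (q (i + k)) (q (i + k).+1).
  by have -> : q (i + k).+1 = nx (q (i + k)) by []; lia.
exists q; split=> //; first by apply: dE; rewrite hq // subnn.
move=> i j hij; have := hs i (j - i) ltac:(lia); have := hs 0 i ltac:(lia).
rewrite add0n subnKC; last by lia.
have := dT x (q i) (q j); have := dT x (q j) y; have := hq j ltac:(lia).
by rewrite -[q 0]/x; lia.
Qed.

Section Action.
Variables (G : groupType) (X : cubeComplex) (a : cubicalAction G X).
Hypothesis hX : CAT0 X.
Hypothesis pa : proper_action a.
Hypothesis ca : cocompact_action a.
Variable S : set G.
Hypothesis fS : finite_set S.
Hypothesis hS : generates S [set: G].
Variable dl : nat.
Local Notation d := (word_dist hS).
Local Notation D := (edge_dist hX).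
Hypothesis d4 : four_point d dl.
Local Open Scope group_scope.
Implicit Types (g h : G) (v w : X) (e f : edge X).

Let dM := word_dist_metric hS.
Let d0 x : d x x = 0. Proof. by case: dM. Qed.
Let dC x y : d x y = d y x. Proof. by case: dM. Qed.
Let dT x y z : d x z <= d x y + d y z. Proof. by case: dM. Qed.
Let D0 x : D x x = 0. Proof. by case: (edge_dist_metric hX). Qed.
Let DC x y : D x y = D y x. Proof. by case: (edge_dist_metric hX). Qed.
Let DT x y z : D x z <= D x y + D y z. Proof. by case: (edge_dist_metric hX). Qed.

Lemma act_edge_path g v p : edge_path v p -> edge_path (a g v) (map (a g) p).
Proof. by elim: p v => [|w p IH] v //= [h /IH]; split=> //; apply: act_adjacent. Qed.

Lemma act_edge_dist g v w : D (a g v) (a g w) = D v w.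
Proof.
have H k x y : D (a k x) (a k y) <= D x y.
  have [p [hp <- <-]] := edge_distP hX x y.
  by have := edge_dist_le hX (act_edge_path k hp); rewrite size_map last_map.
by apply/eqP; rewrite eqn_leq H /= -{1}(actK a g v) -{1}(actK a g w) H.
Qed.

Lemma act_side g e v : side hX (eact a g e) (a g v) = side hX e v.
Proof. by rewrite /side /= !act_edge_dist. Qed.

Lemma par_act g e f : par e f -> par (eact a g e) (eact a g f).
Proof. by rewrite /par !ends_eact; apply: act_parallel. Qed.

Lemma par_actM g h e : par (eact a (g * h) e) (eact a g (eact a h e)).
Proof. by rewrite /par !ends_eact image_act; apply: rst_refl. Qed.

Lemma par_act1 e : par (eact a 1 e) e.
Proof. by rewrite /par !ends_eact image_act1; apply: rst_refl. Qed.

Lemma par_actV g e f : par (eact a g e) f -> par e (eact a g^-1 f).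
Proof.
move=> /(par_act g^-1); apply: par_trans; apply: par_sym.
by apply: par_trans (par_sym (par_actM _ _ _)) _; rewrite mulVg; apply: par_act1.
Qed.

Lemma crossing_par e e' f : par e e' -> crossing hX e f -> crossing hX e' f.
Proof.
move=> p cr s t; have [x [h1 h2]] := cr s t; have [y [h3 h4]] := cr (~~ s) t.
have := par_side hX x y p; rewrite h1 h3.
case: (eqVneq (side hX e' x) s) => h5; first by exists x.
move=> h6; exists y; split=> //; move: h5 h6; clear.
by case: s; case: (side hX e' x); case: (side hX e' y).
Qed.

Lemma crossing_sym e f : crossing hX e f -> crossing hX f e.
Proof. by move=> cr s t; have [x [h1 h2]] := cr t s; exists x. Qed.

Lemma crossing_act g e f : crossing hX e f -> crossing hX (eact a g e) (eact a g f).
Proof.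
by move=> cr s t; have [x [<- <-]] := cr s t; exists (a g x); rewrite !act_side.
Qed.

Definition wall_stab e : set G := [set g | par (eact a g e) e].

(** The class as a set, so that walls can be counted and compared by equality. *)
Definition cls e : set (set X) := parallel (ends e).

Lemma cls_eq e f : cls e = cls f <-> par e f.
Proof.
split=> h; first by change (cls e (ends f)); rewrite h; apply: rst_refl.
by apply/seteqP; split=> E; apply: rst_trans => //; apply: rst_sym.
Qed.

Variable x0 : X.

Lemma orbit_lipschitz : exists A, forall g h, D (a g x0) (a h x0) <= A * d g h.
Proof.
have [A hA] := finite_set_bound (fun g => D x0 (a g x0)) fS.
have key (w : seq G) : (forall x, x \in w -> S x \/ S x^-1) ->
    D x0 (a (\prod_(x <- w) x) x0) <= A * size w.
  elim: w => [|x w IH] hw; first by rewrite big_nil act1 D0.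
  rewrite big_cons /= mulnS actM.
  have h1 : D x0 (a x x0) <= A.
    case: (hw x (mem_head _ _)) => /hA //.
    by rewrite -(act_edge_dist x) actVK DC.
  apply: leq_trans (DT x0 (a x x0) _) _; apply: leq_add => //.
  by rewrite act_edge_dist; apply: IH => y hy; apply: hw; rewrite in_cons hy orbT.
exists A => g h; have /word_distP [w [sw hw e]] : d g h <= d g h by [].
rewrite -(act_edge_dist g^-1) actK -actM e; apply: leq_trans (key _ hw) _.
by rewrite leq_mul2l sw orbT.
Qed.

Lemma cube_finite (c : set X) : cube c -> finite_set c.
Proof.
move=> /cubeP [n [f [_ <- _]]]; apply: finite_image; exact: finite_finset.
Qed.

(** A quasi-inverse [gv] of the orbit map. Translates of the finite set [F1] contain all cubes; by
    properness, elements whose translates of [F1] share a vertex are boundedly far apart, and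
    adjacent vertices share a translate. *)
Lemma approximation : exists (gv : X -> G) (rho B : nat),
  [/\ forall v, D (a (gv v) x0) v <= rho,
      forall v w, adjacent v w -> d (gv v) (gv w) <= B,
      forall g, d g (gv (a g x0)) <= B &
      forall r, finite_set [set v | D x0 v <= r]].
Proof.
have [F [fF Fc cF]] := ca.
pose F1 := [set x0] `|` \bigcup_(c in F) c.
have fF1 : finite_set F1.
  rewrite finite_setU; split; first exact: finite_set1.
  by apply: bigcup_finite => // c /Fc /cube_finite.
have F1x : F1 x0 by left.
have hcube c : cube c -> exists g, forall v, c v -> F1 (a g^-1 v).
  by move=> /cF [g [E [FE ->]]]; exists g => _ [w hw <-]; rewrite actK; right; exists E.
have [gv hgv] : exists gv : X -> G, forall v, F1 (a (gv v)^-1 v).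
  have h v : exists g, F1 (a g^-1 v) by have [g hg] := hcube _ (cube1 v); exists g; apply: hg.
  by have [gv hgv] := choice h; exists gv.
have [M hM] := finite_set_bound (d 1) (pa fF1).
have [rho hrho] := finite_set_bound (D x0) fF1.
have hgg g v : F1 (a g^-1 v) -> d (gv v) g <= M.
  move=> h; rewrite (word_dist1 hS); apply: hM; exists (a (gv v)^-1 v); split=> //.
  by exists (a g^-1 v) => //; rewrite actM actVK.
have hadj v w : adjacent v w -> d (gv v) (gv w) <= 2 * M.
  case=> _ /hcube [g hg]; have := hgg g v (hg v (or_introl erefl)).
  have := hgg g w (hg w (or_intror erefl)); have := dT (gv v) g (gv w).
  by have := dC g (gv w); lia.
have hid g : d g (gv (a g x0)) <= M by rewrite dC; apply: hgg; rewrite actK.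
have hrho' v : D (a (gv v) x0) v <= rho.
  by rewrite -(act_edge_dist (gv v)^-1) actK; apply: hrho.
exists gv, rho, (2 * M)%N; split=> //; first by move=> g; have := hid g; lia.
move=> r; pose r' := (M + 2 * M * r)%N.
have : finite_set [set a g v | g in [set g | d 1 g <= r'] & v in F1].
  by apply: finite_image2 => //; apply: word_dist_finite.
apply: sub_finite_set => v hv.
suff h n w : D x0 w <= n -> d 1 (gv w) <= M + 2 * M * n.
  by exists (gv v); [apply: leq_trans (h _ _ hv) _|exists (a (gv v)^-1 v) => //; exact: actVK].
elim: n w => [|n IH] w hw.
  have <- : x0 = w by apply: (edge_dist_eq0 (hX := hX)); lia.
  by have := hid 1; rewrite act1; lia.
case: (leqP (D x0 w) n) => hwn; first by have := IH w hwn; lia.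
have [w' h1 h2] : exists2 w', D w w' = 1%N & D w' x0 = (D w x0 - 1)%N.
  case: (edge_dist_metric hX) => _ _ _; apply; rewrite DC; lia.
have := IH w' ltac:(rewrite DC h2 DC; lia).
have := hadj _ _ ((edge_dist_eq1 hX _ _).1 h1).
by have := dT 1 (gv w') (gv w); have := dC (gv w) (gv w'); lia.
Qed.

(** As parallelism ignores orientation, [src f] ranges over both sides of the carrier. *)
Definition wall_nbhd r0 e : set G := [set g | exists f, par f e /\ D (a g x0) (src f) <= r0].

Lemma wall_nbhd_par r0 e e' : par e e' -> wall_nbhd r0 e `<=` wall_nbhd r0 e'.
Proof. by move=> p g [f [pf hf]]; exists f; split=> //; apply: par_trans pf p. Qed.

Lemma wall_nbhd_act r0 e g h : wall_nbhd r0 e g -> wall_nbhd r0 (eact a h e) (h * g).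
Proof.
move=> [f [pf hf]]; exists (eact a h f); split; first exact: par_act.
by rewrite actM /= act_edge_dist.
Qed.

Lemma wall_nbhd_side r0 e g b : wall_nbhd r0 e g ->
  exists u, [/\ carrier e u, side hX e u = b & D (a g x0) u <= r0.+1].
Proof.
move=> [f [pf hf]].
have h1 := par_side hX (src f) (tgt f) pf; have h2 := side_src hX f; have h3 := side_tgt hX f.
have hf' : D (a g x0) (tgt f) <= r0.+1.
  have := DT (a g x0) (src f) (tgt f); have := (edge_dist_eq1 hX _ _).2 (edgeP f); lia.
have hE : Edge (edgeP f) = f by case: (f).
case: (eqVneq (side hX e (src f)) b) => h; [exists (src f)|exists (tgt f)]; split=> //.
- by exists (tgt f), (edgeP f); rewrite hE.
- exact: leqW.
- exists (src f), (adjacentC (edgeP f)).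
  have -> : Edge (adjacentC (edgeP f)) = edge_rev f by [].
  by rewrite /par ends_rev.
- move: h1 h; rewrite h2; case: (side hX f (tgt f)) h3 => //.
  by case: (side hX e (src f)); case: (side hX e (tgt f)); case: b.
Qed.

Lemma walls_finite r0 r : finite_set
  [set k | exists e, k = cls e /\ exists2 g, wall_nbhd r0 e g & d 1 g <= r].
Proof.
have [A hA] := orbit_lipschitz; have [gv [rho [B [_ _ _ fB]]]] := approximation.
pose V := [set v | D x0 v <= A * r + r0 + 1].
have : finite_set [set parallel [set v; w] | v in V & w in V].
  by apply: finite_image2; apply: fB.
apply: sub_finite_set => _ [e [-> [g [f [pf hf]] hg]]].
have h1 := hA 1 g; rewrite act1 in h1.
have h2 : A * d 1 g <= A * r by rewrite leq_mul2l hg orbT.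
have h3 := DT x0 (a g x0) (src f); have h4 := DT x0 (src f) (tgt f).
have h5 := (edge_dist_eq1 hX _ _).2 (edgeP f).
exists (src f); first by rewrite /V /=; lia.
exists (tgt f); first by rewrite /V /=; lia.
by apply/cls_eq.
Qed.

(* The coset of [g] modulo the stabiliser is determined by the wall [g^-1 e], which
   takes finitely many values for [g] near [e]. *)
Lemma wall_nbhd_cofinite r0 (L : set G) e : subgroup L ->
  exists c, forall g, (wall_nbhd r0 e `&` L) g ->
    exists2 z, (L `&` wall_stab e) z & d g z <= c.
Proof.
move=> [L1 LM LV].
have [||c hc] := @cofinite_types _ S hS _ (fun g => cls (eact a g^-1 e))
  (L `&` wall_stab e) (wall_nbhd r0 e `&` L).
- apply: sub_finite_set (walls_finite r0 0) => _ [g [Cg _] <-].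
  exists (eact a g^-1 e); split=> //; exists 1; last by rewrite d0.
  by rewrite -(mulVg g); apply: wall_nbhd_act.
- move=> g h [_ Lg] [_ Lh] /cls_eq p; split; first by apply: LM => //; apply: LV.
  apply: par_trans (par_actM _ _ _) _.
  apply: par_trans (par_act g (par_sym p)) _.
  by apply: par_trans (par_sym (par_actM _ _ _)) _; rewrite mulgV; apply: par_act1.
- by exists c.
Qed.

Section Radius.
Variables (gv : X -> G) (rho B A : nat).
Hypothesis gv_dist : forall v, D (a (gv v) x0) v <= rho.
Hypothesis gv_adj : forall v w, adjacent v w -> d (gv v) (gv w) <= B.
Hypothesis gv_id : forall g, d g (gv (a g x0)) <= B.
Hypothesis orbA : forall g h, D (a g x0) (a h x0) <= A * d g h.

Lemma gv_lipschitz v w : d (gv v) (gv w) <= B * D v w.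
Proof.
move En : (D v w) => n; elim: n v En => [|n IH] v En.
  by rewrite (edge_dist_eq0 En) d0.
have [v' h1 h2] : exists2 v', D v v' = 1%N & D v' w = (D v w - 1)%N.
  by case: (edge_dist_metric hX) => _ _ _; apply; rewrite En.
have := IH v' ltac:(lia); have := gv_adj ((edge_dist_eq1 hX _ _).1 h1).
by have := dT (gv v) (gv v') (gv w); rewrite mulnS; lia.
Qed.

Lemma orbit_expansive g h : d g h <= 2 * B + B * D (a g x0) (a h x0).
Proof.
have := dT g (gv (a g x0)) h; have := dT (gv (a g x0)) (gv (a h x0)) h.
have := gv_id g; have := gv_id h; have := dC h (gv (a h x0)).
have := gv_lipschitz (a g x0) (a h x0); lia.
Qed.

Lemma near_gv g v : d g (gv v) <= B + B * D (a g x0) v.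
Proof.
have := dT g (gv (a g x0)) (gv v); have := gv_id g.
have := gv_lipschitz (a g x0) v; lia.
Qed.

Variable r0 : nat.
Hypothesis r0_rho : rho <= r0.

Lemma wall_nbhd_gv e v : carrier e v -> wall_nbhd r0 e (gv v).
Proof.
case=> w [vw p]; exists (Edge vw); split=> //=; exact: leq_trans (gv_dist v) r0_rho.
Qed.

(** Edge geodesics between carrier vertices stay in the carrier, and [gv] maps them to
    quasigeodesics of the group. Both ends are first moved to the side [true], because
    [carrier_convex] treats one side at a time. *)
Lemma wall_nbhd_quasiconvex : exists lam, forall e, quasiconvex_set d lam (wall_nbhd r0 e).
Proof.
pose k := (B + B * r0.+1)%N.
have [E hE] := quasi_geodesic_near dM d4 B A (2 * rho)%N (4 * k)%N.
exists E => e g h v /(@wall_nbhd_side _ _ _ true) [u [cu su hu]].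
move=> /(@wall_nbhd_side _ _ _ true) [u' [cu' su' hu']] hv.
have [q [q0 qn hq]] := geodesic_path u u' (edge_dist_metric hX) (@edge_dist_eq0 _ hX).
have hgu : d g (gv u) <= k.
  by apply: leq_trans (near_gv _ _) _; rewrite leq_add2l leq_mul2l hu orbT.
have hhu : d h (gv u') <= k.
  by apply: leq_trans (near_gv _ _) _; rewrite leq_add2l leq_mul2l hu' orbT.
have qg : quasi_geodesic d B A (2 * rho) (fun i => gv (q i)) (D u u').
  split=> [i hi|i j hij].
    by apply: gv_adj; apply/(edge_dist_eq1 hX); rewrite hq ?subSnn //; lia.
  rewrite -(hq i j hij); have := orbA (gv (q i)) (gv (q j)).
  have := DT (q i) (a (gv (q i)) x0) (q j); have := DT (a (gv (q i)) x0) (a (gv (q j)) x0) (q j).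
  have := gv_dist (q i); have := gv_dist (q j); rewrite (DC (q i) (a _ _)); lia.
have hv' : btw d (4 * k) (gv (q 0)) v (gv (q (D u u'))).
  rewrite q0 qn; have hvv : d v v <= 0 by rewrite d0.
  by have := btw_shift dM hv hgu hhu hvv; rewrite /btw; lia.
have [i hi hvi] := hE _ _ qg v hv'.
exists (gv (q i)) => //; apply: wall_nbhd_gv; apply: (carrier_convex (a := u) (b := u')) => //.
  by rewrite su su'.
have e1 := hq 0 i ltac:(lia); have e2 := hq i (D u u') ltac:(lia).
rewrite q0 in e1; rewrite qn in e2; rewrite /btw e1 e2; lia.
Qed.

Lemma wall_nbhd_crossing s e g h : A * s <= r0 -> d g h <= s ->
  side hX e (a g x0) != side hX e (a h x0) -> wall_nbhd r0 e g.
Proof.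
move=> hs hgh /crossing_edge [v [w [vw [p _ _ hd]]]].
exists (Edge vw); split=> //=; have := orbA g h.
have : A * d g h <= A * s by rewrite leq_mul2l hgh orbT.
lia.
Qed.

Lemma wall_near e g v : carrier e v ->
  exists2 z, wall_nbhd r0 e z & d g z <= B + B * D (a g x0) v.
Proof. by move=> cv; exists (gv v); [exact: wall_nbhd_gv|exact: near_gv]. Qed.

End Radius.

Lemma wall_stab_subgroup e : subgroup (wall_stab e).
Proof.
split; first exact: par_act1.
- by move=> g h pg ph; apply: par_trans (par_actM _ _ _) _; apply: par_trans (par_act g ph) pg.
- by move=> g pg; apply: par_sym; apply: par_actV.
Qed.

Lemma wall_nbhd_stab r0 e g : wall_nbhd r0 e 1 -> wall_stab e g -> wall_nbhd r0 e g.
Proof.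
by move=> h1 hg; have := wall_nbhd_act g h1; rewrite mulg1; apply: wall_nbhd_par.
Qed.

Lemma wall_nbhd_stabI r0 lam c (L : set G) e :
  (forall g, (wall_nbhd r0 e `&` L) g -> exists2 z, (L `&` wall_stab e) z & d g z <= c) ->
  wall_nbhd r0 e 1 -> quasiconvex_set d lam (L `&` wall_stab e) ->
  quasiconvex_set d (4 * c + dl + lam) (wall_nbhd r0 e `&` L).
Proof.
move=> hc h1 hlam x y v hx hy hv.
have [x' Lx hx'] := hc x hx; have [y' Ly hy'] := hc y hy.
have hvv : d v v <= 0 by rewrite d0.
have [z [Lz sz] hz] := quasiconvex_btw dM d4 hlam Lx Ly (btw_shift dM hv hx' hy' hvv).
exists z; last by lia.
by split=> //; apply: wall_nbhd_stab.
Qed.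

(** The stabiliser is coarsely dense in a neighbourhood of its wall, which is quasiconvex. *)
Lemma wall_stab_quasiconvex e : exists C, quasiconvex_set d C (wall_stab e).
Proof.
have [gv [rho [B [h1 h2 h3 _]]]] := approximation; have [A hA] := orbit_lipschitz.
pose r0 := (rho + D x0 (src e))%N.
have [lam hlam] := wall_nbhd_quasiconvex h1 h2 h3 hA (leq_addr _ _ : rho <= r0).
have sT : subgroup [set: G] by [].
have [c hc] := wall_nbhd_cofinite r0 e sT.
have he : wall_nbhd r0 e 1.
  by exists e; split; [exact: par_refl|rewrite act1 leq_addl].
exists (lam + c)%N => x y v hx hy hv.
have [z hz hvz] := hlam e x y v (wall_nbhd_stab he hx) (wall_nbhd_stab he hy) hv.
have [z' [_ hz'] hzz'] := hc z (conj hz I).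
by exists z' => //; have := dT v z z'; lia.
Qed.

Lemma count_image (T : eqType) (F : nat -> T) (P : pred nat) (n : nat) (s : seq T) :
  (forall i j, i < n -> j < n -> F i = F j -> i = j) ->
  (forall i, i < n -> P i -> F i \in s) -> count P (iota 0 n) <= size s.
Proof.
move=> Finj FP; rewrite -size_filter -(size_map F); apply: uniq_leq_size.
  rewrite map_inj_in_uniq ?filter_uniq ?iota_uniq // => i j.
  rewrite !mem_filter !mem_iota !add0n => /andP[_ hi] /andP[_ hj]; exact: Finj.
by move=> _ /mapP [i + ->]; rewrite mem_filter mem_iota add0n => /andP[hP hi]; apply: FP.
Qed.

(** * The wall criterion for a group stabilising a family of walls *)

Section CoreGroup.
Variables (n : nat) (T : 'I_n -> edge X) (L : set G) (s : nat).
Hypothesis s1 : 1 <= s.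
Hypothesis sL : subgroup L.
Hypothesis LT : forall l, L l -> forall i, wall_stab (T i) l.
Hypothesis chainL : forall x y, L x -> L y -> exists2 p, chain d L s x p & last x p = y.
Hypothesis qcL : forall e, (forall i, crossing hX (T i) e) ->
  exists C, quasiconvex_set d C (L `&` wall_stab e).

Let good : set (edge X) := [set e | forall i, crossing hX (T i) e].

Let good_act l e : L l -> good e -> good (eact a l e).
Proof.
move=> Ll ge i; apply: (crossing_par (LT Ll i)); apply: crossing_act; exact: ge.
Qed.

Let Linv l : L l -> L l^-1. Proof. by case: sL => _ _; apply. Qed.
Let Lmul l m : L l -> L m -> L (l * m). Proof. by case: sL => _ + _; apply. Qed.

Let unact l e : par (eact a l (eact a l^-1 e)) e.
Proof.
by apply: par_trans (par_sym (par_actM _ _ _)) _; rewrite mulgV; apply: par_act1.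
Qed.

Let wall_nbhd_unact r0 l e z : wall_nbhd r0 (eact a l^-1 e) z -> wall_nbhd r0 e (l * z).
Proof. by move=> h; apply: (wall_nbhd_par (unact l e)); apply: wall_nbhd_act. Qed.

(** Uniformity comes from translating by [L], which keeps walls good and brings them to the
    identity, where only finitely many classes occur. *)
Lemma wall_orbit_quasiconvex r0 : exists mu, forall e, good e ->
  quasiconvex_set d mu (wall_nbhd r0 e `&` L).
Proof.
pose P k N := forall f, k = cls f -> good f -> wall_nbhd r0 f 1 ->
  quasiconvex_set d N (wall_nbhd r0 f `&` L).
have [||mu hmu] := @finite_set_choice_bound _ _ P (walls_finite r0 0).
- move=> k m m' hm hP f kf gf hf x y v hx hy hv.
  by have [z hz hvz] := hP f kf gf hf x y v hx hy hv; exists z => //; apply: leq_trans hm.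
- move=> k _; case: (EM (exists f, [/\ k = cls f, good f & wall_nbhd r0 f 1])); last first.
    by move=> hn; exists 0 => f kf gf hf; case: hn; exists f.
  case=> f [kf gf hf]; have [C hC] := qcL gf; have [c hc] := wall_nbhd_cofinite r0 f sL.
  exists (4 * c + dl + C)%N => f' kf' gf' hf'.
  have -> : wall_nbhd r0 f' = wall_nbhd r0 f.
    have p : par f f' by apply/cls_eq; rewrite -kf.
    by apply/seteqP; split; apply: wall_nbhd_par => //; apply: par_sym.
  exact: wall_nbhd_stabI.
exists mu => e ge x y v [Cx Lx] [Cy Ly] hv.
pose f := eact a x^-1 e.
have hf1 : wall_nbhd r0 f 1 by rewrite -(mulVg x); exact: (wall_nbhd_act x^-1 Cx).
have hk : [set k | exists e, k = cls e /\ exists2 g, wall_nbhd r0 e g & d 1 g <= 0] (cls f).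
  by exists f; split=> //; exists 1; rewrite ?d0.
have [|||z [Cz Lz] hz] := hmu _ hk f erefl (good_act (Linv Lx) ge) hf1 1 (x^-1 * y) (x^-1 * v).
- by split=> //; case: sL.
- by split; [exact: (wall_nbhd_act x^-1 Cy)|exact: Lmul (Linv Lx) Ly].
- by move: hv; rewrite /btw -(mulVg x) !(word_distM hS).
exists (x * z); first by split; [exact: wall_nbhd_unact|exact: Lmul].
by rewrite -(word_distM hS x^-1) mulKg.
Qed.

Lemma wall_orbit_near r0 c : exists c', forall e (x : G), good e ->
  wall_nbhd r0 e `&` L !=set0 -> (exists2 z, wall_nbhd r0 e z & d x z <= c) ->
  (exists2 z, L z & d x z <= c) -> exists2 z, (wall_nbhd r0 e `&` L) z & d x z <= c'.
Proof.
pose P k N := forall f, k = cls f -> wall_nbhd r0 f `&` L !=set0 ->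
  exists2 z, (wall_nbhd r0 f `&` L) z & d 1 z <= N.
have [||N hN] := @finite_set_choice_bound _ _ P (walls_finite r0 (2 * c)).
- move=> k m m' hm hP f kf hf.
  by have [z hz hvz] := hP f kf hf; exists z => //; apply: leq_trans hm.
- move=> k _; case: (EM (exists f, k = cls f /\ wall_nbhd r0 f `&` L !=set0)); last first.
    by move=> hn; exists 0 => f kf hf; case: hn; exists f.
  case=> f [kf [z [Cz Lz]]]; exists (d 1 z) => f' kf' _; exists z => //; split=> //.
  by apply: (wall_nbhd_par _ Cz); apply/cls_eq; rewrite -kf.
exists (c + N)%N => e v ge [q [Cq Lq]] [z1 Cz1 hz1] [l Ll hl].
have hk : [set k | exists e, k = cls e /\ exists2 g, wall_nbhd r0 e g & d 1 g <= 2 * c]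
    (cls (eact a l^-1 e)).
  exists (eact a l^-1 e); split=> //; exists (l^-1 * z1); first exact: wall_nbhd_act.
  rewrite -(mulVg l) (word_distM hS).
  by have := dT l v z1; have := dC v l; lia.
have [|z [Cz Lz] hz] := hN _ hk _ erefl.
  by exists (l^-1 * q); split; [exact: wall_nbhd_act|exact: Lmul (Linv Ll) Lq].
exists (l * z); first by split; [exact: wall_nbhd_unact|exact: Lmul].
have := dT v l (l * z); rewrite (word_dist_mulr hS); lia.
Qed.

Section ExistsWall.
Variables (gv : X -> G) (rho B A : nat).
Hypothesis gv_dist : forall v, D (a (gv v) x0) v <= rho.
Hypothesis gv_adj : forall v w, adjacent v w -> d (gv v) (gv w) <= B.
Hypothesis gv_id : forall g, d g (gv (a g x0)) <= B.
Hypothesis orbA : forall g h, D (a g x0) (a h x0) <= A * d g h.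
Variable r0 : nat.
Hypothesis r0_rho : rho <= r0.

Let Y c : set G := [set x | forall i, exists2 z, wall_nbhd r0 (T i) z & d x z <= c].

(** If [e] does not cross [T i], one side of [T i] misses one side of [e]. Whichever of [x], [y]
    lies on that side of [e] is close to that side of [T i], and a short path there crosses [e]. *)
Lemma not_good_near c : exists R, forall x y e, Y c x -> Y c y ->
  side hX e (a x x0) != side hX e (a y x0) -> ~ good e ->
  (exists2 z, wall_nbhd r0 e z & d x z <= R) \/ (exists2 z, wall_nbhd r0 e z & d y z <= R).
Proof.
pose R0 := (A * c + r0 + 1)%N; exists (B + B * R0)%N => x y e Yx Yy hxy hg.
have [i [b [b' hb]]] : exists i b b', forall p, side hX (T i) p = b -> side hX e p <> b'.
  apply: contrapT => hn; apply: hg => i b b'; apply: contrapT => hn'; apply: hn.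
  by exists i, b, b' => p h1 h2; apply: hn'; exists p.
have near x' : Y c x' -> side hX e (a x' x0) = b' ->
    exists2 z, wall_nbhd r0 e z & d x' z <= B + B * R0.
  move=> Yx' sx; have [z Cz hz] := Yx' i.
  have [u [_ su hu]] := wall_nbhd_side b Cz.
  have : side hX e (a x' x0) != side hX e u by rewrite sx; apply/eqP => /esym; apply: hb.
  move/crossing_edge => [v [w [vw [p _ _ hd]]]].
  have [|z' hz' hd'] := @wall_near gv rho B gv_dist gv_adj gv_id r0 r0_rho e x' v.
    by exists w, vw.
  exists z' => //; apply: leq_trans hd' _; rewrite leq_add2l leq_mul2l; apply/orP; right.
  have := DT (a x' x0) (a z x0) u; have := orbA x' z.
  have : A * d x' z <= A * c by rewrite leq_mul2l hz orbT.
  rewrite /R0; lia.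
case: (eqVneq (side hX e (a x x0)) b') => sx; first by left; apply: near.
right; apply: near => //; move: hxy sx; clear.
by case: (side hX e (a x x0)); case: (side hX e (a y x0)); case: b'.
Qed.

(** The edges of a geodesic are dual to distinct walls, of which at most [size W] come near either
    end. Once there are more than twice as many, one is near neither end, and it is good by
    [not_good_near]. *)
Lemma exists_good_wall r c : exists M, forall x y, Y c x -> Y c y -> M <= d x y ->
  exists e, [/\ good e, side hX e (a x x0) != side hX e (a y x0),
    forall z, wall_nbhd r0 e z -> r < d x z & forall z, wall_nbhd r0 e z -> r < d y z].
Proof.
have [R1 hR1] := not_good_near c; pose R := maxn r R1.
have [W eW] := (finite_seqP _).1 (walls_finite r0 R).
exists (2 * B + B * (2 * size W) + 1)%N => x y Yx Yy hxy.
have [q [q0 qN hq]] := geodesic_path (a x x0) (a y x0) (edge_dist_metric hX) (@edge_dist_eq0 _ hX).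
set N := D (a x x0) (a y x0) in qN hq.
have hN : 2 * size W < N.
  rewrite ltnNge; apply/negP => h.
  have := orbit_expansive gv_adj gv_id x y; rewrite -/N.
  have : B * N <= B * (2 * size W) by rewrite leq_mul2l h orbT.
  lia.
have hadj i : i < N -> adjacent (q i) (q i.+1).
  by move=> hi; apply/(edge_dist_eq1 hX); rewrite hq ?subSnn //; lia.
have he i : exists e : edge X, i < N -> src e = q i /\ tgt e = q i.+1.
  case: (ltnP i N) => hi; first by exists (Edge (hadj i hi)).
  by exists (Edge (hadj 0 ltac:(lia))).
have [e hE] := choice he.
have hside i j : i < N -> j <= N -> side hX (e i) (q j) = (j <= i).
  move=> hi hj; have [h1 h2] := hE i hi; rewrite /side h1 h2.
  case: (leqP j i) => hji.
    by rewrite (hq j i) ?(hq j i.+1) //; lia.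
  by rewrite !(DC (q j)) (hq i j) ?(hq i.+1 j) //; lia.
have hinj i j : i < N -> j < N -> par (e i) (e j) -> i = j.
  wlog : i j / i < j => [W0 hi hj p|hij hi hj p].
    case: (ltngtP i j) => // h; first exact: W0.
    by apply/esym; apply: W0 => //; apply: par_sym.
  have := par_side hX (q j) (q j.+1) p.
  by rewrite !hside ?leqnn ?ltnn //; lia.
have hsep i : i < N -> side hX (e i) (a x x0) != side hX (e i) (a y x0).
  by move=> hi; rewrite -q0 -qN !hside //; lia.
have nearW x' f : (exists2 z, wall_nbhd r0 f z & d x' z <= R) -> cls (eact a x'^-1 f) \in W.
  case=> z Cz hz.
  suff : [set` W] (cls (eact a x'^-1 f)) by [].
  rewrite -eW; exists (eact a x'^-1 f); split=> //; exists (x'^-1 * z).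
    exact: wall_nbhd_act.
  by rewrite -(mulVg x') (word_distM hS).
have cnt x' : count (fun i => `[< exists2 z, wall_nbhd r0 (e i) z & d x' z <= R >]) (iota 0 N) <= size W.
  apply: (@count_image _ (fun i => cls (eact a x'^-1 (e i)))).
    move=> i j hi hj /cls_eq p; apply: hinj => //.
    apply: par_trans (par_sym (unact x' (e i))) _.
    by apply: par_trans (par_act x' p) _; apply: unact.
  by move=> i hi /asboolP; apply: nearW.
apply: contrapT => hn.
have hall i : i < N -> `[< exists2 z, wall_nbhd r0 (e i) z & d x z <= R >] ||
    `[< exists2 z, wall_nbhd r0 (e i) z & d y z <= R >].
  move=> hi; apply: contrapT => /negP; rewrite negb_or => /andP[/asboolPn hx /asboolPn hy].
  apply: hn; exists (e i); split.
  - apply: contrapT => hng; have [[z Cz hz]|[z Cz hz]] := hR1 x y (e i) Yx Yy (hsep i hi) hng.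
      by apply: hx; exists z => //; rewrite /R; lia.
    by apply: hy; exists z => //; rewrite /R; lia.
  - exact: hsep.
  - move=> z Cz; rewrite ltnNge; apply/negP => hz; apply: hx; exists z => //; rewrite /R; lia.
  - move=> z Cz; rewrite ltnNge; apply/negP => hz; apply: hy; exists z => //; rewrite /R; lia.
have := cnt x; have := cnt y.
set Px := fun i => _; set Py := fun i => _ => h1 h2.
have : count (predU Py Px) (iota 0 N) <= count Py (iota 0 N) + count Px (iota 0 N).
  by rewrite -count_predUI leq_addr.
have -> : count (predU Py Px) (iota 0 N) = N.
  rewrite -[RHS](size_iota 0 N); apply/eqP; rewrite -all_count; apply/allP => i.
  rewrite mem_iota add0n => /andP[_ hi] /=; rewrite /Px /Py /=; exact: hall.
lia.
Qed.

End ExistsWall.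

Theorem core_quasiconvex : exists C, quasiconvex_set d C L.
Proof.
have [gv [rho [B [h1 h2 h3 _]]]] := approximation; have [A hA] := orbit_lipschitz.
(* Large enough for [gv] to send carriers into neighbourhoods, for a step of length [s] across a
   wall to start near it, and for the walls of [T] to be near the identity, so that [L] lies in
   [Y 0]. *)
pose r0 := (rho + A * s + \max_i D x0 (src (T i)))%N.
have hr : rho <= r0 by rewrite /r0; lia.
have [lam hlam] := wall_nbhd_quasiconvex h1 h2 h3 hA hr.
have [mu hmu] := wall_orbit_quasiconvex r0.
pose Y c : set G := [set x | forall i, exists2 z, wall_nbhd r0 (T i) z & d x z <= c].
apply: (@chain_connected_quasiconvex _ d dl dM d4 (edge X)
  (fun e g => side hX e (a g x0)) (wall_nbhd r0) good L Y s lam mu s1) => //.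
- move=> e x y hxy hs; have hAs : A * s <= r0 by rewrite /r0; lia.
  exact: (wall_nbhd_crossing hA hr hAs hxy hs).
- move=> r c; exact: (exists_good_wall h1 h2 h3 hA hr).
- move=> l Ll i; exists l; last by rewrite d0.
  apply: wall_nbhd_stab (LT Ll i); exists (T i); split; first exact: par_refl.
  rewrite act1; apply: leq_trans (leq_addl _ _).
  exact: (leq_bigmax (F := fun j => D x0 (src (T j)))).
- move=> c; exists (4 * c + dl + lam)%N => x y v Yx Yy hv i.
  have [x' Cx hx] := Yx i; have [y' Cy hy] := Yy i.
  have hvv : d v v <= 0 by rewrite d0.
  have [z Cz hz] := quasiconvex_btw dM d4 (hlam (T i)) Cx Cy (btw_shift dM hv hx hy hvv).
  by exists z => //; lia.
- by move=> c c' hc x Yx i; have [z Cz hz] := Yx i; exists z => //; apply: leq_trans hc.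
- exact: wall_orbit_near.
Qed.

End CoreGroup.
End Action.

(** * Stabilisers of families of walls *)

Section QuasiconvexSubgroup.
Local Open Scope group_scope.
Variables (G : groupType) (S : set G).
Hypothesis fS : finite_set S.
Hypothesis hS : generates S [set: G].
Variable dl : nat.
Local Notation d := (word_dist hS).
Hypothesis d4 : four_point d dl.
Implicit Types g h x y : G.

Let dM := word_dist_metric hS.
Let d0 x : d x x = 0. Proof. by case: dM. Qed.
Let dC x y : d x y = d y x. Proof. by case: dM. Qed.
Let dT x y z : d x z <= d x y + d y z. Proof. by case: dM. Qed.

Lemma finitely_presented_chain (L : set G) : subgroup L -> finitely_presented L ->
  exists s, forall x y, L x -> L y -> exists2 p, chain d L s x p & last x p = y.
Proof.
move=> [L1 LM LV] [n [t [rels [eL _]]]].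
have [s hs] := finite_set_bound (fun i => d 1 (t i)) (finite_finset : finite_set [set: 'I_n]).
exists s => x y Lx Ly.
have : L (x^-1 * y) by apply: LM => //; apply: LV.
rewrite {1}eL => -[w _ ew].
have -> : y = x * word_eval t w by rewrite ew mulVKg.
elim: w x Lx {ew y Ly} => [|l w IH] x Lx.
  by exists [::] => //=; rewrite /word_eval big_nil mulg1.
have Ll : L (word_eval t [:: l]) by rewrite eL; exists [:: l].
have [p hp ep] := IH _ (LM _ _ Lx Ll).
exists (x * word_eval t [:: l] :: p) => /=; last first.
  by rewrite ep -[l :: w]cat1s word_eval_cat mulgA.
split=> //; first exact: LM.
rewrite word_dist_mulr /word_eval big_seq1; case: l.2; first exact: hs.
by rewrite word_distV; exact: hs.
Qed.

(** Carries bounded-step connectedness from the setwise stabiliser to the pointwise one, which is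
    coarsely dense in it. *)
Lemma chain_nearby (A B : set G) s c x p x' : (forall g, A g -> exists2 z, B z & d g z <= c) ->
  chain d A s x p -> B x' -> d x x' <= c -> B (last x p) ->
  exists2 p', chain d B (s + 2 * c) x' p' & last x' p' = last x p.
Proof.
move=> hAB; elim: p x x' => [|y p IH] x x' /=.
  by move=> _ Bx' hx Bx; exists [:: x] => //=; split=> //; rewrite dC; lia.
case=> Ay hxy hp Bx' hx Bl; have [y' By' hy'] := hAB y Ay.
have [p' hp' e'] := IH y y' hp By' hy' Bl.
exists (y' :: p') => //=; split=> //.
by have := dT x' x y'; have := dT x y y'; have := dC x x'; lia.
Qed.

(** * The intrinsic geometry of a quasiconvex subgroup *)

Section Subgroup.
Variables (H : set G) (C : nat).
Hypothesis sH : subgroup H.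
Hypothesis qH : quasiconvex_set d C H.

Definition short_gens : set G := [set g | H g /\ d 1 g <= 2 * C + 1].
Local Notation W := short_gens.

Let H1 : H 1. Proof. by case: sH. Qed.
Let HM x y : H x -> H y -> H (x * y). Proof. by case: sH => _ + _; apply. Qed.
Let HV x : H x -> H x^-1. Proof. by case: sH => _ _; apply. Qed.

(** Projecting the vertices of a geodesic to [H] moves each by at most [C], so consecutive
    projections differ by a generator. This makes intrinsic geodesics ambient quasigeodesics. *)
Lemma short_gens_dist x y : H x -> H y -> word_dist_le W (d x y) x y.
Proof.
move=> Hx Hy; have [p [hp p0 pn]] := geodesic_exists hS x y.
have hz i : exists z, i <= d x y -> [/\ H z, d (p i) z <= C, i = 0 -> z = x & i = d x y -> z = y].
  case: (EM (i = 0)) => [i0|hi0].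
    exists x => _; split=> //; first by rewrite i0 p0 d0.
    by move=> h; apply: (@word_dist_eq0 _ _ hS); lia.
  case: (EM (i = d x y)) => [iN|hiN].
    by exists y => _; split=> //; rewrite iN pn d0.
  case: (leqP i (d x y)) => hi; last by exists x.
  have [|z Hz hz] := qH (v := p i) Hx Hy; last by exists z.
  have e1 := geodesic_word_dist hS hp (_ : 0 <= i <= d x y).
  have e2 := geodesic_word_dist hS hp (_ : i <= d x y <= d x y).
  by rewrite /btw; move: (e1 ltac:(lia)) (e2 ltac:(lia)); rewrite p0 pn; lia.
have [z zP] := choice hz.
have key i : i <= d x y -> word_ball W i (x^-1 * z i).
  elim: i => [|i IH] hi.
    by have [_ _ e _] := zP 0 hi; rewrite e // mulVg; apply: word_ball1.
  have [Hz hpz _ _] := zP i (ltnW hi); have [Hz' hpz' _ _] := zP i.+1 hi.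
  have -> : x^-1 * z i.+1 = (x^-1 * z i) * ((z i)^-1 * z i.+1) by rewrite mulgA mulgK.
  suff Wz : W ((z i)^-1 * z i.+1).
    by have := word_ballM (IH (ltnW hi)) (word_ball_gen Wz); rewrite addn1.
  split; first by apply: HM => //; apply: HV.
  rewrite -(word_dist1 hS); have := dT (z i) (p i) (z i.+1); have := dT (p i) (p i.+1) (z i.+1).
  by have := dC (z i) (p i); rewrite (geodesic_word_dist hS hp); lia.
by have := key _ (leqnn _); have [_ _ _ e] := zP _ (leqnn _); rewrite e.
Qed.

Lemma short_gens_sub n x y : H x -> word_dist_le W n x y -> H y.
Proof.
move=> Hx [w [_ hw e]]; rewrite -(mulVKg x y) e; apply: HM => //.
elim: w hw {e} => [|z w IH] hw; first by rewrite big_nil.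
rewrite big_cons; apply: HM; last by apply: IH => t ht; apply: hw; rewrite in_cons ht orbT.
case: (hw z (mem_head _ _)) => -[hz _] //.
by rewrite -[z]invgK; apply: HV.
Qed.

Lemma short_gens_finite : finite_set W.
Proof. by apply: sub_finite_set (word_dist_finite hS (2 * C + 1) fS) => g []. Qed.

Lemma short_gens_generates : generates W H.
Proof.
apply/seteqP; split=> [g Hg|g [n _ h]].
  by exists (d 1 g) => //; have := short_gens_dist H1 Hg; rewrite /word_dist_le invg1 mul1g.
by apply: (@short_gens_sub n 1) => //; rewrite /word_dist_le invg1 mul1g.
Qed.

Lemma short_gens_geodesic x y n p : H x -> geodesic_between W x y n p ->
  [/\ forall i, i <= n -> H (p i), quasi_geodesic d (2 * C + 1) 1 0 p n, p 0 = x & p n = y].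
Proof.
move=> Hx [hp p0 pn].
have Hp i : i <= n -> H (p i).
  move=> hi; apply: (@short_gens_sub i x) => //; rewrite -p0.
  by have [h _] := hp 0 i hi; rewrite subn0 in h.
split=> //; split=> [i hi|i j hij].
  have [] := hp i i.+1 ltac:(lia); rewrite subSnn => -[w [sw hw e]] _.
  case: w sw hw e => [|z [|//]] _ hw e.
    rewrite (word_dist1 hS) e big_nil d0; lia.
  rewrite (word_dist1 hS) e big_seq1; case: (hw z (mem_head _ _)) => -[_] //.
  by rewrite word_distV.
rewrite mul1n addn0; have [_] := hp i j hij; apply; apply: short_gens_dist; apply: Hp; lia.
Qed.

(** Points of an intrinsic geodesic are almost between its ends in the ambient metric; there the
    triangle splits, and the Morse lemma leads back to the other two intrinsic sides. *)
Lemma short_gens_slim : exists delta, slim_triangles W H delta.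
Proof.
have [R hR] := quasi_geodesic_btw dM d4 (2 * C + 1) 1 0.
have [E hE] := quasi_geodesic_near dM d4 (2 * C + 1) 1 0 (R + dl).
exists E => x y z nxy nyz nxz pxy pyz pxz Hx Hy Hz hxy hyz hxz i hi.
have [H_xy qxy xy0 xyn] := short_gens_geodesic Hx hxy.
have [H_yz qyz yz0 yzn] := short_gens_geodesic Hy hyz.
have [H_xz qxz xz0 xzn] := short_gens_geodesic Hx hxz.
have dW g h : H g -> H h -> d g h <= E -> word_dist_le W E g h.
  by move=> Hg Hh le; apply: word_ball_mono le _; apply: short_gens_dist.
have := hR _ _ qxy i hi; rewrite xy0 xyn => hb.
case: (btw_split dM d4 z hb) => h.
  have [|j hj hd] := hE _ _ qxz (pxy i); first by rewrite xz0 xzn.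
  by right; exists j => //; apply: dW => //; [exact: H_xy|exact: H_xz].
have [|j hj hd] := hE _ _ qyz (pxy i); first by rewrite yz0 yzn; apply: btwC h.
by left; exists j => //; apply: dW => //; [exact: H_xy|exact: H_yz].
Qed.

Lemma quasiconvex_hyperbolic : hyperbolic H.
Proof.
exists W; split; [exact: short_gens_finite|exact: short_gens_generates|exact: short_gens_slim].
Qed.

Lemma quasiconvex_in_subgroup K c : K `<=` H -> quasiconvex_set d c K -> quasiconvex K H.
Proof.
move=> KH qK; have [R hR] := quasi_geodesic_btw dM d4 (2 * C + 1) 1 0.
exists W; split; [exact: short_gens_finite|exact: short_gens_generates|split=> //].
exists (R + dl + c)%N => g h n p Kg Kh hp i hi.
have [Hp qp p0 pn] := short_gens_geodesic (KH _ Kg) hp.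
have := hR _ _ qp i hi; rewrite p0 pn => hb.
have [z Kz hz] := quasiconvex_btw dM d4 qK Kg Kh hb.
exists z => //; apply: word_ball_mono hz _; apply: short_gens_dist; [exact: Hp|exact: KH].
Qed.

End Subgroup.
End QuasiconvexSubgroup.

(** * Setwise and pointwise stabilisers of families of walls *)

Section Permuting.
Local Open Scope group_scope.
Variables (G : groupType) (X : cubeComplex) (a : cubicalAction G X) (H : set G).
Hypothesis sH : subgroup H.

Section Family.
Variables (n : nat) (T : 'I_n -> edge X).

Definition perm_stab : set G := [set g | [/\ H g, permutes a T g & permutes a T g^-1]].
Definition fix_stab : set G := [set g | H g /\ forall i, wall_stab a (T i) g].
(** Takes finitely many values on [perm_stab] and determines the coset modulo [fix_stab], which
    therefore has finite index. *)
Definition wall_type (g : G) (i : 'I_n) := cls (eact a g^-1 (T i)).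

Lemma fix_stab_subgroup : subgroup fix_stab.
Proof.
have [h1 hM hV] := sH; split.
- by split=> // i; have [] := wall_stab_subgroup a (T i).
- move=> g h [Hg fg] [Hh fh]; split; first exact: hM.
  by move=> i; have [_ m _] := wall_stab_subgroup a (T i); apply: m.
- move=> g [Hg fg]; split; first exact: hV.
  by move=> i; have [_ _ m] := wall_stab_subgroup a (T i); apply: m.
Qed.

Lemma fix_perm_stab : fix_stab `<=` perm_stab.
Proof.
move=> g [Hg fg]; split=> // i; exists i; first exact: fg.
by have [_ _ m] := wall_stab_subgroup a (T i); apply: m; apply: fg.
Qed.

Lemma perm_stab_subgroup : subgroup perm_stab.
Proof.
have [h1 hM hV] := sH.
have P1 : permutes a T 1 by move=> i; exists i; apply: par_act1.
have PM g h : permutes a T g -> permutes a T h -> permutes a T (g * h).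
  move=> pg ph i; have [j pj] := ph i; have [k pk] := pg j; exists k.
  apply: par_trans (par_actM _ _ _ _) _; apply: par_trans pk; exact: par_act.
split; first by split=> //; rewrite invg1.
  by move=> g h [Hg pg pg'] [Hh ph ph']; split; [exact: hM|exact: PM|rewrite invgM; exact: PM].
by move=> g [Hg pg pg']; split; [exact: hV|by []|rewrite invgK].
Qed.

Lemma wall_type_finite : finite_set (wall_type @` perm_stab).
Proof.
apply: (@sub_finite_set _ _ [set f : 'I_n -> set (set X) |
  forall i, range (fun j => cls (T j)) (f i)]).
  move=> _ [g [_ _ pg] <-] i; have [j pj] := pg i; exists j => //.
  by apply/cls_eq; apply: par_sym.
by apply: finite_set_functions; apply: finite_image; apply: finite_finset.
Qed.

Lemma wall_type_eq g h : perm_stab g -> perm_stab h -> wall_type g = wall_type h ->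
  fix_stab (g * h^-1).
Proof.
have [h1 hM hV] := sH.
move=> [Hg _ _] [Hh _ _] e; split; first by apply: hM => //; apply: hV.
move=> i; have /cls_eq p := congr1 (fun f => f i) e.
apply: par_trans (par_actM _ _ _ _) _; apply: par_trans (par_act _ g (par_sym p)) _.
by apply: par_trans (par_sym (par_actM _ _ _ _)) _; rewrite mulgV; apply: par_act1.
Qed.

End Family.

Variable R : realType.

Lemma edge_chart (e : edge X) : exists c m (f : hypercube m -> X) x i,
  chart c f /\ ends e = [set f x; f (flip x i)].
Proof.
have [n ce] := edgeP e; have [m [f hf]] := cubeP ce.
have [x ex] := chartP hf (or_introl erefl : [set src e; tgt e] (src e)).
have [y ey] := chartP hf (or_intror erefl : [set src e; tgt e] (tgt e)).
have := edgeP e; rewrite ex ey => /(chart_adjacentP hf) [i ei].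
by exists [set src e; tgt e], m, f, x, i; rewrite /ends -ei -ex -ey.
Qed.

(** Treats a hyperplane as a family of one, so that [stab_family] covers its stabiliser. *)
Lemma dual_family (e : edge X) :
  dual_hyperplane (ends e) = @family_set R X 1 (fun _ => e).
Proof.
apply/seteqP; split=> [w hw|w [_ hw]]; last exact: (hw ord0).
split=> //; case: hw => c [n [f [p [i [hf up _ ew _]]]]].
by exists c, n, f, p.
Qed.

Lemma dual_family_nonempty (e : edge X) : @family_set R X 1 (fun _ => e) !=set0.
Proof.
have [c [m [f [x [i [hf ee]]]]]] := edge_chart e.
apply: (@family_cube_set R _ _ _ _ _ _ hf) => _; exists i, x; rewrite ee; exact: rst_refl.
Qed.

Lemma stab_dual (e : edge X) :
  stab a H (dual_hyperplane (ends e) : set (X -> R)) = H `&` wall_stab a e.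
Proof.
rewrite dual_family stab_family; last exact: dual_family_nonempty.
apply/seteqP; split=> [g [Hg /(_ ord0) [_ pg] _]|g [Hg pg]]; first by [].
split=> // i; exists ord0 => //.
by have [_ _ m] := wall_stab_subgroup a e; apply: m.
Qed.

Lemma hyperplaneP (k : set (X -> R)) : hyperplane k <-> exists e, k = dual_hyperplane (ends e).
Proof.
split=> [[v [w [vw ->]]]|[e ->]]; first by exists (Edge vw).
by exists (src e), (tgt e); split=> //; apply: edgeP.
Qed.

Lemma hyperplane_intersectionP (t : set (X -> R)) : hyperplane_intersection t <->
  exists n (T : 'I_n -> edge X), t = @family_set R X n T /\ @family_set R X n T !=set0.
Proof.
split=> [[n [h [hh -> t0]]]|[n [T [-> T0]]]].
  have [T hT] := choice (fun i => (hyperplaneP (h i)).1 (hh i)).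
  have -> : h = fun i => dual_hyperplane (ends (T i)) by apply/funext.
  exists n, T; split=> //; move: t0.
  by have -> : h = fun i => dual_hyperplane (ends (T i)) by apply/funext.
exists n, (fun i => dual_hyperplane (ends (T i))); split=> // i.
by apply/hyperplaneP; exists (T i).
Qed.

End Permuting.

(** * The equivalences *)

Lemma crossing_not_par (X : cubeComplex) (hX : CAT0 X) (e f : edge X) :
  crossing hX e f -> ~ par e f.
Proof.
move=> cr p; have [x [h1 h2]] := cr true true; have [y [h3 h4]] := cr true false.
by have := par_side hX x y p; rewrite h1 h2 h3 h4.
Qed.

(** The walls are dual to edges of one cube, in distinct directions because crossing walls are not
    parallel. *)
Lemma crossing_family_size (X : cubeComplex) (hX : CAT0 X) : finite_dimensional X ->
  exists N, forall n (T : 'I_n -> edge X) v, (forall i j, i <> j -> crossing hX (T i) (T j)) ->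
    (forall i, carrier (T i) v) -> n <= N.
Proof.
move=> [N hN]; exists N => n T v cr hv.
have [c [m [f [cc hf hT]]]] := common_cube cr hv.
have [j hj] := choice hT; have := hN _ _ _ hf; apply: leq_trans.
suff jI : injective j by have := leq_card j jI; rewrite !card_ord.
move=> i i' e; apply: contrapT => /cr /crossing_not_par; apply.
have [x px] := hj i; have [x' px'] := hj i'; rewrite /par.
apply: rst_trans (px) _; apply: rst_trans (rst_sym _ _ _ _ px').
by rewrite -e; apply: chart_parallel hf.
Qed.

Section Main.
Local Open Scope group_scope.
Variables (R : realType) (G : groupType) (X : cubeComplex) (a : cubicalAction G X).
Variable H : set G.
Hypothesis hX : CAT0 X.
Hypothesis dX : finite_dimensional X.
Hypothesis pa : proper_action a.
Hypothesis ca : cocompact_action a.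
Hypothesis sH : subgroup H.

(** The argument takes place inside [H], where the pointwise stabiliser is an intersection of
    quasiconvex subgroups. *)
Lemma hyperbolic_wall_stabs_finitely_presented : hyperbolic H ->
  (forall e, quasiconvex (H `&` wall_stab a e) H) ->
  forall n (T : 'I_n -> edge X), finitely_presented (perm_stab a H T).
Proof.
move=> hypH qH n T; pose M := subgroup_sort sH.
have [S [fS hS [del slim]]] := sub_hyperbolic sH hypH.
have d4 := slim_four_point hS slim.
have sP := perm_stab_subgroup a sH T.
apply: (sub_finitely_presented (sM := sH)); first by move=> g [].
have [||||C hC] := @quasiconvex_setI _ S fS hS _ d4 n
  (fun i => @sub_set G H sH (H `&` wall_stab a (T i))) (@sub_set G H sH (perm_stab a H T)).
- move=> i; apply: sub_subgroup; have [h1 hM hV] := sH.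
  have [w1 wM wV] := wall_stab_subgroup a (T i).
  split=> // [g h [Hg fg] [Hh fh]|g [Hg fg]]; split; by [apply: hM|apply: wM|apply: hV|apply: wV].
- by move=> i; apply: quasiconvex_word_dist => //; apply: sub_quasiconvex.
- move=> g hg; apply: fix_perm_stab; split; last by move=> i; case: (hg i).
  by have := valP g; rewrite inE.
- have [||c hc] := @cofinite_types _ S hS _ (fun g => wall_type a T (val g))
    (@sub_set G H sH (fix_stab a H T)) (@sub_set G H sH (perm_stab a H T)).
  + apply: (@sub_finite_set _ _ (wall_type a T @` perm_stab a H T)); last exact: wall_type_finite.
    move=> _ [g hg <-].
    by exists (val g).
  + move=> g h hg hh e; exact: (wall_type_eq sH hg hh e).
  + exists c => b hb; have [z hz hd] := hc b hb; exists z => // i.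
    by case: hz => Hz hz; exact: (conj Hz (hz i)).
apply: (quasiconvex_finitely_presented fS d4 _ hC).
exact: sub_subgroup.
Qed.

Variable S : set G.
Hypothesis fS : finite_set S.
Hypothesis hS : generates S [set: G].
Variable dl : nat.
Local Notation d := (word_dist hS).
Hypothesis d4 : four_point d dl.

Lemma fix_stab_cofinite n (T : 'I_n -> edge X) :
  exists c, forall g, perm_stab a H T g -> exists2 z, fix_stab a H T z & d g z <= c.
Proof.
apply: (@cofinite_types _ S hS _ (wall_type a T)); first exact: wall_type_finite.
by move=> g h hg hh; apply: wall_type_eq.
Qed.

Lemma quasiconvex_perm_stab_finitely_presented n (T : 'I_n -> edge X) :
  (exists C, quasiconvex_set d C H) -> finitely_presented (perm_stab a H T).
Proof.
move=> qH; have sP := perm_stab_subgroup a sH T.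
(* The pointwise stabiliser as an intersection: [H] at index 0, then the wall stabilisers. *)
pose A (i : 'I_n.+1) : set G := if unlift ord0 i is Some j then wall_stab a (T j) else H.
have [||||C hC] := @quasiconvex_setI G S fS hS _ d4 n.+1 A (perm_stab a H T).
- by move=> i; rewrite /A; case: unlift => // j; apply: wall_stab_subgroup.
- move=> i; rewrite /A; case: unlift => // j.
  have [[[x0 _] _ _] _] := hX.
  exact: (wall_stab_quasiconvex hX pa ca fS d4 x0).
- move=> g hg; apply: fix_perm_stab => //; split.
    by have := hg ord0; rewrite /A unlift_none.
  by move=> i; have := hg (lift ord0 i); rewrite /A liftK.
- have [c hc] := fix_stab_cofinite T; exists c => b hb.
  have [z hz hd] := hc b hb; exists z => // i.
  by case: hz => Hz hz; rewrite /A; case: unlift => [j|] //; apply: hz.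
exact: (quasiconvex_finitely_presented fS d4 sP hC).
Qed.

(** Adding to [T] a wall crossing all of it yields exactly the intersections whose quasiconvexity
    the criterion demands. [common_carrier] preserves the common vertex, so the dimension bounds the
    number of walls and grounds the induction. *)
Lemma fix_stab_quasiconvex :
  (forall t : set (X -> R), hyperplane_intersection t -> finitely_presented (stab a H t)) ->
  forall n (T : 'I_n -> edge X) v, (forall i j, i <> j -> crossing hX (T i) (T j)) ->
    (forall i, carrier (T i) v) -> exists C, quasiconvex_set d C (fix_stab a H T).
Proof.
move=> fpt; have [N hN] := crossing_family_size hX dX.
suff main k n (T : 'I_n -> edge X) v : N < n + k ->
    (forall i j, i <> j -> crossing hX (T i) (T j)) ->
    (forall i, carrier (T i) v) -> exists C, quasiconvex_set d C (fix_stab a H T).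
  by move=> n T v; apply: (main N.+1); rewrite addnS ltnS leq_addl.
elim: k n T v => [|k IH] n T v hk cr hv.
  by have := hN n T v cr hv; rewrite addn0 in hk; rewrite leqNgt hk.
have T0 : @family_set R X n T !=set0.
  by have [c [m [f [_ hf hT]]]] := common_cube cr hv; apply: family_cube_set hf hT.
have fpP : finitely_presented (perm_stab a H T).
  by rewrite /perm_stab -(stab_family a H T0); apply: fpt; apply/hyperplane_intersectionP; exists n, T.
have [s hs] := finitely_presented_chain hS (perm_stab_subgroup a sH T) fpP.
have [c hc] := fix_stab_cofinite T.
have [[[x0 _] _ _] _] := hX.
(* The successor makes the step length at least 1, as the criterion requires. *)
apply: (@core_quasiconvex _ _ a hX pa ca S fS hS dl d4 x0 n T _ (s + 2 * c).+1) => //.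
- exact: fix_stab_subgroup.
- by move=> l [].
- move=> x y Lx Ly.
  have [p hp ep] := hs x y (fix_perm_stab Lx) (fix_perm_stab Ly).
  have [|p' hp' ep'] := chain_nearby hc hp Lx _ (eq_ind_r _ Ly ep).
    by case: (word_dist_metric hS) => ->.
  exists p'; last by rewrite ep' ep.
  elim: p' {ep ep'} (x) hp' => //= z p' IHp x' [h1 h2 h3]; split=> //; first by apply: ltnW.
  exact: IHp.
- move=> e ge.
  pose T' (i : 'I_n.+1) : edge X := if unlift ord0 i is Some j then T j else e.
  have [v' [hv' ev']] := common_carrier ge hv.
  have [|||C hC] := IH n.+1 T' v'.
  + by rewrite addSnnS.
  + move=> i j; rewrite /T'; case: (unliftP ord0 i) => [i'|] ->; case: (unliftP ord0 j) => [j'|] -> //.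
    * by move=> nij; apply: cr => e'; apply: nij; rewrite e'.
    * by move=> _; apply: crossing_sym; apply: ge.
  + by move=> i; rewrite /T'; case: unlift.
  exists C; suff -> : fix_stab a H T `&` wall_stab a e = fix_stab a H T' by [].
  apply/seteqP; split=> g.
    by case=> -[Hg hg] eg; split=> // i; rewrite /T'; case: unlift.
  case=> Hg hg; split; last by have := hg ord0; rewrite /T' unlift_none.
  by split=> // i; have := hg (lift ord0 i); rewrite /T' liftK.
Qed.

Lemma wall_stabs_quasiconvex : finitely_presented H ->
  (forall e, exists C, quasiconvex_set d C (H `&` wall_stab a e)) ->
  exists C, quasiconvex_set d C H.
Proof.
move=> fpH qH; have [s hs] := finitely_presented_chain hS sH fpH.
have [[[x0 _] _ _] _] := hX.
have hT (i : 'I_0) : exists e : edge X, True by case: i.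
have [T _] := choice hT.
apply: (@core_quasiconvex _ _ a hX pa ca S fS hS dl d4 x0 0 T _ s.+1) => //.
- by move=> l _ [].
- move=> x y Lx Ly; have [p hp ep] := hs x y Lx Ly; exists p => //.
  elim: p {ep Ly} x {Lx} hp => //= z p IH x [h1 h2 h3]; split=> //; first by apply: ltnW.
  exact: IH.
Qed.

End Main.

Theorem theorem1p1 (R : realType) (G : groupType) (X : cubeComplex)
    (a : cubicalAction G X) (H : set G) :
  hyperbolic [set: G] ->
  CAT0 X -> finite_dimensional X ->
  proper_action a -> cocompact_action a ->
  subgroup H -> finitely_presented H ->
  [<-> quasiconvex H [set: G];
       forall t : set (X -> R),
         hyperplane_intersection t -> finitely_presented (stab a H t);
       forall k : set (X -> R),
         hyperplane k -> quasiconvex (stab a H k) [set: G];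
       hyperbolic H /\
         forall k : set (X -> R),
           hyperplane k -> quasiconvex (stab a H k) H].
Proof.
move=> [S [fS hS [del slim]]] hX dX pa ca sH fpH.
have d4 := slim_four_point hS slim.
(* For the empty family the pointwise stabiliser is [H] itself. *)
have fix_all : (forall t : set (X -> R), hyperplane_intersection t -> finitely_presented (stab a H t)) ->
    exists C, quasiconvex_set (word_dist hS) C H.
  move=> fpt; have [[[x0 _] _ _] _] := hX.
  have hT (i : 'I_0) : exists e : edge X, True by case: i.
  have [T _] := choice hT.
  have [||C hC] := fix_stab_quasiconvex (hX := hX) dX pa ca sH fS d4 fpt (T := T) (v := x0).
  - by case.
  - by case.
  - suff -> : H = fix_stab a H T by exists C.
    by apply/seteqP; split=> [g Hg|g []//]; split=> // -[].
tfae.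
- move=> /(quasiconvex_word_dist fS d4) qH t /hyperplane_intersectionP [n [T [-> T0]]].
  rewrite (stab_family a H T0).
  exact: (quasiconvex_perm_stab_finitely_presented hX pa ca sH fS d4 T qH).
- move=> fpt k /hyperplaneP [e ->]; rewrite stab_dual.
  have [||C hC] := fix_stab_quasiconvex (hX := hX) dX pa ca sH fS d4 fpt (T := fun _ : 'I_1 => e) (v := src e).
  + by move=> i j; rewrite !ord1.
  + by move=> _; exists (tgt e), (edgeP e); case: e => ? ? ?; apply: par_refl.
  apply: (quasiconvex_intro fS (C := C)).
  suff -> : H `&` wall_stab a e = fix_stab a H (fun _ : 'I_1 => e) by [].
  by apply/seteqP; split=> g [Hg hg]; split=> //; apply: hg ord0.
- move=> qk.
  have qe e : exists C, quasiconvex_set (word_dist hS) C (H `&` wall_stab a e).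
    apply: (quasiconvex_word_dist fS d4); rewrite -(stab_dual a H R); apply: qk.
    by apply/hyperplaneP; exists e.
  have [C hC] := wall_stabs_quasiconvex hX pa ca sH fS d4 fpH qe.
  split; first exact: (quasiconvex_hyperbolic fS d4 sH hC).
  move=> k /hyperplaneP [e ->]; rewrite stab_dual //.
  have [c hc] := qe e.
  by apply: (quasiconvex_in_subgroup fS d4 sH hC _ hc) => g [].
- case=> hypH qk.
  have qe e : quasiconvex (H `&` wall_stab a e) H.
    by rewrite -(stab_dual a H R); apply: qk; apply/hyperplaneP; exists e.
  (* The cycle is closed through (2), since finite presentability of all stabilisers already gives
     quasiconvexity of [H]. *)
  have [|C hC] := fix_all; last exact: (quasiconvex_intro fS hC).
  move=> t /hyperplane_intersectionP [n [T [-> T0]]]; rewrite (stab_family a H T0).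
  exact: hyperbolic_wall_stabs_finitely_presented.
Qed.
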